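(* Let $X$ be a simple finite CW-complex, let $A\subset X$ be a cofibration, and let $m\ge \dim(X)$. Let $X(m)$ denote the $m$-th Postnikov stage of $X$, chosen so that $X\to X(m)$ is a cofibration (and thus $A\to X(m)$ is also a cofibration). Then there is an isomorphism of groups $\pi_0(\mathrm{aut}_A(X(m)))\cong \pi_0(\mathrm{aut}_A(X))$.
   Context: For a cofibration $A\subset Y$, $\mathrm{aut}_A(Y)$ is the topological monoid of self-homotopy equivalences of $Y$ that restrict to the identity on $A$, and $\pi_0(\mathrm{aut}_A(Y))$ is its group of path components under composition. The $m$-th Postnikov stage of $X$ is a space $X(m)$ with a map $X\to X(m)$ inducing isomorphisms on $\pi_i$ for $i\le m$ and with $\pi_i(X(m))=0$ for $i>m$.
   Formalization: The Postnikov stage X(m) is additionally assumed to have the homotopy type of a CW complex; for arbitrary spaces X(m) the claim fails (X = A = point, m = 0, X(m) the square of the Warsaw circle). *)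

(* Defs.v *)
From HB Require Import structures.
From mathcomp Require Import all_boot all_order all_algebra generic_quotient.
From mathcomp Require Import all_classical all_reals all_analysis.
Import Order.TTheory GRing.Theory Num.Theory.
Import numFieldNormedType.Exports.

Set Implicit Arguments.
Unset Strict Implicit.
Unset Printing Implicit Defensive.

Local Open Scope classical_set_scope.
Local Open Scope ring_scope.
Local Open Scope quotient_scope.

Definition mksub (T : Type) (A : set T) (x : T) (xA : x \in A) : A :=
  exist (fun x => x \in A) x xA.

Definition uitv (R : realType) : set R := [set t | 0 <= t <= 1].
Arguments uitv : clear implicits.

Lemma uitv0_subproof (R : realType) : (0 : R) \in uitv R.
Proof. by rewrite inE /uitv /= lexx ler01. Qed.
Lemma uitv1_subproof (R : realType) : (1 : R) \in uitv R.
Proof. by rewrite inE /uitv /= lexx ler01. Qed.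

Definition I0 (R : realType) : uitv R := mksub (uitv0_subproof R).
Definition I1 (R : realType) : uitv R := mksub (uitv1_subproof R).
Arguments I0 {R}.
Arguments I1 {R}.

Definition homotopic_rel (R : realType) (X Y : topologicalType) (A : set X)
    (f g : X -> Y) : Prop :=
  exists H : uitv R * X -> Y,
    [/\ continuous H,
        forall x, H (I0, x) = f x,
        forall x, H (I1, x) = g x
      & forall t x, A x -> H (t, x) = f x].

Definition homotopic (R : realType) (X Y : topologicalType) (f g : X -> Y) :=
  homotopic_rel R set0 f g.

Definition homotopy_equivalence (R : realType) (X Y : topologicalType)
    (f : X -> Y) : Prop :=
  continuous f /\ exists g : Y -> X,
    [/\ continuous g, homotopic R (g \o f) id & homotopic R (f \o g) id].

Definition joined (R : realType) (T : topologicalType) (x y : T) : Prop :=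
  exists g : uitv R -> T, [/\ continuous g, g I0 = x & g I1 = y].

Definition path_connected (R : realType) (T : topologicalType) : Prop :=
  [set: T] !=set0 /\ forall x y : T, joined R x y.

Lemma continuous_compT (X Y Z : topologicalType) (g : Y -> Z) (f : X -> Y) :
  continuous g -> continuous f -> continuous (g \o f).
Proof. by move=> cg cf x; apply: continuous_comp; [exact: cf|exact: cg]. Qed.

Lemma continuous_pair (S T U : topologicalType) (f : S -> T) (g : S -> U) :
  continuous f -> continuous g -> continuous (fun x => (f x, g x)).
Proof. by move=> cf cg x; apply: cvg_pair; [exact: cf|exact: cg]. Qed.

Lemma continuous_fst (S T : topologicalType) : continuous (@fst S T).
Proof. by move=> x; exact: cvg_fst. Qed.

Lemma continuous_snd (S T : topologicalType) : continuous (@snd S T).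
Proof. by move=> x; exact: cvg_snd. Qed.

Section Concatenation.
Context {R : realType}.
Local Notation I := (uitv R).

Lemma continuous_closed_cover (S T : topologicalType) (A B : set S)
    (f g h : S -> T) : closed A -> closed B -> A `|` B = setT ->
  continuous g -> continuous h -> {in A, f =1 g} -> {in B, f =1 h} ->
  continuous f.
Proof.
move=> cA cB AB cg ch fg fh; apply/continuous_closedP => W cW.
suff -> : f @^-1` W = (A `&` g @^-1` W) `|` (B `&` h @^-1` W).
  by apply: closedU; apply: closedI => //; [move/continuous_closedP: cg|
    move/continuous_closedP: ch]; apply.
apply/seteqP; split=> [x Wfx|x [[Ax]|[Bx]]] /=; last 2 first.
- by rewrite fg ?inE.
- by rewrite fh ?inE.
have : (A `|` B) x by rewrite AB.
move=> [Ax|Bx]; [left|right]; split => //=.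
- by rewrite -fg ?inE.
- by rewrite -fh ?inE.
Qed.

Definition clamp (r : R) : R := Num.max 0 (Num.min r 1).

Lemma clamp_subproof r : clamp r \in uitv R.
Proof.
by rewrite inE /uitv /= /clamp le_max lexx /= ge_max ler01 /= ge_min lexx orbT.
Qed.

Definition toI (r : R) : I := mksub (clamp_subproof r).

Lemma toI0 r : r <= 0 -> toI r = I0.
Proof.
move=> r0; apply/val_inj => /=; rewrite /clamp min_l; first by rewrite max_l.
exact: le_trans ler01.
Qed.

Lemma toI1 r : 1 <= r -> toI r = I1.
Proof. by move=> r1; apply/val_inj => /=; rewrite /clamp min_r// max_r. Qed.

Lemma continuous_into (T S : topologicalType) (A : set S) (f : T -> A) :
  continuous (set_val \o f) -> continuous f.
Proof.
move=> cf; apply/continuousP => U [V oV <-].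
rewrite -[X in open X]/((set_val \o f) @^-1` V).
by move/continuousP: cf; apply.
Qed.

Lemma continuous_set_val (S : topologicalType) (A : set S) :
  continuous (set_val : A -> S).
Proof. exact: initial_continuous. Qed.

Lemma continuous_toI : continuous toI.
Proof.
apply: continuous_into => r.
have cst_cont (c : R) : {for r, continuous (cst c : R -> R^o)}.
  by exact: cvg_cst.
have id_cont : {for r, continuous (id : R -> R^o)} by exact: cvg_id.
exact: (continuous_max (cst_cont 0) (continuous_min id_cont (cst_cont 1))).
Qed.

Definition concat (X T : Type) (H K : I * X -> T) (p : I * X) : T :=
  let r := set_val p.1 : R in
  if r <= 2^-1 then H (toI (2 * r), p.2) else K (toI (2 * r - 1), p.2).

Definition reverse (X T : Type) (H : I * X -> T) (p : I * X) : T :=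
  H (toI (1 - set_val p.1), p.2).

Lemma continuous_reparam (X T : topologicalType) (H : I * X -> T) (u : R -> R) :
  continuous u -> continuous H ->
  continuous (fun p : I * X => H (toI (u (set_val p.1)), p.2)).
Proof.
move=> cu cH.
apply: (@continuous_compT _ _ _ H (fun p : I * X => (_, p.2))) => //.
apply: continuous_pair; last exact: continuous_snd.
apply: (@continuous_compT _ _ _ (toI \o u \o set_val) fst);
  last exact: continuous_fst.
apply: continuous_compT; last exact: continuous_set_val.
by apply: continuous_compT => //; exact: continuous_toI.
Qed.

Lemma continuous_concat (X T : topologicalType) (H K : I * X -> T) :
  continuous H -> continuous K -> (forall x, H (I1, x) = K (I0, x)) ->
  continuous (concat H K).
Proof.
move=> cH cK HK.
pose r (p : I * X) : R := set_val p.1.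
have cr : continuous r.
  by apply: (@continuous_compT _ _ _ set_val fst);
    [exact: continuous_set_val|exact: continuous_fst].
apply: (@continuous_closed_cover _ _ (r @^-1` [set t | t <= 2^-1])
  (r @^-1` [set t | 2^-1 <= t])
  _ (fun p => H (toI (2 * set_val p.1), p.2))
  (fun p => K (toI (2 * set_val p.1 - 1), p.2))).
- by move/continuous_closedP: cr; apply; exact: closed_le.
- by move/continuous_closedP: cr; apply; exact: closed_ge.
- by apply/seteqP; split=> // p _ /=; apply/orP; exact: le_total.
- apply: (@continuous_reparam _ _ H (fun s => 2 * s)) => // s.
  exact: mulrl_continuous.
- apply: (@continuous_reparam _ _ K (fun s => 2 * s - 1)) => // s.
  by apply: cvgB; [exact: mulrl_continuous|exact: cvg_cst].
- by move=> p; rewrite inE /= /concat -/(r p) => ->.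
- move=> p; rewrite inE /= /concat -/(r p) => rp.
  case: ifPn => // rp'; have {rp rp'}-> : r p = 2^-1 by apply/le_anti/andP.
  by rewrite divff// subrr toI1// HK toI0.
Qed.

Lemma concat0 (X T : Type) (H K : I * X -> T) x :
  concat H K (I0, x) = H (I0, x).
Proof. by rewrite /concat /= set_valE /= invr_ge0 ler0n mulr0 toI0. Qed.

Lemma concat1 (X T : Type) (H K : I * X -> T) x :
  concat H K (I1, x) = K (I1, x).
Proof.
rewrite /concat /= set_valE /= leNgt invf_lt1 ?ltr0n// ltr1n /= mulr1.
by rewrite toI1// lerBrDr -natr1 lerD2r.
Qed.

Lemma reverse0 (X T : Type) (H : I * X -> T) x : reverse H (I0, x) = H (I1, x).
Proof. by rewrite /reverse /= set_valE /= subr0 toI1. Qed.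

Lemma reverse1 (X T : Type) (H : I * X -> T) x : reverse H (I1, x) = H (I0, x).
Proof. by rewrite /reverse /= set_valE /= subrr toI0. Qed.

Lemma continuous_reverse (X T : topologicalType) (H : I * X -> T) :
  continuous H -> continuous (reverse H).
Proof.
apply: (@continuous_reparam _ _ H (fun s => 1 - s)) => s.
by apply: cvgB; [exact: cvg_cst|exact: cvg_id].
Qed.

End Concatenation.

Section HomotopicRel.
Context {R : realType} {X Y : topologicalType} (A : set X).

Lemma homotopic_rel_refl (f : X -> Y) : continuous f -> homotopic_rel R A f f.
Proof.
move=> cf; exists (fun p => f p.2); split=> //.
by apply: (@continuous_compT _ _ _ f snd) => //; exact: continuous_snd.
Qed.

Lemma homotopic_rel_sym (f g : X -> Y) :
  homotopic_rel R A f g -> homotopic_rel R A g f.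
Proof.
move=> [H [cH H0 H1 HA]]; exists (reverse H); split.
- exact: continuous_reverse.
- by move=> x; rewrite reverse0.
- by move=> x; rewrite reverse1.
- by move=> t x Ax; rewrite -H1 /reverse !HA.
Qed.

Lemma homotopic_rel_trans (f g h : X -> Y) :
  homotopic_rel R A f g -> homotopic_rel R A g h -> homotopic_rel R A f h.
Proof.
move=> [H [cH H0 H1 HA]] [K [cK K0 K1 KA]]; exists (concat H K); split.
- by apply: continuous_concat => // x; rewrite H1 K0.
- by move=> x; rewrite concat0.
- by move=> x; rewrite concat1.
- by move=> t x Ax; rewrite /concat; case: ifP => _; rewrite ?HA// KA// -H1 HA.
Qed.

End HomotopicRel.

Lemma homotopic_compl (R : realType) (X Y Z : topologicalType) (f g : X -> Y)
    (k : Y -> Z) :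
  continuous k -> homotopic R f g -> homotopic R (k \o f) (k \o g).
Proof.
move=> ck [H [cH H0 H1 _]]; exists (k \o H); split=> //.
- by move=> p; apply: continuous_comp; [exact: cH|exact: ck].
- by move=> x /=; rewrite H0.
- by move=> x /=; rewrite H1.
Qed.

Lemma homotopic_compr (R : realType) (X Y Z : topologicalType) (f g : Y -> Z)
    (k : X -> Y) :
  continuous k -> homotopic R f g -> homotopic R (f \o k) (g \o k).
Proof.
move=> ck [H [cH H0 H1 _]]; exists (fun p => H (p.1, k p.2)); split=> //.
apply: (@continuous_compT _ _ _ H (fun p => (p.1, k p.2))) => //.
apply: continuous_pair; first exact: continuous_fst.
by apply: (@continuous_compT _ _ _ k snd) => //; exact: continuous_snd.
Qed.

Lemma homotopy_equivalence_id (R : realType) (X : topologicalType) :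
  homotopy_equivalence R (@id X).
Proof.
have cid : continuous (@id X) by move=> x; exact: cvg_id.
by split=> //; exists id; split=> //; exact: homotopic_rel_refl.
Qed.

Lemma homotopy_equivalence_comp (R : realType) (X Y Z : topologicalType)
    (g : Y -> Z) (f : X -> Y) :
  homotopy_equivalence R g -> homotopy_equivalence R f ->
  homotopy_equivalence R (g \o f).
Proof.
move=> [cg [g' [cg' g'g gg']]] [cf [f' [cf' f'f ff']]].
split; first exact: continuous_compT.
exists (f' \o g'); split; first exact: continuous_compT.
- apply: (homotopic_rel_trans _ f'f); apply: (@homotopic_compl _ _ _ _ _ f) => //.
  exact: (@homotopic_compr _ _ _ _ (g' \o g) id f).
- apply: (homotopic_rel_trans _ gg'); apply: (@homotopic_compl _ _ _ _ _ g') => //.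
  exact: (@homotopic_compr _ _ _ _ (f \o f') id g').
Qed.

Section PathComponents.
Context (R : realType) (T : topologicalType).
Local Notation I := (uitv R).

Lemma joinedE (x y : T) :
  joined R x y <-> homotopic R (fun _ : T => x) (fun _ : T => y).
Proof.
split=> [[g [cg g0 g1]]|[H [cH H0 H1 _]]].
- exists (g \o fst); split=> //.
  by apply: continuous_compT => //; exact: continuous_fst.
- exists (fun t => H (t, x)); split; rewrite ?H0 ?H1//.
  apply: (@continuous_compT _ _ _ H (fun t : I => (t, x))) => //.
  by apply: continuous_pair; [move=> t; exact: cvg_id|exact: cst_continuous].
Qed.

Definition joinedb (x y : T) : bool := `[< joined R x y >].

Lemma joinedb_refl : reflexive joinedb.
Proof.
by move=> x; apply/asboolP/joinedE/homotopic_rel_refl => ?; exact: cvg_cst.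
Qed.

Lemma joinedb_sym : symmetric joinedb.
Proof.
by move=> x y; apply/asboolP/asboolP => /joinedE/homotopic_rel_sym/joinedE.
Qed.

Lemma joinedb_trans : transitive joinedb.
Proof.
move=> y x z /asboolP/joinedE xy /asboolP/joinedE yz.
exact/asboolP/joinedE/(homotopic_rel_trans xy yz).
Qed.

Canonical joined_equiv := EquivRel joinedb joinedb_refl joinedb_sym joinedb_trans.

Definition pi0 : Type := {eq_quot joined_equiv}.
HB.instance Definition _ := Choice.on pi0.
HB.instance Definition _ := EqQuotient.on pi0.

End PathComponents.

Definition cofibration (R : realType) (A X : topologicalType) (i : A -> X) :
    Prop :=
  continuous i /\
  forall (Z : topologicalType) (f : X -> Z) (h : uitv R * A -> Z),
    continuous f -> continuous h -> (forall a, h (I0, a) = f (i a)) ->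
    exists H : uitv R * X -> Z,
      [/\ continuous H,
          forall x, H (I0, x) = f x
        & forall t a, H (t, i a) = h (t, a)].

Section Aut.
Context (R : realType) (A Y : topologicalType) (i : A -> Y).

Definition aut_set : set {compact-open, Y -> Y} :=
  [set f | homotopy_equivalence R (f : Y -> Y) /\ forall a, f (i a) = i a].

(* With the subspace topology of the compact-open topology.  Passing to the
   compactly generated refinement would not change the path components, since
   the unit interval is compact Hausdorff. *)
Definition aut : Type := aut_set.
HB.instance Definition _ := Topological.copy aut (aut_set : Type).

Definition aut_fun (f : aut) : Y -> Y := set_val f.

Lemma aut_funP (f : aut) : aut_set (aut_fun f).
Proof. exact: set_valP. Qed.

Lemma aut_ext (f g : aut) : aut_fun f = aut_fun g -> f = g.
Proof. exact: val_inj. Qed.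

Lemma aut_comp_subproof (f g : aut) :
  ((aut_fun f \o aut_fun g) : {compact-open, Y -> Y}) \in aut_set.
Proof.
have [[hf fi] [hg gi]] := (aut_funP f, aut_funP g).
rewrite inE; split; first exact: homotopy_equivalence_comp.
by move=> a /=; rewrite gi fi.
Qed.

Lemma aut_id_subproof : (id : {compact-open, Y -> Y}) \in aut_set.
Proof. by rewrite inE; split; first exact: homotopy_equivalence_id. Qed.

Definition aut_comp (f g : aut) : aut := mksub (aut_comp_subproof f g).
Definition aut_id : aut := mksub aut_id_subproof.

Lemma aut_compA : associative aut_comp.
Proof. by move=> f g h; exact: aut_ext. Qed.
Lemma aut_comp1f : left_id aut_id aut_comp.
Proof. by move=> f; exact: aut_ext. Qed.
Lemma aut_compf1 : right_id aut_id aut_comp.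
Proof. by move=> f; exact: aut_ext. Qed.

HB.instance Definition _ :=
  isMonoid.Build aut aut_compA aut_comp1f aut_compf1.

Lemma continuous_aut_fun :
  continuous (aut_fun : aut -> {compact-open, Y -> Y}).
Proof. exact: continuous_set_val. Qed.

Lemma aut_fun_continuous (f : aut) : continuous (aut_fun f).
Proof. by have [[]] := aut_funP f. Qed.

Lemma continuous_aut_compr (g : aut) : continuous (aut_comp^~ g).
Proof.
apply: continuous_into => f.
have FF := fmap_filter (set_val \o aut_comp^~ g) (nbhs_filter f).
apply/compact_open_cvgP => K O cK oO fgKO /=.
have cgK : compact (aut_fun g @` K).
  apply: continuous_compact => //; apply: continuous_subspaceT.
  exact: aut_fun_continuous.
have : nbhs (aut_fun f : {compact-open, Y -> Y})
    [set h | h @` (aut_fun g @` K) `<=` O].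
  apply: open_nbhs_nbhs; split; first exact: compact_open_open.
  by rewrite /= -image_comp in fgKO *.
move=> /continuous_aut_fun; apply: (@filterS _ _ (nbhs_filter f)) => h /= hO.
by rewrite -[X in X `<=` _]/((aut_fun h \o aut_fun g) @` K) -image_comp.
Qed.

Lemma continuous_aut_compl (g : aut) : continuous (aut_comp g).
Proof.
apply: continuous_into => f.
have FF := fmap_filter (set_val \o aut_comp g) (nbhs_filter f).
apply/compact_open_cvgP => K O cK oO gfKO /=.
have oV : open (aut_fun g @^-1` O).
  by have /continuousP := @aut_fun_continuous g; apply.
have : nbhs (aut_fun f : {compact-open, Y -> Y})
    [set h | h @` K `<=` aut_fun g @^-1` O].
  apply: open_nbhs_nbhs; split; first exact: compact_open_open.
  by move=> _ [y Ky <-]; apply: gfKO; exists y.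
move=> /continuous_aut_fun; apply: (@filterS _ _ (nbhs_filter f)) => h /= hO _ [y Ky <-].
by apply: hO; exists y.
Qed.

Definition pi0_aut : Type := pi0 R aut.
HB.instance Definition _ := Choice.on pi0_aut.
HB.instance Definition _ := EqQuotient.on pi0_aut.

Definition pi0_class (f : aut) : pi0_aut := \pi_pi0_aut f.

Lemma pi0_classK (a : pi0_aut) : pi0_class (repr a) = a.
Proof. exact: reprK. Qed.

Lemma pi0_classP (f g : aut) : pi0_class f = pi0_class g <-> joined R f g.
Proof.
by split=> [/eqmodP/asboolP //|fg]; apply/eqmodP/asboolP.
Qed.

Definition pi0_aut_mul (a b : pi0_aut) : pi0_aut :=
  pi0_class (aut_comp (repr a) (repr b)).
Definition pi0_aut_one : pi0_aut := pi0_class aut_id.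

Lemma pi0_aut_mulE (f g : aut) :
  pi0_aut_mul (pi0_class f) (pi0_class g) = pi0_class (aut_comp f g).
Proof.
rewrite /pi0_aut_mul.
have /pi0_classP[p [cp p0 p1]] := pi0_classK (pi0_class f).
have /pi0_classP[q [cq q0 q1]] := pi0_classK (pi0_class g).
transitivity (pi0_class (aut_comp f (repr (pi0_class g)))).
- apply/pi0_classP; exists (fun t => aut_comp (p t) (repr (pi0_class g))).
  split; rewrite ?p0 ?p1//.
  apply: (@continuous_compT _ _ _ (aut_comp^~ _) p) => //.
  exact: continuous_aut_compr.
- apply/pi0_classP; exists (fun t => aut_comp f (q t)).
  split; rewrite ?q0 ?q1//.
  apply: (@continuous_compT _ _ _ (aut_comp _) q) => //.
  exact: continuous_aut_compl.
Qed.

Lemma pi0_aut_mulA : associative pi0_aut_mul.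
Proof.
move=> a b c; rewrite -(pi0_classK a) -(pi0_classK b) -(pi0_classK c).
by rewrite !pi0_aut_mulE aut_compA.
Qed.
Lemma pi0_aut_mul1a : left_id pi0_aut_one pi0_aut_mul.
Proof. by move=> a; rewrite -(pi0_classK a) pi0_aut_mulE aut_comp1f. Qed.
Lemma pi0_aut_mula1 : right_id pi0_aut_one pi0_aut_mul.
Proof. by move=> a; rewrite -(pi0_classK a) pi0_aut_mulE aut_compf1. Qed.

HB.instance Definition _ :=
  isMonoid.Build pi0_aut pi0_aut_mulA pi0_aut_mul1a pi0_aut_mula1.

End Aut.

Definition is_group (G : monoidType) : Prop :=
  forall x : G, exists y : G, (x * y = 1 /\ y * x = 1)%g.

Definition group_isomorphic (G H : monoidType) : Prop :=
  [/\ is_group G, is_group H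
    & exists f : G -> H, {morph f : x y / (x * y)%g} /\ bijective f].

Definition cube (R : realType) (n : nat) : set 'rV[R]_n :=
  [set s | forall j, 0 <= s 0 j <= 1].
Arguments cube : clear implicits.

Definition cube_bdry (R : realType) (n : nat) : set (cube R n) :=
  [set s | exists j, (set_val s : 'rV[R]_n) 0 j = 0 \/
                     (set_val s : 'rV[R]_n) 0 j = 1].
Arguments cube_bdry : clear implicits.

Section HomotopyGroups.
Context (R : realType) (n : nat) (X : topologicalType) (x : X).

Definition nloop_set : set (cube R n -> X) :=
  [set a | continuous a /\ forall s, cube_bdry R n s -> a s = x].
Definition nloop : Type := nloop_set.
HB.instance Definition _ := Choice.on nloop.

Definition nloop_fun (a : nloop) : cube R n -> X := set_val a.

Lemma nloopP (a : nloop) : nloop_set (nloop_fun a).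
Proof. exact: set_valP. Qed.

Definition nloop_homotopicb (a b : nloop) : bool :=
  `[< homotopic_rel R (cube_bdry R n) (nloop_fun a) (nloop_fun b) >].

Lemma nloop_homotopicb_refl : reflexive nloop_homotopicb.
Proof.
by move=> a; apply/asboolP/homotopic_rel_refl; have [] := nloopP a.
Qed.
Lemma nloop_homotopicb_sym : symmetric nloop_homotopicb.
Proof. by move=> a b; apply/asboolP/asboolP => /homotopic_rel_sym. Qed.
Lemma nloop_homotopicb_trans : transitive nloop_homotopicb.
Proof.
move=> b a c /asboolP ab /asboolP bc; apply/asboolP.
exact: homotopic_rel_trans ab bc.
Qed.

Canonical nloop_equiv := EquivRel nloop_homotopicb
  nloop_homotopicb_refl nloop_homotopicb_sym nloop_homotopicb_trans.

(* For n = 0 the boundary of the cube is empty and this is the set of path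
   components of X.  The group structure for n > 0 is not needed: maps induced
   by continuous maps are homomorphisms, so that they are isomorphisms iff they
   are bijective. *)
Definition pin : Type := {eq_quot nloop_equiv}.
HB.instance Definition _ := Choice.on pin.
HB.instance Definition _ := EqQuotient.on pin.

Definition pin_class (a : nloop) : pin := \pi_pin a.

Lemma pin_classK (c : pin) : pin_class (repr c) = c.
Proof. exact: reprK. Qed.

Lemma pin_classP (a b : nloop) : pin_class a = pin_class b <->
  homotopic_rel R (cube_bdry R n) (nloop_fun a) (nloop_fun b).
Proof.
by split=> [/eqmodP/asboolP //|ab]; apply/eqmodP/asboolP.
Qed.

End HomotopyGroups.

Section InducedMap.
Context (R : realType) (n : nat) (X Y : topologicalType).
Context (f : continuousType X Y) (x : X).

Lemma nloop_map_subproof (a : nloop R n x) :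
  (f \o nloop_fun a) \in @nloop_set R n Y (f x).
Proof.
have [ca ax] := nloopP a; rewrite inE; split.
  by apply: continuous_compT => //; exact: cts_fun.
by move=> s /ax /= ->.
Qed.

Definition nloop_map (a : nloop R n x) : nloop R n (f x) :=
  mksub (nloop_map_subproof a).

Definition pin_map (c : pin R n x) : pin R n (f x) :=
  pin_class (nloop_map (repr c)).

Lemma pin_mapE (a : nloop R n x) :
  pin_map (pin_class a) = pin_class (nloop_map a).
Proof.
have /pin_classP[H [cH H0 H1 Hb]] := pin_classK (pin_class a).
apply/pin_classP; exists (f \o H); split.
- by apply: continuous_compT => //; exact: cts_fun.
- by move=> s /=; rewrite H0.
- by move=> s /=; rewrite H1.
- by move=> t s bs /=; rewrite Hb.
Qed.

End InducedMap.

(* The loop g carries the class of a to that of b, under the action of pi_1 on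
   pi_n: there is a free homotopy from a to b along which the boundary of the
   cube follows g. *)
Definition carries (R : realType) (n : nat) (X : topologicalType) (x : X)
    (g : uitv R -> X) (a b : nloop R n x) : Prop :=
  exists H : uitv R * cube R n -> X,
    [/\ continuous H,
        forall s, H (I0, s) = nloop_fun a s,
        forall s, H (I1, s) = nloop_fun b s
      & forall t s, cube_bdry R n s -> H (t, s) = g t].

(* For n = 1 the last condition says that pi_1 is abelian. *)
Definition simple_space (R : realType) (X : topologicalType) : Prop :=
  path_connected R X /\
  forall (n : nat) (x : X) (g : uitv R -> X) (a b : nloop R n x),
    (0 < n)%N -> continuous g -> g I0 = x -> g I1 = x ->
    carries g a b -> pin_class a = pin_class b.

Definition postnikov_stage (R : realType) (m : nat) (X Xm : topologicalType)
    (p : continuousType X Xm) : Prop :=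
  (forall n, (n <= m)%N -> forall x : X, bijective (@pin_map R n X Xm p x)) /\
  (forall n, (m < n)%N -> forall (y : Xm) (c d : pin R n y), c = d).

Definition disc (R : realType) (n : nat) : set 'rV[R]_n :=
  [set v | \sum_(j < n) v 0 j ^+ 2 <= 1].
Arguments disc : clear implicits.

Definition open_disc (R : realType) (n : nat) : set (disc R n) :=
  [set v | \sum_(j < n) (set_val v : 'rV[R]_n) 0 j ^+ 2 < 1].
Arguments open_disc : clear implicits.

Definition sphere (R : realType) (n : nat) : set (disc R n) :=
  [set v | \sum_(j < n) (set_val v : 'rV[R]_n) 0 j ^+ 2 = 1].
Arguments sphere : clear implicits.

(* CW structures through their characteristic maps, as in Hatcher, Algebraic
   Topology, Proposition A.2. *)
Record cw_complex (R : realType) (X : topologicalType) := CWComplex {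
  cell : nat -> Type;
  char_map : forall n, cell n -> disc R n -> X;
  open_cell : {n & cell n} -> set X :=
    fun e => char_map (projT2 e) @` open_disc R (projT1 e);
  cw_hausdorff : hausdorff_space X;
  char_map_continuous : forall n (e : cell n), continuous (char_map e);
  char_map_inj : forall n (e : cell n),
    {in open_disc R n &, injective (char_map e)};
  open_cell_partition : forall x : X, exists! e, open_cell e x;
  char_map_sphere : forall n (e : cell n), exists F : set {k & cell k},
    [/\ finite_set F, (forall e', F e' -> (projT1 e' < n)%N)
      & char_map e @` sphere R n `<=` \bigcup_(e' in F) open_cell e'];
  cw_closed : forall C : set X,
    (forall n (e : cell n), closed (char_map e @^-1` C)) -> closed C }.

Definition cw_finite (R : realType) (X : topologicalType)
    (K : cw_complex R X) : Prop :=
  finite_set [set: {n & cell K n}].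

Definition cw_dim_le (R : realType) (X : topologicalType)
    (K : cw_complex R X) (m : nat) : Prop :=
  forall n, cell K n -> (n <= m)%N.

Definition cw_homotopy_type (R : realType) (Y : topologicalType) : Prop :=
  exists (K : topologicalType) (_ : cw_complex R K) (f : Y -> K),
    homotopy_equivalence R f.

(* Main.v *)
(* An endomorphism F of X(m) and an endomorphism a of X, both under A, correspond to
   each other when F p ~ p a rel A, and this is a bijection on homotopy classes under A.
   Given F, the map a exists and is unique because X has dimension at most m and p is
   (m+1)-connected.  Here A need not be a subcomplex: one lifts first over a
   neighbourhood that retracts to A, and then cell by cell after subdividing the cells
   so finely that the pieces near A lie in that neighbourhood.
   Given a, the map F exists and is unique because X(m) is, up to homotopy, a complex
   whose (m+1)-skeleton maps compatibly to X, while the remaining cells have dimensions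
   in which X(m) has no homotopy; cellular approximation moves X into that skeleton.
   Maps under A that are homotopy equivalences are invertible under A (Dold).  Paths in
   the monoid of X(m) are compared through their restrictions to the compact space X,
   as X(m) itself need not satisfy an exponential law. *)
Require Import Defs.
From mathcomp Require Import all_boot all_order all_algebra.
From mathcomp Require Import all_classical all_reals all_analysis.
From mathcomp Require Import ring lra.
Import Order.TTheory GRing.Theory Num.Theory.
Import numFieldNormedType.Exports.

Set Implicit Arguments.
Unset Strict Implicit.
Unset Printing Implicit Defensive.

Local Open Scope classical_set_scope.
Local Open Scope ring_scope.

(** * Continuity on closed sets and currying *)

(** Spaces are arbitrary, so fibrations are not replaced by convenient models: a lifting problem is
    a relation [over] between base points and lifts. One property of cubes, [LP], then serves for
    lifting through [p] up to homotopy ([over_map]), for extending maps into a space without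
    homotopy ([over_triv]), and, through [LP_path], for homotopies between lifts at the cost of one
    dimension. This is why lifting through [p] is established up to dimension [m.+1] although [X]
    stops at [m]. The obstacle is [A]: a lift known over a neighbourhood [phi <= c] of it meets a
    cell in an arbitrary closed set, not in a subcomplex. Part of the known lift is therefore given
    up: [lext2] keeps it only over [phi <= c'] for some [c' < c], and each subdivision and each
    skeleton spends some of the gap. Indices are shifted: [Sk k] holds the cells of dimension less
    than [k], so the (m+1)-skeleton is [Sk m.+2]. *)

Section ClosedContinuity.
Implicit Types S T U : topologicalType.

(* Continuity of [f] on the closed set [D], for [f] defined everywhere: partial maps
   are total maps with arbitrary values outside [D], and glue by [ccontU]. *)
Definition ccont S T (D : set S) (f : S -> T) :=
  forall W, closed W -> closed (D `&` f @^-1` W).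

Lemma ccontT S T (f : S -> T) : continuous f <-> ccont setT f.
Proof.
rewrite /ccont; split=> [/continuous_closedP cf W cW|cf].
  by rewrite setTI; exact: cf.
by apply/continuous_closedP => W cW; rewrite -[X in closed X]setTI; exact: cf.
Qed.

Lemma ccont_closed S T (D : set S) (f : S -> T) : ccont D f -> closed D.
Proof. by move=> /(_ setT closedT); rewrite preimage_setT setIT. Qed.

Lemma ccont_eq S T (D : set S) (f g : S -> T) :
  ccont D f -> (forall x, D x -> f x = g x) -> ccont D g.
Proof.
move=> cf fg W /cf; congr closed; apply/seteqP; split=> x [Dx /= Wx].
  by rewrite -fg.
by rewrite fg.
Qed.

Lemma ccontU S T (D E : set S) (f : S -> T) :
  ccont D f -> ccont E f -> ccont (D `|` E) f.
Proof. by move=> cD cE W cW; rewrite setIUl; apply: closedU; auto. Qed.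

Lemma ccont_sub S T (D E : set S) (f : S -> T) :
  ccont D f -> closed E -> E `<=` D -> ccont E f.
Proof.
move=> cf cE ED W cW; have -> : E `&` f @^-1` W = E `&` (D `&` f @^-1` W).
  by rewrite setIA (setIidl ED).
by apply: closedI => //; exact: cf.
Qed.

Lemma ccont_comp S T U (A : set T) (B : set S) (f : T -> U) (u : S -> T) :
  ccont A f -> ccont B u -> (forall x, B x -> A (u x)) -> ccont B (f \o u).
Proof.
move=> cf cu BA W cW.
have -> : B `&` (f \o u) @^-1` W = B `&` u @^-1` (A `&` f @^-1` W).
  apply/seteqP; split=> x [Bx] /= Wx; last by case: Wx.
  by split=> //; split=> //; exact: BA.
by apply: cu; exact: cf.
Qed.

Lemma ccont_compT S T U (B : set S) (f : T -> U) (u : S -> T) :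
  continuous f -> ccont B u -> ccont B (f \o u).
Proof. by move=> /ccontT cf cu; apply: (ccont_comp cf cu). Qed.

Lemma continuous_ccont S T (D : set S) (f : S -> T) :
  continuous f -> closed D -> ccont D f.
Proof. by move=> /ccontT cf cD; exact: ccont_sub cf cD _. Qed.

Lemma ccont_total S T U (A : set T) (f : T -> U) (u : S -> T) :
  ccont A f -> continuous u -> (forall x, A (u x)) -> continuous (f \o u).
Proof.
by move=> cf /ccontT cu uA; apply/ccontT; apply: ccont_comp cf cu _.
Qed.

Lemma ccont_nbhs S T (D : set S) (f : S -> T) (x : S) (O : set T) :
  ccont D f -> D x -> nbhs (f x) O -> \forall y \near x, D y -> O (f y).
Proof.
move=> cf Dx; rewrite nbhsE => -[V [oV Vfx] VO].
have /cf : closed (~` V) by exact: open_closedC.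
move=> /closed_openC oC.
have : nbhs x (~` (D `&` f @^-1` (~` V))).
  by apply: open_nbhs_nbhs; split=> // -[_].
apply: filterS => y /= nDV Dy; apply: VO; apply: contrapT => nV.
by apply: nDV.
Qed.

Lemma nbhs_ccont S T (D : set S) (f : S -> T) : closed D ->
  (forall x O, D x -> open O -> O (f x) ->
     \forall y \near x, D y -> O (f y)) -> ccont D f.
Proof.
move=> cD fD W cW; rewrite -openC openE => x /= nDW.
have [Dx|nDx] := pselect (D x); last first.
  have : nbhs x (~` D) by apply: open_nbhs_nbhs; split=> //; exact: closed_openC.
  by apply: filterS => y nDy [].
have nWx : ~ W (f x) by move=> ?; apply: nDW.
have := fD x _ Dx (closed_openC cW) nWx.
by apply: filterS => y /= h [Dy Wy]; exact: h.
Qed.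

Lemma closed_fst_preim S T (D : set S) : closed D -> closed (@fst S T @^-1` D).
Proof. by move=> cD; move/continuous_closedP: (@continuous_fst S T); apply. Qed.

Lemma closed_snd_preim S T (D : set T) : closed D -> closed (@snd S T @^-1` D).
Proof. by move=> cD; move/continuous_closedP: (@continuous_snd S T); apply. Qed.

(** The condition on a parameter space under which maps into a compact-open function space are
    uncurried. *)
Definition chaus T := compact [set: T] /\ hausdorff_space T.

(** Tube lemma: a subbasic open set constrains maps on a compact [K] only, and [H] stays in the
    prescribed open set on a tube around [K]. *)
Lemma ccont_curry (V U W : topologicalType) (D : set U) (H : V * U -> W) :
  closed D -> ccont (snd @^-1` D) H ->
  ccont D ((fun x t => H (t, x)) : U -> {compact-open, V -> W}).
Proof.
move=> cD cH.
suff key (x : U) : D x -> forall O : set {compact-open, V -> W},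
    open O -> O (fun t => H (t, x)) ->
    \forall y \near x, D y -> O (fun t => H (t, y)).
  by apply: nbhs_ccont => // x O Dx oO Ox; exact: key.
move=> Dx O oO Ox.
have FW : Filter (within D (nbhs x)) by exact: within_filter.
have FF := @fmap_filter _ _ ((fun x t => H (t, x)) : U -> {compact-open, V -> W}) _ FW.
have : nbhs ((fun t => H (t, x)) : {compact-open, V -> W}) O by exact: open_nbhs_nbhs.
suff cv : (fun x t => H (t, x)) @ within D (nbhs x) -->
    ((fun t => H (t, x)) : {compact-open, V -> W}) by move=> /cv.
apply/compact_open_cvgP => K Q cK oQ HQ /=.
suff : \forall y \near x, forall t, K t -> D y -> Q (H (t, y)).
  by apply: filterS => y h Dy _ [t Kt <-]; exact: h.
move/compact_near_coveringP/near_covering_withinP : cK; apply.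
move=> t Kt.
have : nbhs (H (t, x)) Q by apply: open_nbhs_nbhs; split=> //; apply: HQ; exists t.
move=> /(@ccont_nbhs _ _ _ _ (t, x) _ cH Dx) [[P R] [/= nP nR] PR].
by exists (P, R) => //= -[s y] [/= Ps Ry] _ Dy; apply: (PR (s, y)).
Qed.

Lemma continuous_curry2 (V U W : topologicalType) (H : V * U -> W) :
  continuous H ->
  continuous ((fun x t => H (t, x)) : U -> {compact-open, V -> W}).
Proof.
by move=> /ccontT cH; apply/ccontT; apply: ccont_curry; first exact: closedT.
Qed.

Lemma chaus_closed_nbhs (V : topologicalType) (t : V) (O : set V) :
  chaus V -> nbhs t O ->
  exists C : set V, [/\ compact C, nbhs t C & C `<=` O].
Proof.
move=> [cV hV] nO.
have [R nR RO] := @compact_regular V t setT hV cV filterT _ nO.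
exists (closure R); split=> //.
- by apply: (subclosed_compact _ cV); [exact: closed_closure|].
- by apply: filterS nR; exact: subset_closure.
Qed.

(** A point [t] has a compact neighbourhood [C] that [g x] carries into the given open set; nearby
    [g y] carry [C] there as well. *)
Lemma ccont_uncurry (V U W : topologicalType) (D : set U)
    (g : U -> {compact-open, V -> W}) :
  chaus V -> ccont D g -> (forall x, D x -> continuous (g x : V -> W)) ->
  ccont (snd @^-1` D) (fun p : V * U => g p.2 p.1).
Proof.
move=> cV cg cgx; apply: nbhs_ccont.
  by apply: closed_snd_preim; exact: ccont_closed cg.
move=> [t x] O /= Dx oO Ox.
have nO : nbhs t (g x @^-1` O) by apply: cgx => //; exact: open_nbhs_nbhs.
have [C [cC nC CO]] := chaus_closed_nbhs cV nO.
have /(ccont_nbhs cg Dx) nG : nbhs (g x) [set h : {compact-open, V -> W} | h @` C `<=` O].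
  apply: open_nbhs_nbhs; split; first exact: compact_open_open.
  by move=> _ [s Cs <-]; exact: CO.
exists (C, (fun y => D y -> g y @` C `<=` O)) => //= -[s y] [/= Cs hy] Dy.
by apply: (hy Dy); exists s.
Qed.

Lemma continuous_uncurry2 (V U W : topologicalType)
    (g : U -> {compact-open, V -> W}) :
  chaus V -> continuous g -> (forall x, continuous (g x : V -> W)) ->
  continuous (fun p : V * U => g p.2 p.1).
Proof.
move=> cV /ccontT cg cgx; apply/ccontT.
by rewrite -[X in ccont X _](preimage_setT (@snd V U)); exact: ccont_uncurry.
Qed.

Lemma continuous_precomp (X Y Z : topologicalType) (q : X -> Y) :
  continuous q ->
  continuous ((fun f => f \o q) : {compact-open, Y -> Z} -> {compact-open, X -> Z}).
Proof.
move=> cq f.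
have FF := fmap_filter ((fun f => f \o q) : {compact-open, Y -> Z} -> {compact-open, X -> Z})
  (nbhs_filter f).
apply/compact_open_cvgP => K O cK oO fqO /=.
have cqK : compact (q @` K).
  by apply: continuous_compact => //; exact: continuous_subspaceT.
have : nbhs f [set h : {compact-open, Y -> Z} | h @` (q @` K) `<=` O].
  apply: open_nbhs_nbhs; split; first exact: compact_open_open.
  by rewrite /= image_comp.
by apply: filterS => h /=; rewrite image_comp.
Qed.

End ClosedContinuity.

Section Intervals.
Context {R : realType}.
Local Notation I := (uitv R).

Lemma compact_subtype (T : topologicalType) (A : set T) :
  compact A -> compact [set: A].
Proof.
move=> cA.
have [A0|/set0P[a Aa]] := eqVneq A set0.
  move=> F PF _; exfalso; have [x _] := @filter_ex _ F _ _ filterT.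
  by have : A (set_val x) := set_valP x; move: (set_val x) => y; rewrite A0.
have aA : a \in A by rewrite inE.
pose s : T -> A := fun x =>
  if pselect (x \in A) is left h then mksub h else mksub aA.
have sK x : s (set_val x) = x.
  rewrite /s; case: pselect => [h|]; first exact: val_inj.
  by case; rewrite inE; exact: set_valP.
have -> : [set: A] = s @` A.
  apply/seteqP; split=> // x _; exists (set_val x) => //; exact: set_valP.
apply: continuous_compact => //.
apply/subspace_sigL_continuousP.
have -> : sigL A s = id by apply/funext => x; exact: sK.
by move=> x; exact: cvg_id.
Qed.

Lemma hausdorff_subtype (T : topologicalType) (A : set T) :
  hausdorff_space T -> hausdorff_space A.
Proof.
move=> hT; move=> x y xy; apply: val_inj; apply: hT.
move=> P Q /continuous_set_val nP /continuous_set_val nQ.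
by have [z [Pz Qz]] := xy _ _ nP nQ; exists (set_val z).
Qed.

Lemma chaus_subtype (T : topologicalType) (A : set T) :
  compact A -> hausdorff_space T -> chaus A.
Proof. by move=> ? ?; split; [exact: compact_subtype|exact: hausdorff_subtype]. Qed.

Lemma chaus_I : chaus I.
Proof.
apply: chaus_subtype; last exact: norm_hausdorff.
have -> : uitv R = `[0, 1]%classic by apply/seteqP; split=> x /=; rewrite in_itv.
exact: segment_compact.
Qed.

End Intervals.

(** * Cubes *)

Section RealContinuity.
Context {R : realType} {T : topologicalType}.
Implicit Types f g : T -> R.

Lemma cont_cst (U : topologicalType) (c : U) : continuous (fun _ : T => c).
Proof. by move=> x; exact: cvg_cst. Qed.
Lemma contD f g : continuous f -> continuous g -> continuous (fun x => f x + g x).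
Proof. by move=> cf cg x; apply: cvgD; [exact: cf|exact: cg]. Qed.
Lemma contN f : continuous f -> continuous (fun x => - f x).
Proof. by move=> cf x; apply: cvgN; exact: cf. Qed.
Lemma contB f g : continuous f -> continuous g -> continuous (fun x => f x - g x).
Proof. by move=> cf cg; apply: contD => //; exact: contN. Qed.
Lemma contM f g : continuous f -> continuous g -> continuous (fun x => f x * g x).
Proof. by move=> cf cg x; apply: cvgM; [exact: cf|exact: cg]. Qed.
Lemma contMl (c : R) f : continuous f -> continuous (fun x => c * f x).
Proof. by move=> cf; apply: contM => //; exact: cont_cst. Qed.
Lemma contV f : (forall x, f x != 0) -> continuous f -> continuous (fun x => (f x)^-1).
Proof. by move=> f0 cf x; apply: cvgV => //; exact: cf. Qed.
Lemma cont_max f g : continuous f -> continuous g ->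
  continuous (fun x => Num.max (f x) (g x)).
Proof. by move=> cf cg x; exact: (continuous_max (cf x) (cg x)). Qed.
Lemma cont_min f g : continuous f -> continuous g ->
  continuous (fun x => Num.min (f x) (g x)).
Proof. by move=> cf cg x; exact: (continuous_min (cf x) (cg x)). Qed.
Lemma cont_sum n (F : 'I_n -> T -> R) : (forall j, continuous (F j)) ->
  continuous (fun x => \sum_j F j x).
Proof.
move=> cF; rewrite (_ : (fun x => _) = \sum_j F j).
  by elim/big_ind: _ => // [|f g cf cg]; [exact: cont_cst|exact: contD].
by apply/funext => x; rewrite fct_sumE.
Qed.
Lemma closed_lef f g : continuous f -> continuous g -> closed [set x | f x <= g x].
Proof.
move=> cf cg; have -> : [set x | f x <= g x] = (fun x => g x - f x) @^-1` [set r | 0 <= r].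
  by apply/seteqP; split=> x /=; rewrite subr_ge0.
by have /continuous_closedP := contB cg cf; apply; exact: closed_ge.
Qed.
Lemma closed_eqf f g : continuous f -> continuous g -> closed [set x | f x = g x].
Proof.
move=> cf cg; have -> : [set x | f x = g x] = (fun x => g x - f x) @^-1` [set r | r = 0].
  by apply/seteqP; split=> x /= => [->|/subr0_eq//]; rewrite subrr.
by have /continuous_closedP := contB cg cf; apply; exact: closed_eq.
Qed.
End RealContinuity.

Lemma continuous_rV (R : realType) (T : topologicalType) n (f : T -> 'rV[R]_n) :
  (forall j, continuous (fun x => f x 0 j)) -> continuous f.
Proof.
move=> cf x; apply/cvgrPdist_lt => e e0.
have : \forall y \near x, forall j, `|f x 0 j - f y 0 j| < e.
  apply: filter_forall => j.
  by have /cvgrPdist_lt := cf j x; apply.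
apply: filterS => y hy; rewrite [ltLHS]mx_normrE.
apply/bigmax_ltP; split=> // -[i j] _ /=; rewrite !mxE (ord1 i); exact: hy.
Qed.

Section Cube.
Context {R : realType}.
Local Notation I := (uitv R).
Local Notation Q := (cube R).

Lemma clamp_id (r : R) : 0 <= r <= 1 -> clamp r = r.
Proof. by move=> /andP[r0 r1]; rewrite /clamp min_l// max_r. Qed.

Lemma continuous_clamp : continuous (@clamp R).
Proof.
rewrite /clamp; apply: cont_max; first exact: cont_cst.
by apply: cont_min; [move=> x; exact: cvg_id|exact: cont_cst].
Qed.

Lemma clamp_itv (r : R) : 0 <= clamp r <= 1.
Proof. by have := clamp_subproof r; rewrite inE. Qed.

Definition ival (t : I) : R := set_val t.

Lemma ival_itv t : 0 <= ival t <= 1. Proof. exact: (set_valP t). Qed.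
Lemma ival_toI r : ival (toI r) = clamp r. Proof. by []. Qed.
Lemma ival_inj : injective ival. Proof. exact: val_inj. Qed.
Lemma ival0 : ival I0 = 0. Proof. by []. Qed.
Lemma ival1 : ival I1 = 1. Proof. by []. Qed.
Lemma toI_ival t : toI (ival t) = t.
Proof. by apply: ival_inj; rewrite ival_toI clamp_id// ival_itv. Qed.
Lemma continuous_ival : continuous ival. Proof. exact: continuous_set_val. Qed.
Lemma cont_toI (T : topologicalType) (f : T -> R) :
  continuous f -> continuous (fun x => toI (f x)).
Proof. by apply: continuous_compT; exact: continuous_toI. Qed.

Definition crd n (x : Q n) (j : 'I_n) : R := (set_val x : 'rV_n) 0 j.

Lemma crd_itv n (x : Q n) j : 0 <= crd x j <= 1.
Proof. exact: (set_valP x). Qed.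

Lemma qext n (x y : Q n) : (forall j, crd x j = crd y j) -> x = y.
Proof. by move=> xy; apply: val_inj; apply/rowP. Qed.

Lemma qrow_subproof n (F : 'I_n -> R) : (\row_j clamp (F j)) \in Q n.
Proof. by rewrite inE => j; rewrite mxE clamp_itv. Qed.
(** Clamping makes this total, so that formulas need no proof of staying in the cube; they are exact
    where [crd_qrow_id] applies. *)
Definition qrow n (F : 'I_n -> R) : Q n := mksub (qrow_subproof F).

Lemma crd_qrow n (F : 'I_n -> R) j : crd (qrow F) j = clamp (F j).
Proof. by rewrite /crd /= set_valE /= mxE. Qed.

Lemma crd_qrow_id n (F : 'I_n -> R) j : 0 <= F j <= 1 -> crd (qrow F) j = F j.
Proof. by move=> Fj; rewrite crd_qrow clamp_id. Qed.

Lemma continuous_crd n (j : 'I_n) : continuous (fun x : Q n => crd x j).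
Proof.
apply: (@continuous_compT _ _ _ (fun v : 'rV[R]_n => v 0 j) set_val).
  exact: coord_continuous.
exact: continuous_set_val.
Qed.

Lemma continuous_qrow (T : topologicalType) n (F : T -> 'I_n -> R) :
  (forall j, continuous (F^~ j)) -> continuous (fun x => qrow (F x)).
Proof.
move=> cF; apply: continuous_into; apply: continuous_rV => j.
rewrite (_ : (fun x => _) = clamp \o F^~ j).
  by apply: continuous_compT => //; exact: continuous_clamp.
by apply/funext => x /=; rewrite set_valE /= mxE.
Qed.

Lemma chaus_Q n : chaus (Q n).
Proof.
apply: chaus_subtype; last exact: norm_hausdorff.
rewrite (_ : cube R n = [set v : 'rV[R]_n | forall i, `[0, 1]%classic (v ord0 i)]).
  by apply: (@rV_compact R _ (fun=> `[0, 1]%classic)) => _; exact: segment_compact.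
by apply/seteqP; split=> x /= h j; have := h j; rewrite in_itv.
Qed.

Lemma closed_bd n : closed (cube_bdry R n).
Proof.
rewrite (_ : cube_bdry R n =
  \bigcup_(j in [set: 'I_n]) ([set x : Q n | crd x j = 0] `|` [set x : Q n | crd x j = 1])).
  apply: closed_bigcup => [|j _]; first exact: finite_finset.
  by apply: closedU; apply: closed_eqf; [exact: continuous_crd|exact: cont_cst|exact: continuous_crd|exact: cont_cst].
by apply/seteqP; split=> [x [j h]|x [j _ h]]; exists j.
Qed.

Lemma nbhs_Q n (x : Q n) (V : set (Q n)) : nbhs x V ->
  exists2 d : R, 0 < d & forall y, (forall j, `|crd x j - crd y j| < d) -> V y.
Proof.
move=> /nbhs_ballP[d /= d0 dV]; exists d => // y hy; apply: dV.
by rewrite -initial_ballE; split=> // i j; rewrite (ord1 i); exact: hy.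
Qed.

(** Heine-Cantor by compactness; the modulus is a power of one half because cubes will be
    bisected. *)
Lemma unif_cont_Q n (phi : Q n -> R) (e : R) : continuous phi -> 0 < e ->
  exists N, forall x y : Q n,
    (forall j, `|crd x j - crd y j| <= 2^-1 ^+ N) -> `|phi x - phi y| < e.
Proof.
move=> cphi e0; have [cQ _] := chaus_Q n.
pose P (N : nat) (x : Q n) := forall y : Q n,
  (forall j, `|crd x j - crd y j| <= 2^-1 ^+ N) -> `|phi x - phi y| < e.
suff : \forall N \near \oo, setT `<=` P N.
  by move=> [N _ /(_ N (leqnn N)) h]; exists N => x y; exact: h.
move/compact_near_coveringP : cQ; apply => x _.
have e2 : 0 < e / 2 by rewrite divr_gt0.
have /cvgrPdist_lt /(_ _ e2) /nbhs_Q [d d0 hd] := cphi x.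
have d2 : 0 < d / 2 by rewrite divr_gt0.
have nN : \forall N \near \oo, 2^-1 ^+ N < d / 2 :> R.
  have := @cvg_expr R 2^-1; rewrite ger0_norm ?invr_ge0// invf_lt1// ltr1n => /(_ isT).
  by move=> /cvgrPdist_lt /(_ _ d2); apply: filterS => N; rewrite sub0r normrN ger0_norm// exprn_ge0// invr_ge0.
have nx : \forall y \near x, forall j, `|crd x j - crd y j| < d / 2.
  apply: (@filter_forall _ _ _ _ (nbhs_filter x)) => j.
  by have /cvgrPdist_lt := @continuous_crd n j x; apply.
exists ([set y : Q n | forall j, `|crd x j - crd y j| < d / 2],
        [set N | 2^-1 ^+ N < d / 2 :> R]) => //= -[y N] [/= hy hN] z hz.
have hx1 : `|phi x - phi y| < e / 2.
  by apply: hd => j; apply: lt_trans (hy j) _; rewrite gtr_pMr// invf_lt1// ltr1n.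
have hx2 : `|phi x - phi z| < e / 2.
  apply: hd => j; rewrite (_ : _ - _ = (crd x j - crd y j) + (crd y j - crd z j)); last by ring.
  apply: le_lt_trans (ler_normD _ _) _; rewrite [ltRHS]splitr.
  by apply: ltrD (hy j) _; apply: le_lt_trans hN; exact: hz.
rewrite (_ : _ - _ = (phi y - phi x) + (phi x - phi z)); last by ring.
by apply: le_lt_trans (ler_normD _ _) _; rewrite [ltRHS]splitr ltrD// distrC.
Qed.

End Cube.

(** * Lifting problems and subdivision *)

Section Lifting.
Context {R : realType} {B E : topologicalType} (over : B -> E -> Prop) (U : set B).
Local Notation Q := (cube R).
Local Notation bd := (cube_bdry R).

(* [over b e] plays the part of a fibration, [f] of a map to the base and [g] of a
   lift known on [D]; only its restriction to [D'] has to be preserved.  The set [U]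
   of admissible base points is all of [B] except for spaces of paths. *)
Definition lext2 (T : topologicalType) (D D' : set T) :=
  forall (f : T -> B) (g : T -> E), continuous f -> (forall x, U (f x)) ->
    ccont D g -> (forall x, D x -> over (f x) (g x)) ->
    exists g' : T -> E, [/\ continuous g', forall x, over (f x) (g' x)
      & forall x, D' x -> g' x = g x].

Definition lext (T : topologicalType) (D : set T) := lext2 D D.

Definition LP n := lext (bd n).

(** A retract suffices: the problem is pulled back along [th'] and its solution restricted along
    [th]. *)
Lemma lext2_transfer (T T' : topologicalType) (D1 D2 : set T) (E1 E2 : set T')
    (th : T -> T') (th' : T' -> T) :
  continuous th -> continuous th' -> cancel th th' -> closed E1 ->
  (forall y, E1 y -> D1 (th' y)) -> (forall x, D2 x -> E2 (th x)) ->
  lext2 E1 E2 -> lext2 D1 D2.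
Proof.
move=> cth cth' thK cE1 ED DE hE f g cf fU cg gf.
have [||||g' [cg' og' gg']] := hE (f \o th') (g \o th').
- exact: continuous_compT.
- by move=> x /=.
- by apply: ccont_comp (cg) _ _ => //; exact: continuous_ccont.
- by move=> x /= E1x; apply: gf; exact: ED.
exists (g' \o th); split=> [|x|x D2x] /=.
- exact: continuous_compT.
- by have := og' (th x); rewrite /= thK.
- by rewrite gg'/= ?thK//; exact: DE.
Qed.

Section Halving.
Variables (n : nat) (j : 'I_n.+1).
Implicit Type x : Q n.+1.

(** [half0] and [half1] embed the cube as its two halves in direction [j], [dbl0] and [dbl1] invert
    them on the respective half (elsewhere clamping interferes), and [wall] is the common face. *)
Definition half0 x : Q n.+1 :=
  qrow (fun i => if i == j then crd x i / 2 else crd x i).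
Definition half1 x : Q n.+1 :=
  qrow (fun i => if i == j then (crd x i + 1) / 2 else crd x i).
Definition dbl0 x : Q n.+1 :=
  qrow (fun i => if i == j then 2 * crd x i else crd x i).
Definition dbl1 x : Q n.+1 :=
  qrow (fun i => if i == j then 2 * crd x i - 1 else crd x i).
Definition wall (y : Q n) : Q n.+1 :=
  qrow (fun i => oapp (crd y) 2^-1 (unlift j i)).
Definition unwall x : Q n := qrow (fun i => crd x (lift j i)).

Lemma crd_half0 x i : crd (half0 x) i = if i == j then crd x i / 2 else crd x i.
Proof.
by rewrite crd_qrow_id//; have := crd_itv x i; case: eqP => // _; lra.
Qed.
Lemma crd_half1 x i :
  crd (half1 x) i = if i == j then (crd x i + 1) / 2 else crd x i.
Proof.
by rewrite crd_qrow_id//; have := crd_itv x i; case: eqP => // _; lra.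
Qed.
Lemma crd_dbl0 x i : crd x j <= 2^-1 ->
  crd (dbl0 x) i = if i == j then 2 * crd x i else crd x i.
Proof.
move=> xj; rewrite crd_qrow_id//; have := crd_itv x i.
by case: eqP => [->|//] _; have := crd_itv x j; lra.
Qed.
Lemma crd_dbl1 x i : 2^-1 <= crd x j ->
  crd (dbl1 x) i = if i == j then 2 * crd x i - 1 else crd x i.
Proof.
move=> xj; rewrite crd_qrow_id//; have := crd_itv x i.
by case: eqP => [->|//] _; have := crd_itv x j; lra.
Qed.
Lemma crd_wall y i : crd (wall y) i = oapp (crd y) 2^-1 (unlift j i).
Proof.
rewrite crd_qrow_id//; case: unliftP => [k _|_] /=; first exact: crd_itv.
by lra.
Qed.
Lemma crd_unwall x i : crd (unwall x) i = crd x (lift j i).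
Proof. by rewrite crd_qrow_id// crd_itv. Qed.
Lemma crd_wall_lift y i : crd (wall y) (lift j i) = crd y i.
Proof. by rewrite crd_wall liftK. Qed.

Lemma half0K x : crd x j <= 2^-1 -> half0 (dbl0 x) = x.
Proof.
move=> xj; apply: qext => i; rewrite crd_half0 crd_dbl0//.
by case: eqP => // _; field.
Qed.
Lemma half1K x : 2^-1 <= crd x j -> half1 (dbl1 x) = x.
Proof.
move=> xj; apply: qext => i; rewrite crd_half1 crd_dbl1//.
by case: eqP => // _; field.
Qed.
Lemma unwallK x : crd x j = 2^-1 -> wall (unwall x) = x.
Proof.
move=> xj; apply: qext => i; rewrite crd_wall.
by case: unliftP => [k ->|->] /=; rewrite ?crd_unwall.
Qed.
Lemma continuous_half0 : continuous half0.
Proof.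
apply: continuous_qrow => i; case: eqP => _; last exact: continuous_crd.
by apply: contM; [exact: continuous_crd|exact: cont_cst].
Qed.
Lemma continuous_half1 : continuous half1.
Proof.
apply: continuous_qrow => i; case: eqP => _; last exact: continuous_crd.
apply: contM; last exact: cont_cst.
by apply: contD; [exact: continuous_crd|exact: cont_cst].
Qed.
Lemma continuous_dbl0 : continuous dbl0.
Proof.
apply: continuous_qrow => i; case: eqP => _; last exact: continuous_crd.
by apply: contMl; exact: continuous_crd.
Qed.
Lemma continuous_dbl1 : continuous dbl1.
Proof.
apply: continuous_qrow => i; case: eqP => _; last exact: continuous_crd.
apply: contB; last exact: cont_cst.
by apply: contMl; exact: continuous_crd.
Qed.
Lemma continuous_wall : continuous wall.
Proof.
apply: continuous_qrow => i; case: unlift => [k|] /=; last exact: cont_cst.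
exact: continuous_crd.
Qed.
Lemma continuous_unwall : continuous unwall.
Proof. by apply: continuous_qrow => i; exact: continuous_crd. Qed.

Lemma wall_bd y : bd n y -> bd n.+1 (wall y).
Proof. by move=> [i hi]; exists (lift j i); rewrite -/(crd _ _) crd_wall_lift. Qed.

Lemma unwall_bd x : crd x j = 2^-1 -> bd n.+1 x -> bd n (unwall x).
Proof.
move=> xj [i]; rewrite -/(crd x i) => hi.
have [k ik|ij] := unliftP j i; last by move: hi; rewrite ij xj => -[]; lra.
by exists k; rewrite -/(crd _ _) crd_unwall -ik.
Qed.

Lemma half0_bd x : bd n.+1 x -> bd n.+1 (half0 x) \/ crd (half0 x) j = 2^-1.
Proof.
move=> [i]; rewrite -/(crd x i) => hi; have [ij|ij] := eqVneq i j; last first.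
  by left; exists i; rewrite -/(crd _ _) crd_half0 (negPf ij).
case: hi => xi; last by right; rewrite crd_half0 eqxx -ij xi; lra.
by left; exists i; rewrite -/(crd _ _) crd_half0 ij eqxx -ij xi; left; lra.
Qed.
Lemma half1_bd x : bd n.+1 x -> bd n.+1 (half1 x) \/ crd (half1 x) j = 2^-1.
Proof.
move=> [i]; rewrite -/(crd x i) => hi; have [ij|ij] := eqVneq i j; last first.
  by left; exists i; rewrite -/(crd _ _) crd_half1 (negPf ij).
case: hi => xi; first by right; rewrite crd_half1 eqxx -ij xi; lra.
by left; exists i; rewrite -/(crd _ _) crd_half1 ij eqxx -ij xi; right; lra.
Qed.
Lemma dbl0_bd x : crd x j <= 2^-1 -> bd n.+1 x \/ crd x j = 2^-1 -> bd n.+1 (dbl0 x).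
Proof.
move=> xj [[i]|xj2]; last first.
  by exists j; rewrite -/(crd _ _) crd_dbl0// eqxx xj2; right; lra.
rewrite -/(crd x i) => hi; exists i; rewrite -/(crd _ _) crd_dbl0//.
by case: eqP hi => // -> [|] xi; [left|right]; lra.
Qed.
Lemma dbl1_bd x : 2^-1 <= crd x j -> bd n.+1 x \/ crd x j = 2^-1 -> bd n.+1 (dbl1 x).
Proof.
move=> xj [[i]|xj2]; last first.
  by exists j; rewrite -/(crd _ _) crd_dbl1// eqxx xj2; left; lra.
rewrite -/(crd x i) => hi; exists i; rewrite -/(crd _ _) crd_dbl1//.
by case: eqP hi => // -> [|] xi; [left|right]; lra.
Qed.

(** Solving on the wall first spends the gap from [c] to [c1]. The result and [g] prescribe the lift
    on the boundary of each half, and solving there spends the gap from [c1] to [c']; the two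
    solutions agree on the wall. *)
Lemma lext2_halves (phi : Q n.+1 -> R) (c c1 c' : R) :
  continuous phi -> c' <= c1 -> c1 <= c ->
  lext2 (bd n `|` [set y | phi (wall y) <= c]) (bd n `|` [set y | phi (wall y) <= c1]) ->
  lext2 (bd n.+1 `|` [set x | phi (half0 x) <= c1])
        (bd n.+1 `|` [set x | phi (half0 x) <= c']) ->
  lext2 (bd n.+1 `|` [set x | phi (half1 x) <= c1])
        (bd n.+1 `|` [set x | phi (half1 x) <= c']) ->
  lext2 (bd n.+1 `|` [set x | phi x <= c]) (bd n.+1 `|` [set x | phi x <= c']).
Proof.
move=> cphi c'1 c1c hw h0 h1 f g cf fU cg og.
pose D := bd n.+1 `|` [set x | phi x <= c].
pose D1 := bd n.+1 `|` [set x | phi x <= c1].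
have clD d : closed (bd n.+1 `|` [set x | phi x <= d]).
  by apply: closedU; [exact: closed_bd|apply: closed_lef => //; exact: cont_cst].
have D1D : D1 `<=` D by move=> x [|/= h]; [left|right => /=; exact: le_trans c1c].
have wD y : (bd n `|` [set y | phi (wall y) <= c]) y -> D (wall y).
  by move=> [/wall_bd|]; [left|right].
have [||||gw [cgw ogw ggw]] := hw (f \o wall) (g \o wall).
- by apply: continuous_compT => //; exact: continuous_wall.
- by move=> x /=.
- apply: ccont_comp (cg) _ wD; apply: continuous_ccont; first exact: continuous_wall.
  apply: closedU; first exact: closed_bd.
  apply: closed_lef; last exact: cont_cst.
  by apply: continuous_compT => //; exact: continuous_wall.
- by move=> y /wD; exact: og.
(* On the wall the new lift takes over; on [D1] nothing changes, so the two closed pieces glue. *)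
pose g1 x := if crd x j == 2^-1 then gw (unwall x) else g x.
have g1D1 x : D1 x -> g1 x = g x.
  move=> D1x; rewrite /g1; case: eqP => // xj; rewrite ggw /= ?unwallK//.
  by case: D1x => [/(unwall_bd xj)|px]; [left|right].
pose W := [set x : Q n.+1 | crd x j = 2^-1].
have clW : closed W by apply: closed_eqf; [exact: continuous_crd|exact: cont_cst].
have cg1 : ccont (D1 `|` W) g1.
  apply: ccontU.
    by apply: (@ccont_eq _ _ _ g) => [|x /g1D1//]; exact: ccont_sub cg (clD _) D1D.
  apply: (@ccont_eq _ _ _ (gw \o unwall)) => [|x /= Wx]; last by rewrite /g1 Wx eqxx.
  apply: ccont_compT => //; apply: continuous_ccont => //; exact: continuous_unwall.
have og1 x : (D1 `|` W) x -> over (f x) (g1 x).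
  move=> [D1x|Wx]; first by rewrite g1D1//; apply/og/D1D.
  by rewrite /g1 Wx eqxx; have := ogw (unwall x); rewrite /= unwallK.
have half (h h' : Q n.+1 -> Q n.+1) (L : set (Q n.+1)) :
    continuous h -> continuous h' -> closed L ->
    (forall x, bd n.+1 x -> bd n.+1 (h x) \/ W (h x)) ->
    (forall x, L x -> bd n.+1 x \/ W x -> bd n.+1 (h' x)) ->
    (forall x, L x -> h (h' x) = x) ->
    lext2 (bd n.+1 `|` [set x | phi (h x) <= c1])
        (bd n.+1 `|` [set x | phi (h x) <= c']) ->
    exists g2 : Q n.+1 -> E, [/\ ccont L g2, forall x, L x -> over (f x) (g2 x),
      forall x, L x -> W x -> g2 x = g1 x
      & forall x, L x -> (bd n.+1 `|` [set x | phi x <= c']) x -> g2 x = g x].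
  move=> ch ch' clL hbd hbd' hK hl.
  have hD x : (bd n.+1 `|` [set x | phi (h x) <= c1]) x -> (D1 `|` W) (h x).
    by move=> [/hbd [|]|]; [left; left|right|left; right].
  have [||||g2 [cg2 og2 gg2]] := hl (f \o h) (g1 \o h).
  - exact: continuous_compT.
  - by move=> x /=.
  - apply: ccont_comp (cg1) _ hD; apply: continuous_ccont => //.
    apply: closedU; first exact: closed_bd.
    by apply: closed_lef; [exact: continuous_compT|exact: cont_cst].
  - by move=> x /hD; exact: og1.
  exists (g2 \o h'); split=> [|x Lx|x Lx Wx|x Lx hx] /=.
  - by apply: ccont_compT => //; exact: continuous_ccont.
  - by have := og2 (h' x); rewrite /= hK.
  - by rewrite gg2 /= ?hK//; left; apply: hbd' => //; right.
  - rewrite gg2 /= ?hK//; last first.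
      by case: hx => [bx|/= px]; [left; apply: hbd' => //; left|right].
    by rewrite g1D1//; case: hx => [|/= px]; [left|right; exact: le_trans c'1].
have [|||||g20 [cg20 og20 w20 gg20]] :=
    half half0 dbl0 [set x | crd x j <= 2^-1] continuous_half0 continuous_dbl0.
- by apply: closed_lef; [exact: continuous_crd|exact: cont_cst].
- exact: half0_bd.
- exact: dbl0_bd.
- exact: half0K.
- exact: h0.
have [|||||g21 [cg21 og21 w21 gg21]] :=
    half half1 dbl1 [set x | 2^-1 <= crd x j] continuous_half1 continuous_dbl1.
- by apply: closed_lef; [exact: cont_cst|exact: continuous_crd].
- exact: half1_bd.
- exact: dbl1_bd.
- exact: half1K.
- exact: h1.
exists (fun x => if crd x j <= 2^-1 then g20 x else g21 x); split.
- apply/ccontT; rewrite (_ : setT = [set x : Q n.+1 | crd x j <= 2^-1] `|`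
      [set x : Q n.+1 | 2^-1 <= crd x j]); last first.
    by apply/seteqP; split=> // x _; apply/orP; exact: le_total.
  apply: ccontU.
    by apply: (@ccont_eq _ _ _ g20) => // x /= ->.
  apply: (@ccont_eq _ _ _ g21) => // x /= xj; case: ifP => // xj'.
  have Wx : W x by apply/le_anti; rewrite xj' xj.
  by rewrite w20 ?w21.
- move=> x; case: ifPn => xj; first exact: og20.
  by apply: og21 => /=; rewrite ltW// ltNge.
- move=> x hx; case: ifPn => xj; first exact: gg20.
  by apply: gg21 => //=; rewrite ltW// ltNge.
Qed.

End Halving.

(** [w j] counts the halvings still due in direction [j]. On a box with these sides, [phi] is either
    at most [mid] everywhere or greater than [c'] everywhere. *)
Definition fine_mod n (mid c' : R) (w : 'I_n -> nat) (phi : Q n -> R) :=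
  forall x y : Q n, (forall j, `|crd x j - crd y j| <= 2^-1 ^+ w j) ->
    phi x <= mid \/ c' < phi y.

Lemma fine_half n (j : 'I_n.+1) mid c' w (phi : Q n.+1 -> R) (h : Q n.+1 -> Q n.+1) :
  (0 < w j)%N ->
  (forall x y i, `|crd (h x) i - crd (h y) i| =
     if i == j then `|crd x i - crd y i| / 2 else `|crd x i - crd y i|) ->
  fine_mod mid c' w phi ->
  fine_mod mid c' (fun i => if i == j then (w i).-1 else w i) (phi \o h).
Proof.
move=> wj hh fw x y hxy; apply: fw => i; rewrite hh; have := hxy i.
case: eqP => // -> /= hj; rewrite -(prednK wj) exprSr.
by rewrite ler_pM2r// invr_gt0.
Qed.

(* Halve the cube until each piece lies in [phi <= mid] or in [c' < phi]; the walls
   are cubes of lower dimension. *)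
Lemma lext2_cube n : (forall i, (i <= n)%N -> LP i) ->
  forall (phi : Q n -> R) (c c' : R), continuous phi -> c' < c ->
  lext2 (bd n `|` [set x | phi x <= c]) (bd n `|` [set x | phi x <= c']).
Proof.
elim: n => [|n IH] LPn phi c c' cphi cc'.
  move=> f g cf fU cg og.
  have cst (x y : Q 0) : x = y by apply: qext => -[].
  have [h|h] := pselect (exists x : Q 0, phi x <= c).
    case: h => x0 px0; exists g; split=> //.
    - apply/ccontT; rewrite (_ : setT = bd 0 `|` [set x | phi x <= c])//.
      by apply/seteqP; split=> // x _; right => /=; rewrite (cst x x0).
    - by move=> x; apply: og; right => /=; rewrite (cst x x0).
  have [||||g' [cg' og' gg']] := LPn 0 (leqnn _) f g => //.
  - by apply: ccont_sub cg (@closed_bd R 0) _; left.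
  - by move=> x bx; apply: og; left.
  exists g'; split=> // x [|/= px]; first exact: gg'.
  by exfalso; apply: h; exists x; rewrite (le_trans px)// ltW.
(* [mid] stays fixed in the recursion on the number [N] of halvings, while the upper threshold moves
   only halfway towards it: no number of halvings exhausts the gap. *)
pose mid := (c + c') / 2.
suff key N : forall w, (\sum_j w j)%N = N -> forall phi : Q n.+1 -> R, continuous phi ->
    fine_mod mid c' w phi -> forall c, mid < c ->
    lext2 (bd n.+1 `|` [set x | phi x <= c]) (bd n.+1 `|` [set x | phi x <= c']).
  have [|N hN] := @unif_cont_Q R n.+1 phi (mid - c') cphi; first by rewrite /mid; lra.
  apply: (key _ (fun=> N) erefl) => //; last by rewrite /mid; lra.
  move=> x y /hN; have [|h] := leP (phi x) mid; first by left.
  by rewrite ltr_norml => /andP[_ h2]; right; lra.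
have c'mid : c' < mid by rewrite /mid; lra.
elim: N => [|N IHN] w wN {}phi {}cphi fphi c2 midc.
  (* No halving is due, so the cube is a single box: either [phi <= mid] and [g] is defined
     everywhere, or [c' < phi] and only the boundary values matter. *)
  move=> f g cf fU cg og.
  have w0 j : w j = 0 by apply/eqP; rewrite -leqn0 -wN (bigD1 j)//= leq_addr.
  have all x y : phi x <= mid \/ c' < phi y.
    apply: fphi => j; rewrite w0 expr0; have := crd_itv x j; have := crd_itv y j.
    by rewrite ler_norml; lra.
  have [h|h] := pselect (forall x, phi x <= mid).
    exists g; split=> //.
    - apply/ccontT; rewrite (_ : setT = bd n.+1 `|` [set x | phi x <= c2])//.
      by apply/seteqP; split=> // x _; right => /=; rewrite (le_trans (h x))// ltW.
    - by move=> x; apply: og; right => /=; rewrite (le_trans (h x))// ltW.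
  have {}h y : c' < phi y.
    have /existsNP[x /negP] := h; rewrite -ltNge => hx.
    by case: (all x y) => //; rewrite leNgt hx.
  have [||||g' [cg' og' gg']] := LPn n.+1 (leqnn _) f g => //.
  - by apply: ccont_sub cg (@closed_bd R n.+1) _; left.
  - by move=> x bx; apply: og; left.
  exists g'; split=> // x [|/= px]; first exact: gg'.
  by have := h x; rewrite ltNge px.
have [j wj] : exists j, (0 < w j)%N.
  apply: contrapT => /forallNP nw; have : (\sum_j w j)%N = 0 by
    apply: big1 => j _; apply/eqP; rewrite -leqn0 leqNgt; apply/negP; exact: nw.
  by rewrite wN.
pose w' i := if i == j then (w i).-1 else w i.
have wN' : (\sum_i w' i)%N = N.
  rewrite (bigD1 j)//= in wN; rewrite (bigD1 j)//= /w' eqxx.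
  rewrite (eq_bigr w) => [|i /negPf ->//].
  by move: wN; rewrite -{1}(prednK wj) addSn => -[].
pose c1 := (c2 + mid) / 2.
apply: (@lext2_halves n j phi c2 c1 c') => //; try by rewrite /c1; lra.
- apply: (IH _ (phi \o @wall n j)).
  + by move=> i ni; apply: LPn; exact: leqW.
  + by apply: continuous_compT => //; exact: continuous_wall.
  + by rewrite /c1; lra.
- apply: (IHN w' wN' (phi \o @half0 n j)) => //.
  + by apply: continuous_compT => //; exact: continuous_half0.
  + apply: fine_half => // x y i; rewrite !crd_half0; case: eqP => // _.
    by rewrite -mulrBl normrM [`|2^-1|]ger0_norm ?invr_ge0.
  + by rewrite /c1; lra.
- apply: (IHN w' wN' (phi \o @half1 n j)) => //.
  + by apply: continuous_compT => //; exact: continuous_half1.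
  + apply: fine_half => // x y i; rewrite !crd_half1; case: eqP => // _.
    rewrite -mulrBl normrM [`|2^-1|]ger0_norm ?invr_ge0//.
    by rewrite opprD addrACA subrr addr0.
  + by rewrite /c1; lra.
Qed.

End Lifting.

(** * Discs *)

Section Norms.
Context {R : realType}.

Definition ninf n (F : 'I_n -> R) : R := `|\row_j F j|.
Definition nsq n (F : 'I_n -> R) : R := \sum_j F j ^+ 2.
Definition neuc n (F : 'I_n -> R) : R := Num.sqrt (nsq F).

Lemma ninf_ge0 n (F : 'I_n -> R) : 0 <= ninf F. Proof. exact: normr_ge0. Qed.

Lemma ninf_le n (F : 'I_n -> R) j : `|F j| <= ninf F.
Proof.
rewrite /ninf {2}/Num.norm /= mx_normrE; apply: le_trans (le_bigmax _ _ (ord0, j)).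
by rewrite /= mxE.
Qed.

Lemma ninf_attained n (F : 'I_n -> R) : ninf F != 0 -> exists j, ninf F = `|F j|.
Proof. by move=> /mx_norm_neq0 [[i j] /=]; rewrite mxE => ?; exists j. Qed.

Lemma ninf_lub n (F : 'I_n -> R) c : 0 <= c -> (forall j, `|F j| <= c) -> ninf F <= c.
Proof.
move=> c0 Fc; have [-> //|/ninf_attained [j ->]] := eqVneq (ninf F) 0; exact: Fc.
Qed.

Lemma ninfZ n (a : R) (F : 'I_n -> R) : ninf (fun j => a * F j) = `|a| * ninf F.
Proof.
rewrite /ninf -normrZ; congr (`|_|); by apply/rowP => j; rewrite !mxE.
Qed.

Lemma nsq_ge0 n (F : 'I_n -> R) : 0 <= nsq F.
Proof. by apply: sumr_ge0 => j _; exact: sqr_ge0. Qed.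
Lemma neuc_ge0 n (F : 'I_n -> R) : 0 <= neuc F. Proof. exact: sqrtr_ge0. Qed.
Lemma neuc_sq n (F : 'I_n -> R) : neuc F ^+ 2 = nsq F.
Proof. by rewrite sqr_sqrtr// nsq_ge0. Qed.

Lemma nsqZ n (a : R) (F : 'I_n -> R) : nsq (fun j => a * F j) = a ^+ 2 * nsq F.
Proof. by rewrite /nsq mulr_sumr; apply: eq_bigr => j _; rewrite exprMn. Qed.

Lemma neucZ n (a : R) (F : 'I_n -> R) : neuc (fun j => a * F j) = `|a| * neuc F.
Proof. by rewrite /neuc nsqZ sqrtrM ?sqr_ge0// sqrtr_sqr. Qed.

Lemma neuc_le n (F : 'I_n -> R) j : `|F j| <= neuc F.
Proof.
rewrite -(@ler_pXn2r _ 2)// ?nnegrE ?neuc_ge0// neuc_sq real_normK ?num_real//.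
by rewrite /nsq (bigD1 j)//= lerDl sumr_ge0// => i _; exact: sqr_ge0.
Qed.

Lemma neuc_eq0 n (F : 'I_n -> R) j : neuc F = 0 -> F j = 0.
Proof. by move=> F0; apply/eqP; rewrite -normr_le0 -F0 neuc_le. Qed.

Lemma ninf_eq0 n (F : 'I_n -> R) j : ninf F = 0 -> F j = 0.
Proof. by move=> F0; apply/eqP; rewrite -normr_le0 -F0 ninf_le. Qed.

Lemma neuc0 n (F : 'I_n -> R) : (forall j, F j = 0) -> neuc F = 0.
Proof. by move=> F0; rewrite /neuc /nsq big1 ?sqrtr0// => j _; rewrite F0 expr0n. Qed.

Lemma ninf0 n (F : 'I_n -> R) : (forall j, F j = 0) -> ninf F = 0.
Proof. by move=> F0; apply/le_anti; rewrite ninf_ge0 ninf_lub// => j; rewrite F0 normr0. Qed.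

Lemma neuc_le1 n (F : 'I_n -> R) : (neuc F <= 1) = (nsq F <= 1).
Proof. by rewrite -neuc_sq expr_le1// neuc_ge0. Qed.

Lemma neuc_triangle n (F G : 'I_n -> R) :
  neuc (fun j => F j + G j) <= neuc F + neuc G.
Proof.
rewrite -(@ler_pXn2r _ 2)// ?nnegrE ?addr_ge0 ?neuc_ge0// sqrrD !neuc_sq.
have -> : nsq (fun j => F j + G j) = nsq F + (\sum_j F j * G j) *+ 2 + nsq G.
  by rewrite /nsq -sumrMnl -!big_split; apply: eq_bigr => j _; rewrite sqrrD.
rewrite lerD2r lerD2l lerMn2r /=.
have [F0|F0] := eqVneq (neuc F) 0.
  by rewrite F0 mul0r big1// => j _; rewrite (neuc_eq0 _ F0) mul0r.
have [G0|G0] := eqVneq (neuc G) 0.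
  by rewrite G0 mulr0 big1// => j _; rewrite (neuc_eq0 _ G0) mulr0.
have F1 : 0 < neuc F by rewrite lt_neqAle eq_sym F0 neuc_ge0.
have G1 : 0 < neuc G by rewrite lt_neqAle eq_sym G0 neuc_ge0.
(* expand the square of |G| F - |F| G *)
have : 0 <= nsq (fun j => neuc G * F j - neuc F * G j) by exact: nsq_ge0.
have -> : nsq (fun j => neuc G * F j - neuc F * G j) =
    neuc G ^+ 2 * nsq F - (neuc F * neuc G * \sum_j F j * G j) *+ 2 + neuc F ^+ 2 * nsq G.
  rewrite /nsq !mulr_sumr -sumrMnl -sumrN -!big_split; apply: eq_bigr => j _ /=.
  by ring.
rewrite !neuc_sq => h.
rewrite -(ler_pM2l (mulr_gt0 F1 G1)) mulrACA -!expr2 !neuc_sq.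
by move: h; rewrite [nsq G * nsq F]mulrC; lra.
Qed.

Lemma cont_ninf (T : topologicalType) n (F : T -> 'I_n -> R) :
  (forall j, continuous (F^~ j)) -> continuous (fun x => ninf (F x)).
Proof.
move=> cF; have cr : continuous (fun x => \row_j F x j : 'rV[R]_n).
  apply: continuous_rV => j; rewrite (_ : (fun x => _) = F^~ j)//.
  by apply/funext => x; rewrite mxE.
by move=> x; apply: cvg_norm; exact: cr.
Qed.

Lemma cont_sqrt (T : topologicalType) (f : T -> R) :
  continuous f -> continuous (fun x => Num.sqrt (f x)).
Proof.
by move=> cf; apply: (@continuous_compT _ _ _ (@Num.sqrt R)) => //; exact: sqrt_continuous.
Qed.

Lemma cont_neuc (T : topologicalType) n (F : T -> 'I_n -> R) :
  (forall j, continuous (F^~ j)) -> continuous (fun x => neuc (F x)).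
Proof.
move=> cF; apply: cont_sqrt; apply: cont_sum => j.
by rewrite (_ : (fun x => _) = (fun x => F x j * F x j)); [exact: contM|apply/funext].
Qed.

(* At the zeros of [g] the quotient is a junk [0], which is the limit. *)
Lemma cont_ratio (T : topologicalType) (f g N : T -> R) :
  continuous f -> continuous g -> continuous N -> (forall x, `|f x| <= g x) ->
  (forall x, g x = 0 -> N x = 0) -> continuous (fun x => f x * N x / g x).
Proof.
move=> cf cg cN fg gN x; have [gx|gx] := eqVneq (g x) 0; last first.
  apply: cvgM; first by apply: cvgM; [exact: cf|exact: cN].
  by apply: cvgV => //; exact: cg.
have Nx := gN _ gx.
apply/cvgrPdist_lt => e e0.
have /cvgrPdist_lt /(_ _ e0) := cN x; apply: filterS => y.
rewrite Nx gx !(mulr0, mul0r) !sub0r !normrN; apply: le_lt_trans.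
have [gy|gy] := eqVneq (g y) 0; first by rewrite gy invr0 mulr0 normr0.
have g0 : 0 < g y by rewrite lt_neqAle eq_sym gy (le_trans _ (fg y)).
rewrite mulrAC normrM -[leRHS]mul1r ler_wpM2r// normrM normfV (gtr0_norm g0).
by rewrite ler_pdivrMr// mul1r.
Qed.

End Norms.

Section Disc.
Context {R : realType}.
Local Notation Q := (cube R).
Local Notation bd := (cube_bdry R).
Local Notation disc := (disc R).
Local Notation sphere := (sphere R).

Definition dcrd n (v : disc n) (j : 'I_n) : R := (set_val v : 'rV_n) 0 j.

Lemma dext n (x y : disc n) : dcrd x =1 dcrd y -> x = y.
Proof. by move=> xy; apply: val_inj; apply/rowP. Qed.

Lemma continuous_dcrd n (j : 'I_n) : continuous (fun x : disc n => dcrd x j).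
Proof.
apply: (@continuous_compT _ _ _ (fun v : 'rV[R]_n => v 0 j) set_val).
  exact: coord_continuous.
exact: continuous_set_val.
Qed.

Definition drad n (v : disc n) : R := neuc (dcrd v).

Lemma drad_ge0 n (v : disc n) : 0 <= drad v. Proof. exact: neuc_ge0. Qed.
Lemma drad_le1 n (v : disc n) : drad v <= 1.
Proof. by rewrite /drad neuc_le1; exact: (set_valP v). Qed.
Lemma continuous_drad n : continuous (@drad n).
Proof. by apply: cont_neuc => j; exact: continuous_dcrd. Qed.

Lemma open_discE n (v : disc n) : open_disc R n v <-> drad v < 1.
Proof.
by rewrite /drad -(@expr_lt1 _ 2)// ?neuc_ge0// neuc_sq.
Qed.
Lemma sphereE n (v : disc n) : sphere n v <-> drad v = 1.
Proof.
split=> [h|h]; last by change (nsq (dcrd v) = 1); rewrite -neuc_sq -/(drad v) h expr1n.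
by rewrite /drad /neuc (_ : nsq _ = 1) ?sqrtr1//; exact: h.
Qed.
Lemma disc_cases n (v : disc n) : open_disc R n v \/ sphere n v.
Proof.
rewrite open_discE sphereE; have := drad_le1 v.
by rewrite le_eqVlt => /orP[/eqP|]; [right|left].
Qed.

Lemma drow_subproof n (F : 'I_n -> R) :
  (\row_j ((Num.max 1 (neuc F))^-1 * F j)) \in disc n.
Proof.
rewrite inE /= /disc /mkset.
under eq_bigr do rewrite mxE.
rewrite -[leLHS]/(nsq (fun j => (Num.max 1 (neuc F))^-1 * F j)) -neuc_le1 neucZ.
have m0 : 0 < Num.max 1 (neuc F) by rewrite lt_max ltr01.
rewrite normfV (gtr0_norm m0) mulrC ler_pdivrMr// mul1r.
by rewrite le_max lexx orbT.
Qed.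
(** Radial retraction onto the disc, total for the same reason as [qrow] and exact on vectors of
    norm at most 1. *)
Definition drow n (F : 'I_n -> R) : disc n := mksub (drow_subproof F).

Lemma dcrd_drow n (F : 'I_n -> R) j : neuc F <= 1 -> dcrd (drow F) j = F j.
Proof.
by move=> F1; rewrite /dcrd /= set_valE /= mxE max_l// invr1 mul1r.
Qed.

Lemma continuous_drow (T : topologicalType) n (F : T -> 'I_n -> R) :
  (forall j, continuous (F^~ j)) -> continuous (fun x => drow (F x)).
Proof.
move=> cF; apply: continuous_into; apply: continuous_rV => j.
rewrite (_ : (fun x => _) = (fun x => (Num.max 1 (neuc (F x)))^-1 * F x j)); last first.
  by apply/funext => x /=; rewrite set_valE /= mxE.
apply: contM => //; apply: contV => [x|].
  by rewrite gt_eqF// lt_max ltr01.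
by apply: cont_max; [exact: cont_cst|exact: cont_neuc].
Qed.

Lemma chaus_disc n : chaus (disc n).
Proof.
have cs : closed (disc n : set 'rV[R]_n).
  apply: (@closed_lef R 'rV[R]_n (fun v => \sum_(j < n) v 0 j ^+ 2)); last exact: cont_cst.
  apply: cont_sum => j.
  by rewrite (_ : (fun x => _) = (fun x : 'rV[R]_n => x 0 j * x 0 j)); [apply: contM; exact: coord_continuous|apply/funext].
apply: chaus_subtype; last exact: norm_hausdorff.
apply: bounded_closed_compact => //.
exists 1; split=> // M M1 v /= hv; rewrite {1}/Num.norm /= mx_normrE.
apply/bigmax_leP; split=> [|[i j] _ /=]; first by rewrite (le_trans ler01)// ltW.
apply: le_trans (ltW M1); rewrite (ord1 i).
apply: le_trans (neuc_le (fun j => v 0 j) j) _.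
by rewrite neuc_le1.
Qed.

Lemma closed_sphere n : closed (sphere n).
Proof.
rewrite (_ : sphere n = [set v | drad v = 1]).
  by apply: closed_eqf; [exact: continuous_drad|exact: cont_cst].
by apply/seteqP; split=> v /sphereE.
Qed.

(** Recentred coordinates in [-1, 1], for which the cube is the unit ball of the sup norm. *)
Definition qc n (s : Q n) (j : 'I_n) : R := 2 * crd s j - 1.
Lemma qc_norm n (s : Q n) j : `|qc s j| <= 1.
Proof. by rewrite ler_norml /qc; have := crd_itv s j; lra. Qed.
Lemma ninf_qc n (s : Q n) : ninf (qc s) <= 1.
Proof. by apply: ninf_lub => // j; exact: qc_norm. Qed.
Lemma continuous_qc n (j : 'I_n) : continuous (fun s : Q n => qc s j).
Proof. by apply: contB; [apply: contMl; exact: continuous_crd|exact: cont_cst]. Qed.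
Definition qmk n (F : 'I_n -> R) : Q n := qrow (fun j => (1 + F j) / 2).
Lemma qc_qmk n (F : 'I_n -> R) j : `|F j| <= 1 -> qc (qmk F) j = F j.
Proof.
rewrite ler_norml => h; rewrite /qc crd_qrow_id; first by field.
by move: h; lra.
Qed.
Lemma qc_inj n (s s' : Q n) : qc s =1 qc s' -> s = s'.
Proof. by move=> h; apply: qext => j; have := h j; rewrite /qc; lra. Qed.
Lemma continuous_qmk (T : topologicalType) n (F : T -> 'I_n -> R) :
  (forall j, continuous (F^~ j)) -> continuous (fun x => qmk (F x)).
Proof.
move=> cF; apply: continuous_qrow => j; apply: contM; last exact: cont_cst.
by apply: contD => //; exact: cont_cst.
Qed.
Lemma bd_qc n (s : Q n) : bd n s <-> ninf (qc s) = 1.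
Proof.
split=> [[j]|].
  rewrite -/(crd s j) => hj; apply/le_anti; rewrite ninf_qc /=.
  apply: le_trans (ninf_le _ j); rewrite /qc.
  by case: hj => ->; rewrite ?mulr0 ?sub0r ?normrN ?mulr1 ?normr1// ger0_norm; lra.
move=> s1; have [|j hj] := @ninf_attained R n (qc s); first by rewrite s1 oner_neq0.
exists j; rewrite -/(crd s j); move: hj; rewrite s1 /qc.
by case: (ger0P (2 * crd s j - 1)) => _ h; [right|left]; lra.
Qed.

(** Radial rescaling by the ratio of the Euclidean and the sup norm; at the centre the quotient is 0
    by convention. *)
Definition disc_cube n (v : disc n) : Q n :=
  qmk (fun j => dcrd v j * drad v / ninf (dcrd v)).
Definition cube_disc n (s : Q n) : disc n :=
  drow (fun j => qc s j * ninf (qc s) / neuc (qc s)).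

Lemma continuous_disc_cube n : continuous (@disc_cube n).
Proof.
apply: continuous_qmk => j; apply: cont_ratio.
- exact: continuous_dcrd.
- by apply: cont_ninf => i; exact: continuous_dcrd.
- exact: continuous_drad.
- by move=> x; exact: ninf_le.
- by move=> x x0; apply: neuc0 => i; exact: ninf_eq0.
Qed.

Lemma continuous_cube_disc n : continuous (@cube_disc n).
Proof.
apply: continuous_drow => j; apply: cont_ratio.
- exact: continuous_qc.
- by apply: cont_neuc => i; exact: continuous_qc.
- by apply: cont_ninf => i; exact: continuous_qc.
- by move=> x; exact: neuc_le.
- by move=> x x0; apply: ninf0 => i; exact: neuc_eq0.
Qed.

Lemma neuc_cube_disc n (s : Q n) :
  neuc (fun j => qc s j * ninf (qc s) / neuc (qc s)) = ninf (qc s).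
Proof.
have [s0|s0] := eqVneq (neuc (qc s)) 0.
  rewrite neuc0 => [|j]; last by rewrite s0 invr0 mulr0.
  by rewrite ninf0// => j; exact: neuc_eq0.
rewrite (_ : (fun j => _) = (fun j => (ninf (qc s) / neuc (qc s)) * qc s j)).
  rewrite neucZ ger0_norm ?divr_ge0 ?ninf_ge0 ?neuc_ge0//.
  by rewrite divfK.
by apply/funext => j; ring.
Qed.

Lemma dcrd_cube_disc n (s : Q n) j :
  dcrd (cube_disc s) j = qc s j * ninf (qc s) / neuc (qc s).
Proof. by rewrite dcrd_drow// neuc_cube_disc ninf_qc. Qed.

Lemma cube_disc_bd n (s : Q n) : bd n s -> sphere n (cube_disc s).
Proof.
move=> /bd_qc s1; apply/sphereE; rewrite /drad.
by rewrite (_ : dcrd _ = (fun j => qc s j * ninf (qc s) / neuc (qc s)));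
  [rewrite neuc_cube_disc|apply/funext => j; rewrite dcrd_cube_disc].
Qed.

Lemma qc_disc_cube n (v : disc n) j :
  qc (disc_cube v) j = dcrd v j * drad v / ninf (dcrd v).
Proof.
rewrite qc_qmk//; have [v0|v0] := eqVneq (ninf (dcrd v)) 0.
  by rewrite v0 invr0 mulr0 normr0.
have v1 : 0 < ninf (dcrd v) by rewrite lt_neqAle eq_sym v0 ninf_ge0.
rewrite mulrAC !normrM normfV (gtr0_norm v1) (ger0_norm (drad_ge0 _)).
apply: le_trans (drad_le1 v); rewrite -[leRHS]mul1r ler_wpM2r ?drad_ge0//.
by rewrite ler_pdivrMr// mul1r ninf_le.
Qed.

Lemma disc_cubeK n : cancel (@disc_cube n) (@cube_disc n).
Proof.
move=> v; apply: dext => j; rewrite dcrd_cube_disc.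
have -> : qc (disc_cube v) = (fun j => (drad v / ninf (dcrd v)) * dcrd v j).
  by apply/funext => i; rewrite qc_disc_cube; ring.
rewrite ninfZ neucZ -/(drad v).
have [v0|v0] := eqVneq (ninf (dcrd v)) 0.
  by rewrite v0 invr0 !(mulr0, mul0r) (ninf_eq0 _ v0).
have d0 : drad v != 0.
  by apply: contra_neq v0 => v0; apply: ninf0 => i; exact: neuc_eq0.
have a0 : `|drad v / ninf (dcrd v)| != 0 by rewrite normr_eq0 mulf_neq0// invr_eq0.
by field; rewrite v0 d0 a0.
Qed.

Lemma disc_cube_sphere n (v : disc n) : sphere n v -> bd n (disc_cube v).
Proof.
move=> /sphereE v1; apply/bd_qc.
have -> : qc (disc_cube v) = (fun j => (drad v / ninf (dcrd v)) * dcrd v j).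
  by apply/funext => i; rewrite qc_disc_cube; ring.
have v0 : ninf (dcrd v) != 0.
  apply: contra_eq_neq v1 => v0.
  by rewrite /drad neuc0 ?(eq_sym 0) ?oner_neq0// => i; exact: ninf_eq0.
rewrite ninfZ v1 mul1r ger0_norm ?invr_ge0 ?ninf_ge0//.
by rewrite mulVf.
Qed.

End Disc.

(** * Lifting over CW complexes *)

Section Skeleta.
Context {R : realType} {X : topologicalType} (K : cw_complex R X).
Local Notation disc := (disc R).
Local Notation sphere := (sphere R).
Implicit Types (n k : nat).

(* The points of the cells of dimension less than [k]: the (k-1)-skeleton. *)
Definition Sk k : set X := [set x | exists n (e : cell K n) (v : disc n),
  [/\ (n < k)%N, open_disc R n v & char_map e v = x]].

Lemma cont_char n (e : cell K n) : continuous (char_map e).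
Proof. exact: char_map_continuous. Qed.
Arguments cont_char {n} e.

Lemma Sk_sub k l : (k <= l)%N -> Sk k `<=` Sk l.
Proof.
by move=> kl x [n [e [v [nk ov ex]]]]; exists n, e, v; split=> //; exact: leq_trans kl.
Qed.

Lemma Sk0 : Sk 0 = set0.
Proof. by apply/seteqP; split=> // x [n [e [v []]]]. Qed.

Lemma Sk_total (x : X) : exists k, Sk k x.
Proof.
have [[n e] [[v ov ex] _]] := open_cell_partition K x.
by exists n.+1, n, e, v.
Qed.

Lemma cell_unique n (e : cell K n) v n' (e' : cell K n') v' :
  open_disc R n v -> open_disc R n' v' -> char_map e v = char_map e' v' ->
  existT (cell K) n e = existT (cell K) n' e'.
Proof.
move=> ov ov' E; have [c [_ cu]] := open_cell_partition K (char_map e v).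
rewrite -(cu (existT _ n e)); last by exists v.
by rewrite -(cu (existT _ n' e'))//; exists v' => //=; rewrite -E.
Qed.

Lemma char_map_uniq n (e e' : cell K n) v v' :
  open_disc R n v -> open_disc R n v' -> char_map e v = char_map e' v' ->
  e = e' /\ v = v'.
Proof.
move=> ov ov' E; have := cell_unique ov ov' E.
(* Equality of dependent pairs descends to the cells because equality of dimensions is decidable. *)
move=> /(Eqdep_dec.inj_pair2_eq_dec _ PeanoNat.Nat.eq_dec _ _ _ _) ee; split=> //.
by subst e'; apply: (char_map_inj (e := e)) => //; rewrite inE.
Qed.

Lemma open_cell_Sk n (e : cell K n) v k :
  open_disc R n v -> Sk k (char_map e v) -> (n < k)%N.
Proof.
move=> ov [n' [e' [v' [n'k ov' E]]]].
by have := cell_unique ov' ov E; move=> /(f_equal (@projT1 _ _)) /= <-.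
Qed.

Lemma sphere_Sk n (e : cell K n) v : sphere n v -> Sk n (char_map e v).
Proof.
move=> sv; have [F [_ Fn FS]] := char_map_sphere e.
have [|[n' e'] /Fn /= n'n [v' ov' E]] := FS (char_map e v); first by exists v.
by exists n', e', v'.
Qed.

Lemma cell_Sk n (e : cell K n) v : Sk n.+1 (char_map e v).
Proof.
have [ov|/(sphere_Sk e)] := disc_cases v; first by exists n, e, v.
exact: Sk_sub.
Qed.

Lemma closed_cell_image n (e : cell K n) (C : set (disc n)) :
  closed C -> closed (char_map e @` C).
Proof.
move=> cC; apply: compact_closed; first exact: cw_hausdorff K.
apply: continuous_compact; first by apply: continuous_subspaceT; exact: char_map_continuous.
by apply: (subclosed_compact cC (chaus_disc n).1).
Qed.

(** A cell of dimension at least [k] meets [C] only through its boundary sphere, which lies in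
    finitely many cells of lower dimension. By induction the traces of [C] on their closures are
    compact, so only cells below [k] have to be tested. *)
Lemma closed_Sk_sub k (C : set X) : C `<=` Sk k ->
  (forall n (e : cell K n), (n < k)%N -> closed (char_map e @^-1` C)) -> closed C.
Proof.
move=> CS Ck; apply: (cw_closed (c := K)) => n.
have [m] := ubnP n; elim: m n => // m IH n /ltnSE nm e.
have [nk|kn] := ltnP n k; first exact: Ck.
have [F [fF Fn FS]] := char_map_sphere e.
pose G := \bigcup_(c in F) (char_map (projT2 c) @` (char_map (projT2 c) @^-1` C)).
rewrite (_ : _ @^-1` C = sphere n `&` char_map e @^-1` G).
  apply: closedI; first exact: closed_sphere.
  have /continuous_closedP := cont_char e; apply.
  apply: (@closed_bigcup _ {classic {k & cell K k}}) => // c /Fn cn; apply: closed_cell_image.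
  by apply: IH; exact: leq_trans nm.
apply/seteqP; split=> v /=.
  move=> Cv; have [ov|sv] := disc_cases v.
    by have := open_cell_Sk ov (CS _ Cv); rewrite ltnNge kn.
  split=> //; have [|c Fc [w ow E]] := FS (char_map e v); first by exists v.
  by exists c => //; exists w => //=; rewrite E.
by move=> [_ [c _ [w /= Cw <-]]].
Qed.

Lemma closed_Sk k : closed (Sk k).
Proof.
apply: (@closed_Sk_sub k) => [//|n e nk].
have -> : char_map e @^-1` (Sk k) = setT; last exact: closedT.
apply/seteqP; split=> // v _; apply: (Sk_sub nk); exact: cell_Sk.
Qed.

Lemma ccont_Sk k (T : topologicalType) (g : X -> T) :
  (forall n (e : cell K n), (n < k)%N -> continuous (g \o char_map e)) -> ccont (Sk k) g.
Proof.
move=> cg W cW; apply: (@closed_Sk_sub k) => [x []//|n e nk].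
rewrite (_ : _ @^-1` _ = (g \o char_map e) @^-1` W).
  by have /continuous_closedP := cg n e nk; apply.
apply/seteqP; split=> v /= => [[]//|gv]; split=> //.
by apply: (Sk_sub nk); exact: cell_Sk.
Qed.

(** Otherwise some sequence in [C] has its k-th point outside [Sk k]. Only finitely many of its
    indices hit a given closed cell, so its tails are closed and a cluster point lies in all of
    them; but every point lies in some [Sk k], which the k-th tail avoids. *)
Lemma compact_Sk (C : set X) : compact C -> exists k, C `<=` Sk k.
Proof.
move=> cC; apply: contrapT => /forallNP nC.
have /choice[x hx] k : exists x, C x /\ ~ Sk k x.
  by have /existsNP[x /not_implyP] := nC k; exists x.
pose D k := [set y | exists2 j, (k <= j)%N & y = x j].
have clD k : closed (D k).
  apply: (cw_closed (c := K)) => n e.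
  rewrite (_ : _ @^-1` _ = char_map e @^-1` (x @` [set j | (k <= j <= n)%N])).
    have /continuous_closedP := cont_char e; apply.
    apply: compact_closed; first exact: cw_hausdorff K.
    apply: finite_compact; apply: finite_image.
    apply: (@sub_finite_set _ _ `I_n.+1); last exact: finite_II.
    by move=> j /= /andP[].
  apply/seteqP; split=> v /=; last by move=> [j /andP[kj _] <-]; exists j.
  move=> [j kj E]; exists j => //; rewrite kj /=.
  have [_ nS] := hx j; rewrite leqNgt; apply/negP => nj; apply: nS.
  by rewrite -E; apply: (Sk_sub nj); exact: cell_Sk.
have PF : ProperFilter (filter_from setT D).
  apply: filter_from_proper; last by move=> k _; exists (x k), k.
  apply: filter_from_filter; first by exists 0.
  move=> i j _ _; exists (maxn i j) => // z [l].
  by rewrite geq_max => /andP[il jl] ->; split; exists l.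
have [|y [Cy yD]] := cC _ PF.
  by exists 0 => // z [j _ ->]; exact: (hx j).1.
have [k Sy] := Sk_total y.
have nDy : ~ D k y.
  by move=> [j kj yj]; have [_] := hx j; apply; rewrite -yj; exact: Sk_sub Sy.
have [||z []//] := yD (D k) (~` D k); first by exists k.
by apply: open_nbhs_nbhs; split=> //; exact: closed_openC.
Qed.

Definition cell_point k (x : X) : Prop :=
  exists e : cell K k, exists2 v, open_disc R k v & char_map e v = x.

(** [F] on the open k-cells, [G] everywhere else. The chosen cell and point are unique by
    [char_map_uniq]; agreement on spheres makes the formula valid on closed cells. *)
Definition cellwise k (T : Type) (F : cell K k -> disc k -> T) (G : X -> T) (x : X) : T :=
  if pselect (cell_point k x) is left h then
   F (projT1 (cid h)) (projT1 (cid2 (projT2 (cid h)))) else G x.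

Lemma cellwise_Sk k (T : Type) (F : cell K k -> disc k -> T) (G : X -> T) x :
  Sk k x -> cellwise F G x = G x.
Proof.
rewrite /cellwise => Sx; case: pselect => // -[e [v ov ex]].
by have := @open_cell_Sk k e v k ov; rewrite ex ltnn => /(_ Sx).
Qed.

Lemma cellwise_cell k (T : Type) (F : cell K k -> disc k -> T) (G : X -> T) e v :
  (forall e v, sphere k v -> F e v = G (char_map e v)) ->
  cellwise F G (char_map e v) = F e v.
Proof.
move=> FG; have [ov|sv] := disc_cases v; last first.
  by rewrite cellwise_Sk ?FG//; exact: sphere_Sk.
rewrite /cellwise; case: pselect => [h|[]]; last by exists e, v.
case: cid => e' h' /=; case: cid2 => v' ov' E' /=.
by have [-> ->] := char_map_uniq ov' ov E'.
Qed.

Lemma ccont_cellwise k (T : topologicalType) (F : cell K k -> disc k -> T) (G : X -> T) :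
  (forall e v, sphere k v -> F e v = G (char_map e v)) ->
  (forall e, continuous (F e)) -> ccont (Sk k) G -> ccont (Sk k.+1) (cellwise F G).
Proof.
move=> FG cF cG; apply: ccont_Sk => n e; rewrite ltnS leq_eqVlt => /orP[/eqP nk|nk].
  subst n; rewrite (_ : _ \o _ = F e); first exact: cF.
  by apply/funext => v /=; rewrite cellwise_cell.
have S v : Sk k (char_map e v) by apply: (Sk_sub nk); exact: cell_Sk.
rewrite (_ : _ \o _ = G \o char_map e); first exact: ccont_total cG (cont_char e) S.
by apply/funext => v /=; rewrite cellwise_Sk.
Qed.

End Skeleta.
Arguments cont_char {R X K n} e.

(** * Lifting cell by cell over a shrinking neighbourhood *)

Section CellLifting.
Context {R : realType} {X : topologicalType} (K : cw_complex R X).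
Context {B E : topologicalType} (over : B -> E -> Prop) (U : set B).
Local Notation disc := (disc R).
Local Notation sphere := (sphere R).
Local Notation Sk := (Sk K).
Variables (f : X -> B).
Hypotheses (cf : continuous f) (fU : forall x, U (f x)).

Definition good_lift (D : set X) (g : X -> E) :=
  ccont D g /\ forall x, D x -> over (f x) (g x).

(** The k-cells are treated independently; their lifts fit together because they agree with [g] on
    the spheres and over [phi <= c']. *)
Lemma lift_step k (phi : X -> R) c c' (g : X -> E) : continuous phi -> c' < c ->
  (forall e : cell K k, lext2 over U (sphere k `|` [set v | phi (char_map e v) <= c])
                           (sphere k `|` [set v | phi (char_map e v) <= c'])) ->
  good_lift (Sk k `|` [set x | phi x <= c]) g ->
  exists2 g', good_lift (Sk k.+1 `|` [set x | phi x <= c']) g' &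
    forall x, (Sk k `|` [set x | phi x <= c']) x -> g' x = g x.
Proof.
move=> cphi c'c hext [cg og].
pose D := Sk k `|` [set x | phi x <= c].
have cphie n (e : cell K n) : continuous (fun v => phi (char_map e v)).
  exact: (continuous_compT cphi (cont_char e)).
have clphi d : closed [set x | phi x <= d] by apply: closed_lef => //; exact: cont_cst.
have sD (e : cell K k) v : (sphere k `|` [set v | phi (char_map e v) <= c]) v ->
  D (char_map e v) by move=> [/(sphere_Sk e)|]; [left|right].
have /choice[ge hge] (e : cell K k) : exists ge : disc k -> E, [/\ continuous ge,
    forall v, over (f (char_map e v)) (ge v)
    & forall v, (sphere k `|` [set v | phi (char_map e v) <= c']) v ->
      ge v = g (char_map e v)].
  have [||||ge ?] := hext e (f \o char_map e) (g \o char_map e); last by exists ge.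
  - exact: (continuous_compT cf (cont_char e)).
  - by move=> v /=.
  - apply: ccont_comp (cg) _ (@sD e).
    apply: continuous_ccont; first exact: cont_char.
    apply: closedU; first exact: closed_sphere.
    by apply: closed_lef; [exact: cphie|exact: cont_cst].
  - by move=> v /sD; exact: og.
have FG e v : sphere k v -> ge e v = g (char_map e v).
  by move=> sv; have [_ _ ->] := hge e => //; left.
pose g' := cellwise ge g.
have g'e (e : cell K k) v : g' (char_map e v) = ge e v by exact: cellwise_cell.
have g'D x : (Sk k `|` [set x | phi x <= c']) x -> g' x = g x.
  move=> [Sx|px]; first exact: cellwise_Sk.
  have [[e [v ov ex]]|nx] := pselect (cell_point K k x); last first.
    by rewrite /g' /cellwise; case: pselect.
  by rewrite -ex g'e; have [_ _ ->] := hge e => //; right; rewrite /= ex.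
have DD : Sk k `|` [set x | phi x <= c'] `<=` D.
  by move=> x [|/= px]; [left|right => /=; rewrite (le_trans px)// ltW].
exists g' => //; split.
- apply: ccontU; last first.
    apply: (@ccont_eq _ _ _ g) => [|x px]; last by rewrite g'D//; right.
    by apply: ccont_sub cg (clphi _) _ => x px; apply: DD; right.
  apply: ccont_cellwise => // [e|]; first by have [] := hge e.
  by apply: (ccont_sub cg) => [|x]; [exact: closed_Sk|left].
- move=> x [|px]; last by rewrite g'D; [apply/og/DD; right|right].
  move=> [n [e [v [+ ov ex]]]]; rewrite ltnS leq_eqVlt => /orP[/eqP nk|nk].
    by subst n; rewrite -ex g'e; have [_ + _] := hge e; apply.
  have Sx : Sk k x by exists n, e, v.
  by rewrite g'D; [apply: og; left|left].
Qed.

Lemma lift_skeleta k l (phi : X -> R) c c' (g : X -> E) : continuous phi -> c' < c ->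
  (k <= l)%N ->
  (forall n (e : cell K n) d d', (k <= n < l)%N -> c' <= d' -> d' < d -> d <= c ->
    lext2 over U (sphere n `|` [set v | phi (char_map e v) <= d])
                           (sphere n `|` [set v | phi (char_map e v) <= d'])) ->
  good_lift (Sk k `|` [set x | phi x <= c]) g ->
  exists2 g', good_lift (Sk l `|` [set x | phi x <= c']) g' &
    forall x, (Sk k `|` [set x | phi x <= c']) x -> g' x = g x.
Proof.
move=> cphi + kl; rewrite -(subnKC kl); elim: (l - k)%N c' => [|i IH] c' cc' hl hg.
  have clphi d : closed [set x | phi x <= d] by apply: closed_lef => //; exact: cont_cst.
  have S x : (Sk k `|` [set x | phi x <= c']) x -> (Sk k `|` [set x | phi x <= c]) x.
    by move=> [|/= px]; [left|right => /=; rewrite (le_trans px)// ltW].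
  exists g => //; rewrite addn0; split=> [|x /S]; last exact: hg.2.
  by apply: ccont_sub hg.1 _ S; apply: closedU => //; exact: closed_Sk.
(* The earlier skeleta spend the first half of the gap, the last one the rest. *)
pose c1 := (c + c') / 2.
have [|||g1 hg1 g1g] := IH c1 => //; first by rewrite /c1; lra.
  move=> n e d d' /andP[kn nl] c1d d'd dc; apply: hl => //.
    by rewrite kn /= (leq_trans nl)// leq_add2l.
  by apply: le_trans c1d; rewrite /c1; lra.
have [|e||g2 hg2 g2g] := @lift_step (k + i) phi c1 c' g1 cphi.
- by rewrite /c1; lra.
- by apply: hl => //; rewrite ?leq_addr ?addnS ?ltnSn// /c1; lra.
- exact: hg1.
exists g2; first by rewrite addnS.
move=> x Sx; rewrite g2g ?g1g//.
  by case: Sx => [|/= px]; [left|right; rewrite /= (le_trans px)// /c1; lra].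
by case: Sx => [|/= px]; [left; apply: (@Sk_sub _ _ K k) => //; rewrite leq_addr|right].
Qed.

Lemma no_nbhd (D : set X) : D `|` [set x : X | (1 : R) <= 0] = D.
Proof.
rewrite (_ : [set x : X | _] = set0) ?setU0//.
by apply/seteqP; split=> // x /=; rewrite ler10.
Qed.

Lemma lext2_no_nbhd n (d d' : R) : d' <= 0 -> d <= 0 ->
  lext over U (sphere n) ->
  lext2 over U (sphere n `|` [set v | (1 : R) <= d]) (sphere n `|` [set v | (1 : R) <= d']).
Proof.
move=> d'0 d0.
have S (c : R) : c <= 0 -> [set v : disc n | 1 <= c] = set0.
  by move=> c0; apply/seteqP; split=> // v /= /le_trans /(_ c0); rewrite ler10.
by rewrite !S// setU0.
Qed.

Lemma lift_skeleta0 k l (g : X -> E) : (k <= l)%N ->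
  (forall n (e : cell K n), (k <= n < l)%N -> lext over U (sphere n)) ->
  good_lift (Sk k) g ->
  exists2 g', good_lift (Sk l) g' & forall x, Sk k x -> g' x = g x.
Proof.
move=> kl hl hg.
(* With [phi = 1] and thresholds 0 and -1 the neighbourhoods are empty. *)
have [|||||g' hg' gg'] := @lift_skeleta k l (fun=> 1) 0 (-1) g => //.
- exact: cont_cst.
- move=> n e d d' nkl cd dd' dc; apply: lext2_no_nbhd; [lra|lra|exact: (hl n e)].
- by rewrite no_nbhd.
have S : [set x : X | (1 : R) <= -1] = set0.
  by apply/seteqP; split=> // x /=; lra.
exists g'; last by move=> x Sx; apply: gg'; left.
by rewrite S setU0 in hg'.
Qed.

(** Lifts over successive skeleta extend each other; their union is continuous by the weak topology,
    each closed cell lying in one skeleton. *)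
Lemma lift_total k (g : X -> E) :
  (forall n (e : cell K n), (k <= n)%N -> lext over U (sphere n)) ->
  good_lift (Sk k) g ->
  exists g', [/\ continuous g', forall x, over (f x) (g' x)
    & forall x, Sk k x -> g' x = g x].
Proof.
move=> hl hg.
pose T i := {h : X -> E | good_lift (Sk (k + i)) h}.
have nxt i (h : T i) : {h' : T i.+1 | forall x, Sk (k + i) x -> sval h' x = sval h x}.
  apply: cid; case: h => h hh /=.
  have [||h' hh' hx] := @lift_skeleta0 (k + i) (k + i.+1) h _ _ hh.
  - by rewrite addnS.
  - by move=> n e /andP[kn _]; apply: (hl n e); rewrite (leq_trans _ kn)// leq_addr.
  by exists (exist _ h' hh').
have hg0 : good_lift (Sk (k + 0)) g by rewrite addn0.
pose s : forall i, T i := fix s i := if i is j.+1 then sval (nxt j (s j)) else exist _ g hg0.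
have sS i x : Sk (k + i) x -> sval (s i.+1) x = sval (s i) x.
  exact: (svalP (nxt i (s i)) x).
have sle i j x : (i <= j)%N -> Sk (k + i) x -> sval (s j) x = sval (s i) x.
  move=> /subnKC <- Sx; elim: (j - i)%N => [|d IHd]; first by rewrite addn0.
  rewrite addnS sS//; apply: Sk_sub Sx; by rewrite leq_add2l leq_addr.
have lev x : exists i, Sk (k + i) x.
  by have [i Si] := Sk_total K x; exists i; apply: Sk_sub Si; rewrite leq_addl.
pose g' x := sval (s (projT1 (cid (lev x)))) x.
have g'E i x : Sk (k + i) x -> g' x = sval (s i) x.
  move=> Sx; rewrite /g'; case: cid => j /= Sj.
  have [ij|/ltnW ji] := leqP i j; first exact: sle.
  by rewrite -(sle _ _ _ ji).
exists g'; split=> [|x|x Sx].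
- apply/ccontT => W cW; rewrite setTI; apply: (cw_closed (c := K)) => n e.
  have [cs _] := svalP (s n.+1).
  rewrite (_ : _ @^-1` _ = char_map e @^-1` (Sk (k + n.+1) `&` sval (s n.+1) @^-1` W)).
    have /continuous_closedP := cont_char e; apply; exact: cs.
  have S v : Sk (k + n.+1) (char_map e v).
    by apply: (@Sk_sub _ _ K n.+1); [rewrite leq_addl|exact: cell_Sk].
  apply/seteqP; split=> v /=; have -> := g'E n.+1 _ (S v); last by move=> [].
  by split.
- have [i Si] := lev x; rewrite (g'E i)//; exact: (svalP (s i)).2.
- by rewrite (g'E 0)// addn0.
Qed.

End CellLifting.

(** * Homotopy extension *)

Section HomotopyExtension.
Context {R : realType}.
Local Notation I := (uitv R).
Local Notation Q := (cube R).
Local Notation bd := (cube_bdry R).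

(** Homotopy extension for a closed subset, with [h] total but relevant on [A] only;
    [cofibration_hep] returns to the formulation by maps. *)
Definition hep (T : topologicalType) (A : set T) :=
  forall (Z : topologicalType) (f : T -> Z) (h : I * T -> Z),
    continuous f -> ccont (snd @^-1` A) h ->
    (forall x, A x -> h (I0, x) = f x) ->
    exists H : I * T -> Z, [/\ continuous H, forall x, H (I0, x) = f x
      & forall t x, A x -> H (t, x) = h (t, x)].

Lemma cont_pt (S T : topologicalType) (t : S) : continuous (fun x : T => (t, x)).
Proof. by apply: continuous_pair; [exact: cont_cst|move=> x; exact: cvg_id]. Qed.

Lemma closed_I (t : I) : closed [set t].
Proof.
rewrite (_ : [set t] = [set s | ival s = ival t]).
  by apply: closed_eqf; [exact: continuous_ival|exact: cont_cst].
by apply/seteqP; split=> s /= => [->|/ival_inj].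
Qed.

Lemma closed_fst_pt (T : topologicalType) (t : I) : closed [set p : I * T | p.1 = t].
Proof.
exact: (@closed_fst_preim _ _ [set t] (@closed_I t)).
Qed.

Lemma I0_neq_I1 : (I0 : I) <> I1.
Proof. by move=> /(congr1 ival); rewrite ival0 ival1 => /eqP; rewrite eq_sym oner_eq0. Qed.

(** [r] retracts the cylinder onto its bottom united with the part over [A], where [f] and [h]
    glue. *)
Lemma hep_retract (T : topologicalType) (A : set T) (r : I * T -> I * T) :
  closed A -> continuous r ->
  (forall p, (r p).1 = I0 \/ A (r p).2) ->
  (forall p, p.1 = I0 \/ A p.2 -> r p = p) -> hep A.
Proof.
move=> cA cr rM rid Z f h cf ch hf.
pose gl (p : I * T) := if pselect (A p.2) then h p else f p.2.
have glM : ccont ([set p | p.1 = I0] `|` snd @^-1` A) gl.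
  apply: ccontU.
    apply: (@ccont_eq _ _ _ (f \o snd)) => [|[t x] /= ->].
      apply: continuous_ccont; last exact: closed_fst_pt.
      by apply: continuous_compT => //; exact: continuous_snd.
    by rewrite /gl /=; case: pselect => // Ax; rewrite hf.
  by apply: (@ccont_eq _ _ _ h) => // p Ap; rewrite /gl; case: pselect.
exists (gl \o r); split=> [|x|t x Ax] /=.
- exact: ccont_total glM cr rM.
- by rewrite rid; [rewrite /gl /=; case: pselect => // Ax; rewrite hf|left].
- by rewrite rid; [rewrite /gl /=; case: pselect|right].
Qed.

Lemma hep_transfer (T T' : topologicalType) (A : set T) (A' : set T')
    (th : T -> T') (th' : T' -> T) :
  continuous th -> continuous th' -> cancel th th' -> closed A' ->
  (forall x, A x -> A' (th x)) -> (forall y, A' y -> A (th' y)) ->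
  hep A' -> hep A.
Proof.
move=> cth cth' thK cA' AA' A'A hA' Z f h cf ch hf.
have c1 : continuous (fun p : I * T' => (p.1, th' p.2)).
  apply: continuous_pair; first exact: continuous_fst.
  by apply: (continuous_compT cth'); exact: continuous_snd.
have [|||H [cH H0 HA]] := hA' Z (f \o th') (fun p => h (p.1, th' p.2)).
- exact: continuous_compT.
- apply: (ccont_comp ch (u := fun p : I * T' => (p.1, th' p.2))) => [|p /=]; last exact: A'A.
  by apply: continuous_ccont => //; exact: closed_snd_preim.
- by move=> y /= /A'A; exact: hf.
exists (fun p => H (p.1, th p.2)); split=> [|x|t x Ax] /=.
- apply: (@continuous_compT _ _ _ H (fun p : I * T => (p.1, th p.2))) => //.
  apply: continuous_pair; first exact: continuous_fst.
  by apply: (continuous_compT cth); exact: continuous_snd.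
- by rewrite H0 /= thK.
- by rewrite HA/= ?thK//; exact: AA'.
Qed.

Section CubeRetraction.
Variable n : nat.
(** From the apex the ray drops by [2 - t] while moving sideways by [qc s]. It leaves through the
    floor when the drop reaches 2, through a side when the sup norm reaches 1; dividing by the
    larger ratio stops it at whichever comes first. *)
Definition rfac (p : I * Q n) : R := Num.max (ninf (qc p.2)) ((2 - ival p.1) / 2).

(* Radial projection of the cylinder from the point of height 2 over the centre. *)
Definition cube_ret (p : I * Q n) : I * Q n :=
  (toI (2 - (2 - ival p.1) / rfac p), qmk (fun j => qc p.2 j / rfac p)).

Lemma rfac_gt0 p : 0 < rfac p.
Proof. by rewrite /rfac lt_max; have := ival_itv p.1; lra. Qed.

Lemma cont_val1 : continuous (fun p : I * Q n => ival p.1).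
Proof. by apply: (continuous_compT continuous_ival); exact: continuous_fst. Qed.
Lemma cont_qc2 j : continuous (fun p : I * Q n => qc p.2 j).
Proof. by apply: (continuous_compT (@continuous_qc R n j)); exact: continuous_snd. Qed.

Lemma continuous_rfac : continuous rfac.
Proof.
apply: cont_max; first by apply: cont_ninf => j; exact: cont_qc2.
apply: contM; last exact: cont_cst.
by apply: contB; [exact: cont_cst|exact: cont_val1].
Qed.

Lemma continuous_cube_ret : continuous cube_ret.
Proof.
have cV : continuous (fun p => (rfac p)^-1).
  by apply: contV; [move=> p; rewrite gt_eqF// rfac_gt0|exact: continuous_rfac].
apply: continuous_pair.
  apply: cont_toI; apply: contB; first exact: cont_cst.
  by apply: contM => //; apply: contB; [exact: cont_cst|exact: cont_val1].
by apply: continuous_qmk => j; apply: contM => //; exact: cont_qc2.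
Qed.

Lemma cube_ret_id p : p.1 = I0 \/ bd n p.2 -> cube_ret p = p.
Proof.
move=> h; have r1 : rfac p = 1.
  rewrite /rfac; case: h => [->|/bd_qc ->].
    by rewrite ival0 subr0 divff ?pnatr_eq0// max_r// ninf_qc.
  by rewrite max_l//; have := ival_itv p.1; lra.
rewrite /cube_ret r1 [p in RHS]surjective_pairing; congr pair.
  apply: ival_inj; rewrite ival_toI clamp_id divr1; first by ring.
  by have := ival_itv p.1; lra.
by apply: qc_inj => j; rewrite qc_qmk divr1// qc_norm.
Qed.

Lemma cube_ret_mem p : (cube_ret p).1 = I0 \/ bd n (cube_ret p).2.
Proof.
have rp := rfac_gt0 p.
have [h|h] := leP (ninf (qc p.2)) ((2 - ival p.1) / 2); [left|right].
  have r1 : rfac p = (2 - ival p.1) / 2 by rewrite /rfac max_r.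
  rewrite /cube_ret /= toI0// r1 invf_div mulrCA divff ?mulr1 ?subrr//.
  by have := ival_itv p.1; lra.
have r1 : rfac p = ninf (qc p.2) by rewrite /rfac max_l// ltW.
apply/bd_qc; rewrite /cube_ret /= r1 in rp *.
rewrite (_ : qc _ = (fun j => (ninf (qc p.2))^-1 * qc p.2 j)).
  by rewrite ninfZ gtr0_norm ?invr_gt0// mulVf// gt_eqF.
apply/funext => j; rewrite qc_qmk 1?mulrC//.
by rewrite normrM normfV (gtr0_norm rp) mulrC ler_pdivrMr// mul1r ninf_le.
Qed.

Lemma hep_cube : hep (bd n).
Proof.
exact: hep_retract (@closed_bd R n) continuous_cube_ret cube_ret_mem cube_ret_id.
Qed.

Definition Bd : set (I * Q n) := [set p | [\/ p.1 = I0, p.1 = I1 | bd n p.2]].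

Lemma closed_Bd : closed Bd.
Proof.
rewrite (_ : Bd = [set p | p.1 = I0] `|` [set p | p.1 = I1] `|` snd @^-1` bd n).
  apply: closedU; last by apply: closed_snd_preim; exact: closed_bd.
  by apply: closedU; exact: closed_fst_pt.
apply/seteqP; split=> p /=.
  by move=> [|?|?]; [left; left|left; right|right].
by move=> [[?|?]|?]; [apply: Or31|apply: Or32|apply: Or33].
Qed.

Definition qcons (p : I * Q n) : Q n.+1 :=
  qrow (fun j => oapp (crd p.2) (ival p.1) (unlift ord0 j)).
Definition qsplit (s : Q n.+1) : I * Q n :=
  (toI (crd s ord0), qrow (fun j => crd s (lift ord0 j))).

Lemma crd_qcons p j : crd (qcons p) j = oapp (crd p.2) (ival p.1) (unlift ord0 j).
Proof.
by rewrite crd_qrow_id//; case: unlift => [i|] /=; [exact: crd_itv|exact: ival_itv].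
Qed.
Lemma crd_qcons0 p : crd (qcons p) ord0 = ival p.1.
Proof. by rewrite crd_qcons unlift_none. Qed.
Lemma crd_qconsS p j : crd (qcons p) (lift ord0 j) = crd p.2 j.
Proof. by rewrite crd_qcons liftK. Qed.

Lemma qconsK : cancel qcons qsplit.
Proof.
move=> [t s]; rewrite /qsplit; congr pair; first by rewrite crd_qcons0 toI_ival.
by apply: qext => j; rewrite crd_qrow crd_qconsS clamp_id// crd_itv.
Qed.

Lemma continuous_qcons : continuous qcons.
Proof.
apply: continuous_qrow => j; case: unlift => [i|] /=; last exact: cont_val1.
by apply: (continuous_compT (@continuous_crd R n i)); exact: continuous_snd.
Qed.

Lemma continuous_qsplit : continuous qsplit.
Proof.
apply: continuous_pair; first by apply: cont_toI; exact: continuous_crd.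
by apply: continuous_qrow => j; exact: continuous_crd.
Qed.

Lemma qcons_Bd p : Bd p -> bd n.+1 (qcons p).
Proof.
move=> [p0|p1|[j hj]].
- by exists ord0; rewrite -/(crd _ _) crd_qcons0 p0 ival0; left.
- by exists ord0; rewrite -/(crd _ _) crd_qcons0 p1 ival1; right.
- by exists (lift ord0 j); rewrite -/(crd _ _) crd_qconsS.
Qed.

Lemma qsplit_Bd s : bd n.+1 s -> Bd (qsplit s).
Proof.
move=> [j]; rewrite -/(crd s j).
have [i ->|->] := unliftP ord0 j; last first.
  by move=> [s0|s1]; [apply: Or31|apply: Or32]; apply: ival_inj;
    rewrite ival_toI clamp_id ?crd_itv// ?s0 ?s1.
move=> h; apply: Or33; exists i; rewrite -/(crd (qsplit s).2 i).
by rewrite crd_qrow clamp_id// crd_itv.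
Qed.

End CubeRetraction.

Lemma hep_Bd n : hep (@Bd n).
Proof.
apply: hep_transfer (@continuous_qcons n) (@continuous_qsplit n) (@qconsK n)
  (@closed_bd R n.+1) (@qcons_Bd n) (@qsplit_Bd n) (@hep_cube n.+1).
Qed.

Lemma lext_Bd (B E : topologicalType) (over : B -> E -> Prop) U n :
  LP (R := R) over U n.+1 -> lext over U (@Bd n).
Proof.
exact: lext2_transfer (@continuous_qcons n) (@continuous_qsplit n) (@qconsK n)
  (@closed_bd R n.+1) (@qsplit_Bd n) (@qcons_Bd n).
Qed.

End HomotopyExtension.

(** * Relative homotopies and equivalences under a cofibration *)

Section Cofibrations.
Context {R : realType}.
Local Notation I := (uitv R).

Lemma homotopic_rel_compl (X Y Z : topologicalType) (A : set X) (f g : X -> Y) (k : Y -> Z) :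
  continuous k -> homotopic_rel R A f g -> homotopic_rel R A (k \o f) (k \o g).
Proof.
move=> ck [H [cH H0 H1 HA]]; exists (k \o H); split=> [|x|x|t x Ax] /=.
- exact: continuous_compT.
- by rewrite H0.
- by rewrite H1.
- by rewrite HA.
Qed.

Lemma homotopic_rel_compr (W X Y : topologicalType) (C : set W) (A : set X)
    (f g : X -> Y) (k : W -> X) :
  continuous k -> (forall w, C w -> A (k w)) -> homotopic_rel R A f g ->
  homotopic_rel R C (f \o k) (g \o k).
Proof.
move=> ck CA [H [cH H0 H1 HA]]; exists (fun p => H (p.1, k p.2)); split=> //.
  apply: (@continuous_compT _ _ _ H (fun p : I * W => (p.1, k p.2))) => //.
  apply: continuous_pair; first exact: continuous_fst.
  by apply: (continuous_compT ck); exact: continuous_snd.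
by move=> t w /CA Akw; exact: HA.
Qed.

Lemma homotopic_rel_sub (X Y : topologicalType) (A C : set X) (f g : X -> Y) :
  C `<=` A -> homotopic_rel R A f g -> homotopic_rel R C f g.
Proof. by move=> CA [H [cH H0 H1 HA]]; exists H; split=> // t x /CA; exact: HA. Qed.

Lemma homotopic_of_rel (X Y : topologicalType) (A : set X) (f g : X -> Y) :
  homotopic_rel R A f g -> homotopic R f g.
Proof. exact: homotopic_rel_sub. Qed.

Lemma homotopy_equivalence_homotopic (X Y : topologicalType) (f g : X -> Y) :
  continuous g -> homotopic R f g -> homotopy_equivalence R f ->
  homotopy_equivalence R g.
Proof.
move=> cg fg [cf [f' [cf' f'f ff']]]; split=> //; exists f'; split=> //.
  by apply: homotopic_rel_trans f'f; apply/homotopic_rel_sym/homotopic_compl.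
by apply: homotopic_rel_trans ff'; apply/homotopic_rel_sym; exact: homotopic_compr.
Qed.

Definition pathspace (Y : topologicalType) : set {compact-open, I -> Y} :=
  [set g | continuous (g : I -> Y)].

(** By adjunction this is the extension property of [i] for maps into the path space of [Z];
    currying over the compact interval is reversible. *)
Lemma cofibration_cylinder (S T : topologicalType) (i : S -> T) :
  cofibration R i -> cofibration R (fun p : I * S => (p.1, i p.2)).
Proof.
move=> [ci hi]; split.
  apply: continuous_pair; first exact: continuous_fst.
  by apply: (continuous_compT ci); exact: continuous_snd.
move=> Z f h cf ch hf.
pose P : topologicalType := @pathspace Z.
have fP x : ((fun t => f (t, x)) : {compact-open, I -> Z}) \in @pathspace Z.
  rewrite inE; apply: (continuous_compT cf).
  by apply: continuous_pair; [move=> t; exact: cvg_id|exact: cont_cst].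
have hP p : ((fun t => h (p.1, (t, p.2))) : {compact-open, I -> Z}) \in @pathspace Z.
  rewrite inE; apply: (@continuous_compT _ _ _ h (fun t => (p.1, (t, p.2)))) => //.
  apply: continuous_pair; first exact: cont_cst.
  by apply: continuous_pair; [move=> t; exact: cvg_id|exact: cont_cst].
have [|||H [cH H0 HA]] := hi P (fun x => mksub (fP x)) (fun p => mksub (hP p)).
- by apply: continuous_into; exact: continuous_curry2.
- apply: continuous_into.
  apply: (@continuous_curry2 _ _ _ (fun q : I * (I * S) => h (q.2.1, (q.1, q.2.2)))).
  apply: (@continuous_compT _ _ _ h (fun q : I * (I * S) => (q.2.1, (q.1, q.2.2)))) => //.
  have c2 : continuous (@snd I (I * S)) by exact: continuous_snd.
  apply: continuous_pair; first by apply: continuous_compT c2; exact: continuous_fst.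
  apply: continuous_pair; first exact: continuous_fst.
  by apply: continuous_compT c2; exact: continuous_snd.
- by move=> a; apply: val_inj; apply/funext => t; rewrite /= hf.
pose G (q : I * (I * T)) := (set_val (H q.2) : {compact-open, I -> Z}) q.1.
have cG : continuous G.
  apply: (@continuous_uncurry2 _ _ _ (set_val \o H)).
  - exact: chaus_I.
  - by apply: continuous_compT => //; exact: continuous_set_val.
  - by move=> x /=; exact: (set_valP (H x)).
exists (fun q => G (q.2.1, (q.1, q.2.2))); split=> [|[t x]|t [s a]].
- apply: (@continuous_compT _ _ _ G (fun q : I * (I * T) => (q.2.1, (q.1, q.2.2)))) => //.
  have c2 : continuous (@snd I (I * T)) by exact: continuous_snd.
  apply: continuous_pair; first by apply: continuous_compT c2; exact: continuous_fst.
  apply: continuous_pair; first exact: continuous_fst.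
  by apply: continuous_compT c2; exact: continuous_snd.
- by rewrite /G /= H0 /= set_valE.
- by rewrite /G /= HA /= set_valE.
Qed.

Lemma concat_congr (X X' T : Type) (H K : I * X -> T) (H' K' : I * X' -> T) t x x' :
  (forall s, H (s, x) = H' (s, x')) -> (forall s, K (s, x) = K' (s, x')) ->
  concat H K (t, x) = concat H' K' (t, x').
Proof. by move=> HH KK; rewrite /concat /=; case: ifP. Qed.

(* On the image of [i] the concatenation F0^-1 L F1 is null relative to its ends;
   extend this null homotopy along [I * i]. *)
Lemma homotopic_rel_transport (S T Y : topologicalType) (i : S -> T) (F0 F1 : I * T -> Y) :
  cofibration R i -> continuous F0 -> continuous F1 ->
  (forall t s, F0 (t, i s) = F1 (t, i s)) ->
  homotopic_rel R (range i) (fun x => F0 (I0, x)) (fun x => F1 (I0, x)) ->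
  homotopic_rel R (range i) (fun x => F0 (I1, x)) (fun x => F1 (I1, x)).
Proof.
move=> hi cF0 cF1 FF [L [cL L0 L1 LA]].
have [ci _] := hi.
(* At stage [u] of the null homotopy the path runs along [F0] from time 1 back to [u], rests, and
   returns to 1; [u = 0] gives the concatenation on the image of [i], [u = 1] a constant path. *)
pose A1 (q : I * (I * S)) := F0 (toI (Num.max (ival q.1) (ival q.2.1)), i q.2.2).
pose A0 (q : I * (I * S)) := F0 (q.2.1, i q.2.2).
have c2 : continuous (@snd I (I * S)) by exact: continuous_snd.
have c21 : continuous (fun q : I * (I * S) => q.2.1) by apply: continuous_compT c2; exact: continuous_fst.
have c22 : continuous (fun q : I * (I * S) => i q.2.2).
  by apply: (continuous_compT ci); apply: continuous_compT c2; exact: continuous_snd.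
have cA0 : continuous A0 by apply: (continuous_compT cF0); exact: continuous_pair.
have cA1 : continuous A1.
  apply: (continuous_compT cF0); apply: continuous_pair => //.
  apply: cont_toI; apply: cont_max; last by apply: (continuous_compT continuous_ival).
  by apply: (continuous_compT continuous_ival); exact: continuous_fst.
have A1E u : toI (Num.max (ival I0) (ival u)) = u.
  by rewrite ival0 max_r ?toI_ival//; case/andP: (ival_itv u).
have maxI0 u : toI (Num.max (ival u) (ival I0)) = u by rewrite maxC A1E.
have maxI1 u : toI (Num.max (ival u) (ival I1)) = I1.
  by rewrite ival1 max_r; [exact: toI1|case/andP: (ival_itv u)].
have max1I u : toI (Num.max (ival I1) (ival u)) = I1 by rewrite maxC maxI1.
pose N := concat (reverse F0) (concat L F1).
pose M := concat (reverse A1) (concat A0 A1).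
have cN : continuous N.
  apply: continuous_concat; first exact: continuous_reverse.
    by apply: continuous_concat => // x; rewrite L1.
  by move=> x; rewrite reverse1 concat0 L0.
have cM : continuous M.
  apply: continuous_concat; first exact: continuous_reverse.
    by apply: continuous_concat => // -[u s]; rewrite /A0 /A1 /= A1E.
  by move=> [u s]; rewrite reverse1 concat0 /A0 /A1 /= A1E.
have [_ /(_ Y N (fun q => M (q.2.1, (q.1, q.2.2))))[]] := cofibration_cylinder hi => //.
- apply: (@continuous_compT _ _ _ M (fun q : I * (I * S) => (q.2.1, (q.1, q.2.2)))) => //.
  apply: continuous_pair => //; apply: continuous_pair; first exact: continuous_fst.
  by apply: continuous_compT c2; exact: continuous_snd.
- move=> [t s] /=; apply: concat_congr => u; first by rewrite /reverse /A1 /= maxI0.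
  apply: concat_congr => v; first by rewrite /A0 /= LA//; exists s.
  by rewrite /A1 /= maxI0 FF.
move=> H [cH H0 HA].
have cHt t : continuous (fun q : I * T => H (q.1, (t, q.2))).
  apply: (@continuous_compT _ _ _ H (fun q : I * T => (q.1, (t, q.2)))) => //.
  apply: continuous_pair; first exact: continuous_fst.
  by apply: continuous_pair; [exact: cont_cst|exact: continuous_snd].
(* During the null homotopy the two ends of the path stay fixed on the image of [i], so they connect
   back to [F0] and [F1] at time 1. *)
have e0 : homotopic_rel R (range i) (fun x => F0 (I1, x)) (fun x => H (I1, (I0, x))).
  exists (fun q => H (q.1, (I0, q.2))); split=> // [x|t _ [s _ <-]] /=.
    by rewrite H0 /N concat0 reverse0.
  by rewrite (HA t (I0, s)) /M /= concat0 reverse0 /A1 /= max1I.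
have e1 : homotopic_rel R (range i) (fun x => F1 (I1, x)) (fun x => H (I1, (I1, x))).
  exists (fun q => H (q.1, (I1, q.2))); split=> // [x|t _ [s _ <-]] /=.
    by rewrite H0 /N !concat1.
  by rewrite (HA t (I1, s)) /M /= !concat1 /A1 /= max1I FF.
apply: homotopic_rel_trans e0 _; apply: homotopic_rel_trans (homotopic_rel_sym e1).
exists (fun q => H (I1, q)); split=> // [|t _ [s _ <-]].
  by apply: (continuous_compT cH); exact: cont_pt.
have HM u : H (I1, (u, i s)) = F0 (I1, i s).
  rewrite (HA I1 (u, s)) /M /concat /reverse /A1 /A0 /= .
  by do !case: ifP => _ /=; rewrite ?maxI1.
by rewrite !HM.
Qed.

(** A free inverse [g0] moves the image of [i] along [H]; extending this motion turns [g0] into a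
    map [g] under [A]. Then [G (t, f y)] and [H (t, y)] agree on that image and start from the same
    map, so [homotopic_rel_transport] compares their ends, [g \o f] and the identity. *)
Lemma under_left_inverse (A Y : topologicalType) (i : A -> Y) (f : Y -> Y) :
  cofibration R i -> homotopy_equivalence R f -> (forall a, f (i a) = i a) ->
  exists g : Y -> Y, [/\ homotopy_equivalence R g, forall a, g (i a) = i a
    & homotopic_rel R (range i) (g \o f) id].
Proof.
move=> hi [cf [g0 [cg0 [H [cH H0 H1 _]] fg]]] fi.
have [ci hep] := hi.
have [|a|G [cG G0 GA]] := hep Y g0 (fun p => H (p.1, i p.2)) cg0.
- apply: (@continuous_compT _ _ _ H (fun p : I * A => (p.1, i p.2))) => //.
  apply: continuous_pair; first exact: continuous_fst.
  by apply: (continuous_compT ci); exact: continuous_snd.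
- by rewrite /= H0 /= fi.
have cg : continuous (fun x => G (I1, x)) by apply: (continuous_compT cG); exact: cont_pt.
have gg0 : homotopic R g0 (fun x => G (I1, x)) by exists G; split.
exists (fun x => G (I1, x)); split.
- apply: homotopy_equivalence_homotopic gg0 _ => //; split=> //.
  by exists f; split=> //; exists H; split.
- by move=> a; rewrite GA /= H1.
have cGf : continuous (fun p : I * Y => G (p.1, f p.2)).
  apply: (@continuous_compT _ _ _ G (fun p : I * Y => (p.1, f p.2))) => //.
  apply: continuous_pair; first exact: continuous_fst.
  by apply: (continuous_compT cf); exact: continuous_snd.
have := @homotopic_rel_transport A Y Y i _ H hi cGf cH.
rewrite (_ : (fun x => H (I1, x)) = id); last by apply/funext => x; rewrite H1.
apply => [t a|] /=; first by rewrite fi GA.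
rewrite (_ : (fun x => H (I0, x)) = g0 \o f); last by apply/funext => x; rewrite H0.
rewrite (_ : (fun x => _) = g0 \o f); last by apply/funext => x; rewrite G0.
exact/homotopic_rel_refl/continuous_compT.
Qed.

(* Dold *)
Lemma under_inverse (A Y : topologicalType) (i : A -> Y) (f : Y -> Y) :
  cofibration R i -> homotopy_equivalence R f -> (forall a, f (i a) = i a) ->
  exists g : Y -> Y, [/\ homotopy_equivalence R g, forall a, g (i a) = i a,
    homotopic_rel R (range i) (g \o f) id & homotopic_rel R (range i) (f \o g) id].
Proof.
move=> hi hf fi; have [g [hg gi gf]] := under_left_inverse hi hf fi.
exists g; split=> //; have [g' [hg' g'i g'g]] := under_left_inverse hi hg gi.
have [cf _] := hf; have [cg _] := hg; have [cg' _] := hg'.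
have ff' : homotopic_rel R (range i) f g'.
  apply: (@homotopic_rel_trans _ _ _ _ _ (g' \o (g \o f))).
    have := @homotopic_rel_compr _ _ _ (range i) (range i) (g' \o g) id f cf.
    move=> /(_ _ g'g) h; apply/homotopic_rel_sym/h => _ [a _ <-].
    by exists a; rewrite ?fi.
  exact: (@homotopic_rel_compl _ _ _ (range i) (g \o f) id g').
apply: homotopic_rel_trans g'g.
apply: (@homotopic_rel_compr _ _ _ (range i) (range i) f g' g) => // _ [a _ <-].
by exists a; rewrite ?gi.
Qed.

End Cofibrations.

(** * Homotopy groups and lifts of paths *)

Section CubeHomotopy.
Context {R : realType}.
Local Notation I := (uitv R).
Local Notation Q := (cube R).
Local Notation bd := (cube_bdry R).

Definition icvx (u t t0 : I) : I := toI ((1 - ival u) * ival t + ival u * ival t0).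
Definition qcvx n (u : I) (s s0 : Q n) : Q n :=
  qrow (fun j => (1 - ival u) * crd s j + ival u * crd s0 j).

Lemma icvx0 t t0 : icvx I0 t t0 = t.
Proof. by rewrite /icvx ival0 subr0 mul1r mul0r addr0 toI_ival. Qed.
Lemma icvx1 t t0 : icvx I1 t t0 = t0.
Proof. by rewrite /icvx ival1 subrr mul0r mul1r add0r toI_ival. Qed.
Lemma qcvx0 n (s s0 : Q n) : qcvx I0 s s0 = s.
Proof.
by apply: qext => j; rewrite crd_qrow ival0 subr0 mul1r mul0r addr0 clamp_id// crd_itv.
Qed.
Lemma qcvx1 n (s s0 : Q n) : qcvx I1 s s0 = s0.
Proof.
by apply: qext => j; rewrite crd_qrow ival1 subrr mul1r mul0r add0r clamp_id// crd_itv.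
Qed.

Lemma cont_icvx (T : topologicalType) (u t t0 : T -> I) : continuous u -> continuous t ->
  continuous t0 -> continuous (fun x => icvx (u x) (t x) (t0 x)).
Proof.
move=> cu ct ct0; apply: cont_toI.
have ci (f : T -> I) : continuous f -> continuous (fun x => ival (f x)).
  by apply: continuous_compT; exact: continuous_ival.
apply: contD; apply: contM; try exact: ci.
by apply: contB; [exact: cont_cst|exact: ci].
Qed.
Lemma cont_qcvx (T : topologicalType) n (u : T -> I) (s s0 : T -> Q n) : continuous u ->
  continuous s -> continuous s0 -> continuous (fun x => qcvx (u x) (s x) (s0 x)).
Proof.
move=> cu cs cs0; apply: continuous_qrow => j.
have ci (f : T -> I) : continuous f -> continuous (fun x => ival (f x)).
  by apply: continuous_compT; exact: continuous_ival.
have cc (f : T -> Q n) : continuous f -> continuous (fun x => crd (f x) j).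
  by apply: (continuous_compT (@continuous_crd R n j)).
apply: contD; apply: contM; try exact: ci; try exact: cc.
by apply: contB; [exact: cont_cst|exact: ci].
Qed.

Definition iflip (t : I) : I := toI (1 - ival t).
Lemma iflip0 : iflip I0 = I1. Proof. by rewrite /iflip ival0 subr0 toI1. Qed.
Lemma iflip1 : iflip I1 = I0. Proof. by rewrite /iflip ival1 subrr toI0. Qed.
Lemma iflipK : involutive iflip.
Proof.
move=> t; apply: ival_inj; rewrite !ival_toI !clamp_id; [by ring|..];
  by rewrite ?clamp_id; have := ival_itv t; lra.
Qed.
Lemma continuous_iflip : continuous iflip.
Proof.
by apply: cont_toI; apply: contB; [exact: cont_cst|exact: continuous_ival].
Qed.

Definition capped n : set (I * Q n) := [set p | p.1 = I1 \/ bd n p.2].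

(** [cube_ret] upside down: it retracts the cylinder onto its boundary without the open bottom
    face. *)
Definition cap_ret n (p : I * Q n) : I * Q n :=
  let q := cube_ret (iflip p.1, p.2) in (iflip q.1, q.2).

Lemma continuous_cap_ret n : continuous (@cap_ret n).
Proof.
have cq : continuous (fun p : I * Q n => cube_ret (iflip p.1, p.2)).
  apply: (continuous_compT (@continuous_cube_ret R n)); apply: continuous_pair.
    by apply: (continuous_compT continuous_iflip); exact: continuous_fst.
  exact: continuous_snd.
apply: continuous_pair.
  by apply: (continuous_compT continuous_iflip); apply: continuous_compT cq; exact: continuous_fst.
by apply: continuous_compT cq; exact: continuous_snd.
Qed.

Lemma cap_ret_mem n (p : I * Q n) : capped (cap_ret p).
Proof.
rewrite /capped /cap_ret; have := cube_ret_mem (iflip p.1, p.2).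
by case: (cube_ret _) => t s [/= ->|]; [left; rewrite iflip0|right].
Qed.

Lemma cap_ret_id n (p : I * Q n) : capped p -> cap_ret p = p.
Proof.
move=> h; rewrite /cap_ret cube_ret_id /= ?iflipK; first by case: p h.
by case: h => [->|]; [left; rewrite iflip1|right].
Qed.

Lemma capped_Bd n (p : I * Q n) : capped p -> Bd p.
Proof. by move=> [p1|p2]; [apply: Or32|apply: Or33]. Qed.

Lemma closed_capped n : closed (@capped n).
Proof.
apply: closedU; first exact: closed_fst_pt.
by apply: closed_snd_preim; exact: closed_bd.
Qed.

Definition nloop_inj n (X Z : topologicalType) (q : X -> Z) :=
  forall (x : X) (al be : nloop R n x),
    homotopic_rel R (bd n) (q \o nloop_fun al) (q \o nloop_fun be) ->
    homotopic_rel R (bd n) (nloop_fun al) (nloop_fun be).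

Lemma ccont_point (T : topologicalType) n (t : I) (h : I * (I * Q n) -> T)
    (k : I * Q n -> T) :
  continuous k -> (forall u s, h (u, (t, s)) = k (u, s)) ->
  ccont (snd @^-1` [set p : I * Q n | p.1 = t]) h.
Proof.
move=> ck hk; have c2 : continuous (@snd I (I * Q n)) by exact: continuous_snd.
apply: (@ccont_eq _ _ _ (fun q => k (q.1, q.2.2))) => [|[u [t' s]] /= ->//].
apply: continuous_ccont; last by apply: closed_snd_preim; exact: closed_fst_pt.
apply: (@continuous_compT _ _ _ k (fun q : I * (I * Q n) => (q.1, q.2.2))) => //.
by apply: continuous_pair; [exact: continuous_fst|apply: continuous_compT c2; exact: continuous_snd].
Qed.

Lemma Bd_cover n : @Bd R n =
  [set p | p.1 = I0] `|` (@capped n).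
Proof.
apply/seteqP; split=> p; first by move=> [|?|?]; [left|right; left|right; right].
by move=> [?|[?|?]]; [apply: Or31|apply: Or32|apply: Or33].
Qed.

(* If the induced map on the n-th homotopy groups is injective then a sphere
   that becomes null in [Z] is null: contract the sphere minus its bottom face. *)
Lemma sphere_fill n (X Z : topologicalType) (q : X -> Z) (a : I * Q n -> X)
    (b : I * Q n -> Z) :
  continuous q -> nloop_inj n q -> ccont (@Bd R n) a -> continuous b ->
  (forall p, Bd p -> b p = q (a p)) ->
  exists2 a' : I * Q n -> X, continuous a' & forall p, Bd p -> a' p = a p.
Proof.
move=> cq inj ca cb bqa.
pose s0 : Q n := qrow (fun=> 0).
pose j0 : I * Q n := (I1, s0).
(* Linear contraction followed by the retraction: it contracts the capped part to [j0] inside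
   itself. *)
pose c (z : I * (I * Q n)) := cap_ret (icvx z.1 z.2.1 I1, qcvx z.1 z.2.2 s0).
have c2 : continuous (@snd I (I * Q n)) by exact: continuous_snd.
have c21 : continuous (fun z : I * (I * Q n) => z.2.1).
  by apply: continuous_compT c2; exact: continuous_fst.
have c22 : continuous (fun z : I * (I * Q n) => z.2.2).
  by apply: continuous_compT c2; exact: continuous_snd.
have cc : continuous c.
  apply: (continuous_compT (@continuous_cap_ret n)); apply: continuous_pair.
    by apply: cont_icvx => //; [exact: continuous_fst|exact: cont_cst].
  by apply: cont_qcvx => //; [exact: continuous_fst|exact: cont_cst].
have cJ z : capped (c z) by exact: cap_ret_mem.
have c0 p : capped p -> c (I0, p) = p.
  by move=> Jp; rewrite /c /= icvx0 qcvx0 -surjective_pairing cap_ret_id.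
have c1 p : c (I1, p) = j0.
  by rewrite /c /= icvx1 qcvx1 cap_ret_id//; left.
have cac : continuous (a \o c).
  by apply: ccont_total ca cc _ => z; apply: capped_Bd; exact: cJ.
have botB s : Bd (I0 : I, s : Q n) by apply: Or31.
have cbot : continuous (fun s : Q n => a (I0, s)).
  by apply: (ccont_total ca (u := fun s : Q n => (I0, s))) => //; exact: cont_pt.
have ccyl0 : continuous (fun z : I * Q n => (z.1, (I0 : I, z.2))).
  apply: continuous_pair; first exact: continuous_fst.
  by apply: continuous_pair; [exact: cont_cst|exact: continuous_snd].
(* The bottom face follows the contraction of its boundary and becomes a loop [al] at [x], while the
   rest of the sphere becomes constant: filling the sphere amounts to a null homotopy of [al]. *)
have [||s bs|A [cA A0 AA]] := @hep_cube R n X (fun s => a (I0, s))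
    (fun z => a (c (z.1, (I0, z.2)))).
- exact: cbot.
- apply: continuous_ccont; last by apply: closed_snd_preim; exact: closed_bd.
  exact: (continuous_compT cac ccyl0).
- by rewrite /= c0//; right.
pose x := a j0.
have alP : (fun s => A (I1, s)) \in @nloop_set R n X x.
  rewrite inE; split; first by apply: (continuous_compT cA); exact: cont_pt.
  by move=> s bs; rewrite AA// c1.
have beP : (fun _ : Q n => x) \in @nloop_set R n X x.
  by rewrite inE; split=> //; exact: cont_cst.
pose al : nloop R n x := mksub alP; pose be : nloop R n x := mksub beP.
pose au (z : I * (I * Q n)) :=
  if pselect (z.2.1 = I0) then A (z.1, z.2.2) else a (c z).
have auJ u p : capped p -> au (u, p) = a (c (u, p)).
  case: p => t s; rewrite /au /=; case: pselect => //= -> [/(@I0_neq_I1 R)//|/= bs].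
  by rewrite AA.
have au0 u s : au (u, (I0, s)) = A (u, s) by rewrite /au /=; case: pselect.
have cau : ccont (snd @^-1` (@Bd R n)) au.
  rewrite Bd_cover preimage_setU; apply: ccontU; first exact: ccont_point cA au0.
  apply: (@ccont_eq _ _ _ (a \o c)) => [|[u p] /= Jp]; last by rewrite auJ.
  by apply: continuous_ccont => //; apply: closed_snd_preim; exact: closed_capped.
have auI0 p : Bd p -> au (I0, p) = a p.
  rewrite Bd_cover; case: p => t s [/= ->|Jp]; first by rewrite au0 A0.
  by rewrite auJ// c0.
(* In [Z] the same deformation extends over the filled cylinder and yields the null homotopy of the
   image of [al]. *)
have [|p Bp|b1 [cb1 b10 b1B]] := @hep_Bd R n Z b (q \o au) cb.
- by apply: ccont_compT.
- by rewrite /= auI0// bqa.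
have qab : homotopic_rel R (bd n) (q \o nloop_fun al) (q \o nloop_fun be).
  exists (fun p => b1 (I1, p)); split=> [|s|s|t s bs].
  - by apply: (continuous_compT cb1); exact: cont_pt.
  - by rewrite b1B ?/= ?au0.
  - by rewrite b1B /= ?auJ ?c1//; [left|apply: Or32].
  - rewrite b1B /= ?auJ ?c1//; [|by right|by apply: Or33].
    by have [_ ->] := nloopP al.
have [L [cL L0 L1 LA]] := inj x al be qab.
have LBd p : Bd p -> L p = au (I1, p).
  rewrite Bd_cover; case: p => t s [/= ->|Jp]; first by rewrite L0 au0.
  rewrite auJ// c1; case: Jp => /= [->|bs]; first by rewrite L1.
  by rewrite LA//; have [_ ->] := nloopP al.
(* The deformation is undone around the filling [L]. *)
have [|p Bp|L' [cL' L'0 L'B]] := @hep_Bd R n X L (fun z => au (iflip z.1, z.2)) cL.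
- apply: (ccont_comp cau (u := fun z : I * (I * Q n) => (iflip z.1, z.2))) => //.
  apply: continuous_ccont; last by apply: closed_snd_preim; exact: closed_Bd.
  apply: continuous_pair; last exact: continuous_snd.
  by apply: (continuous_compT continuous_iflip); exact: continuous_fst.
- by rewrite /= iflip0 LBd.
exists (fun p => L' (I1, p)); first by apply: (continuous_compT cL'); exact: cont_pt.
by move=> p Bp; rewrite L'B//= iflip1 auI0.
Qed.

Lemma qsplitK n : cancel (@qsplit R n) (@qcons R n).
Proof.
move=> s; apply: qext => j; rewrite crd_qcons.
case: unliftP => [i ->|->] /=; first by rewrite crd_qrow clamp_id// crd_itv.
by rewrite ival_toI clamp_id// crd_itv.
Qed.

Lemma cube_fill n (X Z : topologicalType) (q : X -> Z) (a : Q n.+1 -> X)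
    (b : Q n.+1 -> Z) :
  continuous q -> nloop_inj n q -> ccont (bd n.+1) a -> continuous b ->
  (forall s, bd n.+1 s -> b s = q (a s)) ->
  exists2 a' : Q n.+1 -> X, continuous a' & forall s, bd n.+1 s -> a' s = a s.
Proof.
move=> cq inj ca cb ba.
have [|||a' ca' a'a] := @sphere_fill n X Z q (a \o @qcons R n) (b \o @qcons R n) cq inj.
- apply: (ccont_comp ca) => [|p]; last exact: qcons_Bd.
  by apply: continuous_ccont; [exact: continuous_qcons|exact: closed_Bd].
- by apply: (continuous_compT cb); exact: continuous_qcons.
- by move=> p /qcons_Bd; exact: ba.
exists (a' \o @qsplit R n).
  by apply: (continuous_compT ca'); exact: continuous_qsplit.
by move=> s bs /=; rewrite a'a /= ?qsplitK//; exact: qsplit_Bd.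
Qed.

(** Lifting without condition is extension; the base [R] is a dummy. *)
Definition over_triv (Y : topologicalType) : R -> Y -> Prop := fun _ _ => True.

Definition pin_trivial n (Y : topologicalType) :=
  forall (y : Y) (c d : pin R n y), c = d.

(** A constant map is injective on a trivial group and makes every sphere null, so [cube_fill]
    applies to it. *)
Lemma LP_triv n (Y : topologicalType) :
  pin_trivial n Y -> LP (R := R) (@over_triv Y) setT n.+1.
Proof.
move=> hY f g cf _ cg _.
have inj : nloop_inj n (fun _ : Y => 0 : R).
  by move=> y al be _; apply/pin_classP; exact: hY.
have [||||a' ca' a'g] := @cube_fill n Y R (fun=> 0) g (fun=> 0) _ inj; try exact: cont_cst.
- exact: cg.
- by [].
by exists a'.
Qed.

End CubeHomotopy.

(** * Mapping path fibrations and paths of lifts *)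

Section PathLifting.
Context {R : realType}.
Local Notation I := (uitv R).
Local Notation Q := (cube R).
Local Notation bd := (cube_bdry R).

Section MappingPaths.
Context (P B : topologicalType) (q : P -> B) (P0 : set P).

(** The mapping path fibration of [q]: a point of [P], confined to [P0], with a path from its image
    to [b]. *)
Definition over_map (b : B) (e : P * {compact-open, I -> B}) : Prop :=
  [/\ P0 e.1, continuous (e.2 : I -> B), (e.2 : I -> B) I0 = q e.1
    & (e.2 : I -> B) I1 = b].

Definition compress n := forall (b : Q n -> B) (a : Q n -> P), continuous b ->
  ccont (bd n) a -> (forall s, bd n s -> P0 (a s)) ->
  (forall s, bd n s -> q (a s) = b s) ->
  exists a' : Q n -> P, [/\ continuous a', forall s, P0 (a' s),
    forall s, bd n s -> a' s = a s & homotopic_rel R (bd n) (q \o a') b].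

(** The given paths allow [f] to be deformed until its boundary values are exactly the images of the
    given points. After compression the homotopies are composed; the result restricts to the given
    paths only up to reparametrisation, which homotopy extension on the boundary of the cylinder
    removes. *)
Lemma LP_map n : continuous q -> compress n -> LP (R := R) over_map setT n.
Proof.
move=> cq hc f g cf _ cg og.
pose gam (p : I * Q n) : B := (g p.2).2 p.1.
have cgam : ccont (snd @^-1` bd n) gam.
  apply: (@ccont_uncurry I (Q n) B (bd n) (snd \o g)).
  - exact: chaus_I.
  - by apply: ccont_compT => //; exact: continuous_snd.
  - by move=> s /og [].
have c1 : continuous (fun p : I * Q n => (iflip p.1, p.2)).
  apply: continuous_pair; last exact: continuous_snd.
  by apply: (continuous_compT continuous_iflip); exact: continuous_fst.
have clb : closed (snd @^-1` bd n : set (I * Q n)) by apply: closed_snd_preim; exact: closed_bd.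
have [|s bs|Hh [cHh Hh0 HhA]] := @hep_cube R n B f (fun p => gam (iflip p.1, p.2)) cf.
- by apply: (ccont_comp cgam (u := fun p : I * Q n => (iflip p.1, p.2))) => //; exact: continuous_ccont.
- by rewrite /= iflip0 /gam /=; have [] := og _ bs.
have [||s bs|s bs|a' [ca' a'P a'a [L [cL L0 L1 LA]]]] :=
    hc (fun s => Hh (I1, s)) (fst \o g).
- by apply: (continuous_compT cHh); exact: cont_pt.
- by apply: ccont_compT => //; exact: continuous_fst.
- by have [] := og _ bs.
- by rewrite HhA//= iflip1 /gam /=; have [] := og _ bs.
pose G := concat L (reverse Hh).
have cG : continuous G.
  by apply: continuous_concat => // [|s]; [exact: continuous_reverse|rewrite L1 reverse0].
have G0 s : G (I0, s) = q (a' s) by rewrite /G concat0 L0.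
have G1 s : G (I1, s) = f s by rewrite /G concat1 reverse1 Hh0.
(* [rep] interpolates, with fixed ends, between the pace that [concat] produces (rest, then double
   speed) and the original one. *)
pose rep (u t : I) : I := icvx u (toI (2 * ival t - 1)) t.
have rep0 u : rep u I0 = I0.
  by rewrite /rep ival0 mulr0 sub0r toI0 ?lerN10// /icvx ival0 !mulr0 addr0 toI0.
have rep1 u : rep u I1 = I1.
  rewrite /rep ival1 mulr1 toI1; last by rewrite lerBrDr -natr1.
  by rewrite /icvx ival1 !mulr1 subrK toI1.
have Gb t s : bd n s -> G (t, s) = gam (rep I0 t, s).
  move=> bs; rewrite /G /concat /rep icvx0 /=; case: ifP => th.
    rewrite LA//= a'a//= toI0 ?/gam /=; first by have [_ _ -> _] := og _ bs.
    by move: th; rewrite /ival; lra.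
  by rewrite /reverse /= HhA//=; congr gam; congr pair; exact: (iflipK (toI _)).
pose h (z : I * (I * Q n)) : B :=
  if pselect (bd n z.2.2) then gam (rep z.1 z.2.1, z.2.2) else G z.2.
have c2 : continuous (@snd I (I * Q n)) by exact: continuous_snd.
have c21 : continuous (fun z : I * (I * Q n) => z.2.1).
  by apply: continuous_compT c2; exact: continuous_fst.
have c22 : continuous (fun z : I * (I * Q n) => z.2.2).
  by apply: continuous_compT c2; exact: continuous_snd.
have gq s : bd n s -> q (a' s) = gam (I0, s).
  by move=> bs; rewrite a'a// /gam /=; have [_ _ -> _] := og _ bs.
have gf s : bd n s -> gam (I1, s) = f s.
  by move=> bs; rewrite /gam /=; have [] := og _ bs.
have h0 u s : h (u, (I0, s)) = q (a' s).
  by rewrite /h /=; case: pselect => bs; [rewrite rep0 gq|rewrite G0].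
have h1 u s : h (u, (I1, s)) = f s.
  by rewrite /h /=; case: pselect => bs; [rewrite rep1 gf|rewrite G1].
have ch : ccont (snd @^-1` (@Bd R n)) h.
  rewrite Bd_cover /capped.
  rewrite (_ : _ @^-1` _ = (snd @^-1` [set p : I * Q n | p.1 = I0]) `|`
    ((snd @^-1` [set p : I * Q n | p.1 = I1]) `|` (snd @^-1` (snd @^-1` bd n))))//.
  apply: ccontU.
    apply: (ccont_point (k := q \o a' \o snd)) h0.
    by apply: continuous_compT; [exact: continuous_compT|exact: continuous_snd].
  apply: ccontU.
    apply: (ccont_point (k := f \o snd)) h1.
    by apply: continuous_compT => //; exact: continuous_snd.
  apply: (@ccont_eq _ _ _ (gam \o (fun z : I * (I * Q n) => (rep z.1 z.2.1, z.2.2)))); last first.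
    by move=> z bz; rewrite /h; case: pselect.
  apply: (ccont_comp cgam) => //; apply: continuous_ccont; last first.
    by apply: closed_snd_preim; exact: clb.
  apply: continuous_pair => //; apply: cont_icvx => //; first exact: continuous_fst.
  apply: cont_toI; apply: contB; last exact: cont_cst.
  by apply: contMl; apply: (continuous_compT continuous_ival).
have [[t s] Bp|G' [cG' G'0 G'B]] := @hep_Bd R n B G h cG ch.
  by rewrite /h /=; case: pselect => // bs; rewrite Gb.
have G'1 := G'B I1.
exists (fun s => (a' s, (fun t => G' (I1, (t, s))))); split=> [|s|s bs].
- apply: continuous_pair => //.
  apply: (@continuous_curry2 I (Q n) B (fun p => G' (I1, p))).
  by apply: (continuous_compT cG'); exact: cont_pt.
- split=> //=.
  + apply: (@continuous_compT _ _ _ G' (fun t : I => (I1, (t, s)))) => //.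
    apply: continuous_pair; first exact: cont_cst.
    by apply: continuous_pair; [move=> t; exact: cvg_id|exact: cont_cst].
  + by rewrite G'1 ?h0//; apply: Or31.
  + by rewrite G'1 ?h1//; apply: Or32.
- transitivity ((g s).1, (g s).2); last by case: (g s).
  congr pair; first exact: a'a.
  apply/funext => t.
  rewrite G'1 /=; last exact: Or33.
  by rewrite /h /=; case: pselect => // bs'; rewrite /rep icvx1.
Qed.

End MappingPaths.

Section PathsOfLifts.
Context (B E : topologicalType) (over : B -> E -> Prop).
Local Notation CB := ({compact-open, I -> B} : topologicalType).

(** A base point is a path in [B] with candidate lifts of its ends, and a lift of it is a path of
    lifts between these. [path_ok] asks the base path to be continuous and the candidates to be
    lifts; this is the use of [U] in [lext2]. *)
Definition over_path (b : CB * (E * E)) (d : {compact-open, I -> E}) : Prop :=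
  [/\ continuous (d : I -> E), forall t, over ((b.1 : I -> B) t) ((d : I -> E) t),
    (d : I -> E) I0 = b.2.1 & (d : I -> E) I1 = b.2.2].

Definition path_ok : set (CB * (E * E)) := [set b |
  [/\ continuous (b.1 : I -> B), over ((b.1 : I -> B) I0) b.2.1
    & over ((b.1 : I -> B) I1) b.2.2]].

(** A path of lifts over an n-cube is a lift over the cylinder; prescribed ends and boundary values
    together cover the boundary of an (n+1)-cube. *)
Lemma LP_path n : LP (R := R) over setT n.+1 -> LP (R := R) over_path path_ok n.
Proof.
move=> hLP f g cf fU cg og.
have cf2 : continuous (fun s => (f s).2).
  by apply: (continuous_compT (@continuous_snd _ _)).
pose f' (p : I * Q n) : B := ((f p.2).1 : I -> B) p.1.
have cf' : continuous f'.
  apply: (@continuous_uncurry2 I (Q n) B (fst \o f)).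
  - exact: chaus_I.
  - by apply: continuous_compT cf; exact: continuous_fst.
  - by move=> s; have [] := fU s.
pose g' (p : I * Q n) : E := if pselect (p.1 = I0) then (f p.2).2.1 else
  if pselect (p.1 = I1) then (f p.2).2.2 else (g p.2 : I -> E) p.1.
have g'b p : bd n p.2 -> g' p = (g p.2 : I -> E) p.1.
  case: p => t s /= bs; have [_ _ g0 g1] := og _ bs; rewrite /g' /=.
  by case: pselect => /= [->//|_]; case: pselect => /= [->//|_].
have g'0 s : g' (I0, s) = (f s).2.1 by rewrite /g' /=; case: pselect.
have g'1 s : g' (I1, s) = (f s).2.2.
  by rewrite /g' /=; case: pselect => /= [/esym/(@I0_neq_I1 R)//|_]; case: pselect => /=.
have cg' : ccont (@Bd R n) g'.
  rewrite Bd_cover; apply: ccontU.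
    apply: (@ccont_eq _ _ _ (fun p : I * Q n => (f p.2).2.1)) => [|[t s] /= ->]; last by rewrite g'0.
    apply: continuous_ccont; last exact: closed_fst_pt.
    apply: (@continuous_compT _ _ _ (fun s => (f s).2.1) snd); last exact: continuous_snd.
    by apply: continuous_compT cf2; exact: continuous_fst.
  apply: ccontU.
    apply: (@ccont_eq _ _ _ (fun p : I * Q n => (f p.2).2.2)) => [|[t s] /= ->]; last by rewrite g'1.
    apply: continuous_ccont; last exact: closed_fst_pt.
    apply: (@continuous_compT _ _ _ (fun s => (f s).2.2) snd); last exact: continuous_snd.
    by apply: continuous_compT cf2; exact: continuous_snd.
  apply: (@ccont_eq _ _ _ (fun p : I * Q n => (g p.2 : I -> E) p.1)) => [|p /= /g'b//].
  apply: (@ccont_uncurry I (Q n) E (bd n) g) => //; first exact: chaus_I.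
  by move=> s /og [].
have [||||G [cG oG Gg]] := lext_Bd hLP (f := f') (g := g') => //.
  move=> [t s]; rewrite Bd_cover => -[/= ->|[/= ->|bs]].
  - by rewrite g'0; have [] := fU s.
  - by rewrite g'1; have [] := fU s.
  - by rewrite g'b//; have [_ + _ _] := og _ bs; exact.
exists (fun s t => G (t, s)); split=> [|s|s bs].
- exact: continuous_curry2.
- split=> [|t||].
  + apply: (@continuous_compT _ _ _ G (fun t : I => (t, s))) => //.
    by apply: continuous_pair; [move=> t; exact: cvg_id|exact: cont_cst].
  + exact: (oG (t, s)).
  + by rewrite Gg ?g'0//; apply: Or31.
  + by rewrite Gg ?g'1//; apply: Or32.
- apply/funext => t; rewrite Gg ?g'b//; exact: Or33.
Qed.

End PathsOfLifts.

End PathLifting.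

(** * Connectivity of Postnikov stages *)

Section Connectivity.
Context {R : realType}.
Local Notation I := (uitv R).
Local Notation Q := (cube R).
Local Notation bd := (cube_bdry R).

Lemma nbhs_subtype (T : topologicalType) (A : set T) (y : A) (P : set A) :
  nbhs y P -> exists2 V : set T, nbhs (set_val y : T) V & forall z : A, V (set_val z) -> P z.
Proof.
move=> nP; have [W [[V oV VW] Wy] WP] : exists2 W, open_nbhs y W & W `<=` P by move: nP; rewrite nbhsE.
exists V; first by apply: open_nbhs_nbhs; split=> //; move: Wy; rewrite -VW.
by move=> z Vz; apply: WP; rewrite -VW.
Qed.

Lemma cofibration_hep (T : topologicalType) (A : set T) :
  closed A -> hep (R := R) A -> cofibration R (set_val : A -> T).
Proof.
move=> cA hA; split; first exact: continuous_set_val.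
move=> Z f h cf ch hf.
pose h' (p : I * T) := if pselect (p.2 \in A) is left xA then h (p.1, mksub xA) else f p.2.
have h'E t (a : A) : h' (t, set_val a) = h (t, a).
  rewrite /h' /=; case: pselect => [xA|[]]; last exact: (valP a).
  by congr (h (t, _)); exact: val_inj.
have [||H [cH H0 HA]] := hA Z f h' cf.
- apply: nbhs_ccont; first exact: closed_snd_preim.
  move=> [t x] O /= Ax oO; have xA : x \in A by rewrite inE.
  rewrite (h'E t (mksub xA)) => Oh.
  have : nbhs (h (t, mksub xA)) O by exact: open_nbhs_nbhs.
  move=> /ch [[P1 P2] [/= nP1 nP2] PO].
  have [V nV VP] := nbhs_subtype nP2.
  exists (P1, V) => //= -[s y] /= [P1s Vy] Ay.
  have yA : y \in A by rewrite inE.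
  by rewrite (h'E s (mksub yA)); apply: (PO (s, mksub yA)); split=> //; exact: VP.
- by move=> x Ax; have xA : x \in A := mem_set Ax; rewrite (h'E I0 (mksub xA)) hf.
exists H; split=> // t a.
by rewrite HA ?h'E//; exact: (set_valP a).
Qed.

Lemma bd_cofibration n : cofibration R (set_val : bd n -> Q n).
Proof. by apply: cofibration_hep; [exact: closed_bd|exact: hep_cube]. Qed.

(** The two maps and the constant homotopy on the boundary form an n-sphere in [Y], which bounds. *)
Lemma homotopic_rel_triv n (Y : topologicalType) (f g : Q n -> Y) :
  pin_trivial (R := R) n Y -> continuous f -> continuous g ->
  (forall s, bd n s -> f s = g s) -> homotopic_rel R (bd n) f g.
Proof.
move=> hY cf cg fg.
pose G (p : I * Q n) := if pselect (p.1 = I1) then g p.2 else f p.2.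
have G1 s : G (I1, s) = g s by rewrite /G /=; case: pselect.
have G0 s : G (I0, s) = f s.
  by rewrite /G /=; case: pselect => //= /(@I0_neq_I1 R).
have Gb p : bd n p.2 -> G p = f p.2.
  by move=> bp; rewrite /G; case: pselect => //= _; rewrite fg.
have cG : ccont (@Bd R n) G.
  have cs (k : Q n -> Y) : continuous k -> continuous (k \o @snd I (Q n)).
    by move=> ck; apply: continuous_compT => //; exact: continuous_snd.
  rewrite Bd_cover; apply: ccontU.
    apply: (@ccont_eq _ _ _ (f \o snd)) => [|[t s] /= ->//].
    by apply: continuous_ccont; [exact: cs|exact: closed_fst_pt].
  apply: ccontU.
    apply: (@ccont_eq _ _ _ (g \o snd)) => [|[t s] /= ->//].
    by apply: continuous_ccont; [exact: cs|exact: closed_fst_pt].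
  apply: (@ccont_eq _ _ _ (f \o snd)) => [|p bp]; last by rewrite Gb.
  by apply: continuous_ccont; [exact: cs|apply: closed_snd_preim; exact: closed_bd].
have [||||H [cH _ HB]] := lext_Bd (LP_triv hY) (f := fun=> 0) (g := G) => //.
  exact: cont_cst.
exists H; split=> // [s|s|t s bs]; rewrite HB ?G0 ?G1 ?Gb//; [exact: Or31|exact: Or32|exact: Or33].
Qed.

Section Postnikov.
Variables (m : nat) (X Y : topologicalType) (p : continuousType X Y).
Hypotheses (X0 : X) (hp : @postnikov_stage R m X Y p).

Lemma cont_p : continuous p. Proof. exact: cts_fun. Qed.

Lemma postnikov_inj n : (n <= m)%N -> nloop_inj (R := R) n p.
Proof.
move=> nm x al be h; apply/pin_classP.
have /bij_inj inj := hp.1 n nm x; apply: inj.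
by rewrite !pin_mapE; apply/pin_classP.
Qed.

Lemma postnikov_surj n (x : X) (be : nloop R n (p x)) : (n <= m)%N ->
  exists al : nloop R n x, homotopic_rel R (bd n) (p \o nloop_fun al) (nloop_fun be).
Proof.
move=> nm; have [g _ gK] := hp.1 n nm x.
have := gK (pin_class be); move: (g _) => c; rewrite -(pin_classK c) pin_mapE.
by move=> /pin_classP h; exists (repr c).
Qed.

Lemma postnikov_trivial n : (m < n)%N -> pin_trivial (R := R) n Y.
Proof. exact: hp.2. Qed.

(* First fill the sphere, by injectivity; then correct the filling, by surjectivity or,
   in the top dimension, by triviality of the group of the target. *)
Lemma postnikov_compress n : (n <= m.+1)%N -> compress (R := R) p setT n.
Proof.
move=> nm b a cb ca _ pab.
have [a0 ca0 a0a] : exists2 a0 : Q n -> X, continuous a0 & forall s, bd n s -> a0 s = a s.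
  (* A 0-cube has no boundary, so any point of [X] fills it. *)
  case: n nm b a cb ca pab => [|n] nm b a cb ca pab.
    by exists (fun=> X0); [exact: cont_cst|move=> s [[]]].
  apply: (@cube_fill R n X Y p a b cont_p _ ca cb) => [|s bs]; last by rewrite pab.
  exact: postnikov_inj.
have ba0 s : bd n s -> p (a0 s) = b s by move=> bs; rewrite a0a ?pab.
have [nm1|nm1] := leqP n m; last first.
  exists a0; split=> //; apply: homotopic_rel_triv => //; first exact: postnikov_trivial.
  by apply: continuous_compT => //; exact: cont_p.
pose s0 : Q n := qrow (fun=> 0).
pose x := a0 s0.
(* Contracting the filling [a0] to [x] drags [b] to a loop at [p x]; a preimage [al] of its class is
   then dragged back along the same motion. *)
pose at_ (z : I * Q n) := a0 (qcvx z.1 z.2 s0).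
have cat : continuous at_.
  apply: (continuous_compT ca0); apply: cont_qcvx; [exact: continuous_fst|exact: continuous_snd|exact: cont_cst].
have at0 s : at_ (I0, s) = a0 s by rewrite /at_ /= qcvx0.
have at1 s : at_ (I1, s) = x by rewrite /at_ /= qcvx1.
have clb : closed (snd @^-1` bd n : set (I * Q n)) by apply: closed_snd_preim; exact: closed_bd.
have cpat : continuous (p \o at_) by apply: continuous_compT => //; exact: cont_p.
have [||Bh [cBh Bh0 BhA]] := @hep_cube R n Y b (p \o at_) cb.
- exact: continuous_ccont.
- by move=> s bs /=; rewrite at0 ba0.
have beP : (fun s => Bh (I1, s)) \in @nloop_set R n Y (p x).
  rewrite inE; split; first by apply: (continuous_compT cBh); exact: cont_pt.
  by move=> s bs; rewrite BhA//= at1.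
have [al hal] := @postnikov_surj n x (mksub beP) nm1.
have [cal alx] := nloopP al.
have cfl : continuous (fun z : I * Q n => (iflip z.1, z.2)).
  apply: continuous_pair; last exact: continuous_snd.
  by apply: (continuous_compT continuous_iflip); exact: continuous_fst.
have [||Ah [cAh Ah0 AhA]] := @hep_cube R n X (nloop_fun al) (fun z => at_ (iflip z.1, z.2)) cal.
- by apply: continuous_ccont => //; exact: (continuous_compT cat cfl).
- by move=> s bs /=; rewrite iflip0 at1 alx.
exists (fun s => Ah (I1, s)); split=> //.
- by apply: (continuous_compT cAh); exact: cont_pt.
- by move=> s bs; rewrite AhA//= iflip1 at0 a0a.
(* The image of the motion of [al] and the reversed motion of [b] agree on the boundary and start
   from homotopic loops. *)
have := @homotopic_rel_transport R _ _ Y _ (p \o Ah) (fun z => Bh (iflip z.1, z.2)) (bd_cofibration n).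
have rg : range (set_val : bd n -> Q n) = bd n.
  apply/seteqP; split=> s; first by move=> [t _ <-]; exact: (set_valP t).
  by move=> bs; have sb : s \in bd n := mem_set bs; exists (mksub sb).
rewrite rg.
rewrite (_ : (fun x => Bh (iflip (I1, x).1, (I1, x).2)) = b); last first.
  by apply/funext => s /=; rewrite iflip1 Bh0.
apply.
- by apply: continuous_compT => //; exact: cont_p.
- exact: (continuous_compT cBh cfl).
- move=> t [s sb] /=; have bs : bd n s by move: sb; rewrite inE.
  by rewrite AhA// BhA.
rewrite (_ : (fun x => (p \o Ah) (I0, x)) = p \o nloop_fun al); last first.
  by apply/funext => s /=; rewrite Ah0.
by rewrite /= iflip0.
Qed.

Lemma postnikov_LP n : (n <= m.+1)%N ->
  LP (R := R) (@over_map R X Y p setT) setT n.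
Proof. by move=> nm; apply: LP_map; [exact: cont_p|exact: postnikov_compress]. Qed.

End Postnikov.

End Connectivity.

(** * Avoiding a point *)

Section AvoidZero.
Context {R : realType}.
Local Notation I := (uitv R).
Local Notation Q := (cube R).
Local Notation disc := (disc R).

Lemma bounded_Q n (w : Q n -> R) : continuous w -> exists2 M, 0 < M & forall x, `|w x| <= M.
Proof.
move=> cw; have : compact (w @` setT).
  by apply: continuous_compact; [exact: continuous_subspaceT|exact: (chaus_Q n).1].
move=> /compact_bounded[M [_ hM]].
exists (Num.max (M + 1) 1); first by rewrite lt_max ltr01 orbT.
by move=> x; apply: (hM (Num.max (M + 1) 1)) => //; rewrite ?lt_max ?ltrDl ?ltr01.
Qed.

Definition qdist n (x y : Q n) : R := ninf (fun j => crd x j - crd y j).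

Lemma qdist_triangle n (x y z : Q n) : qdist x z <= qdist x y + qdist y z.
Proof.
apply: ninf_lub => [|j]; first by rewrite addr_ge0 ?ninf_ge0.
rewrite (_ : _ - _ = (crd x j - crd y j) + (crd y j - crd z j)); last by ring.
apply: le_trans (ler_normD _ _) _.
by apply: lerD; [exact: (ninf_le (fun j => crd x j - crd y j))|exact: (ninf_le (fun j => crd y j - crd z j))].
Qed.

Lemma qdistC n (x y : Q n) : qdist x y = qdist y x.
Proof.
apply/le_anti/andP; split; apply: ninf_lub; rewrite ?ninf_ge0// => j; rewrite distrC.
- exact: (ninf_le (fun j => crd y j - crd x j)).
- exact: (ninf_le (fun j => crd x j - crd y j)).
Qed.

Lemma qdistxx n (x : Q n) : qdist x x = 0.
Proof. by apply: ninf0 => j; rewrite subrr. Qed.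

(* The approximation is the inf-convolution [inf_y w y + L d(x, y)]. *)
Lemma lipschitz_approx n (w : Q n -> R) (e : R) : continuous w -> 0 < e ->
  exists (g : Q n -> R) (L : R), [/\ 0 < L, forall x, `|g x - w x| <= e
    & forall x y, g x - g y <= L * qdist x y].
Proof.
move=> cw e0; have [M M0 wM] := bounded_Q cw.
have [N hN] := unif_cont_Q cw e0.
have d0 : 0 < 2^-1 ^+ N :> R by rewrite exprn_gt0// invr_gt0.
pose L := 2 * M / 2^-1 ^+ N.
have L0 : 0 < L by rewrite divr_gt0// mulr_gt0.
pose S x := range (fun y => w y + L * qdist x y).
have Sne x : S x !=set0 by exists (w x + L * qdist x x), x.
have Slb x : lbound (S x) (- M).
  move=> _ [y _ <-]; have := wM y; rewrite ler_norml => /andP[wy _].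
  by rewrite -[leLHS]addr0 lerD// mulr_ge0 ?ninf_ge0// ltW.
have Si x : has_inf (S x) by split => //; exists (- M).
pose g x := inf (S x).
have gle x y : g x <= w y + L * qdist x y.
  by apply: ge_inf; [exists (- M)|exists y].
exists g, L; split=> // x.
  rewrite ler_norml; apply/andP; split; last first.
    by have := gle x x; rewrite qdistxx mulr0 addr0; lra.
  rewrite lerBrDr; apply: lb_le_inf => // _ [y _ <-].
  have [xy|xy] := leP (qdist x y) (2^-1 ^+ N).
    have := hN x y; rewrite ltr_norml => /(_ _)/andP[j|_ wxy].
      by apply: le_trans xy; exact: (ninf_le (fun j => crd x j - crd y j)).
    have : 0 <= L * qdist x y by rewrite mulr_ge0 ?ninf_ge0// ltW.
    by lra.
  have : 2 * M <= L * qdist x y.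
    by rewrite /L mulrAC ler_pdivlMr// ler_pM2l ?mulr_gt0// ltW.
  have := wM x; have := wM y; rewrite !ler_norml => /andP[h1 h2] /andP[h3 h4].
  by lra.
move=> y; rewrite lerBlDr -lerBlDl; apply: lb_le_inf => // _ [z _ <-].
rewrite lerBlDl; apply: le_trans (gle x z) _.
rewrite addrCA lerD2l -mulrDr ler_pM2l//; exact: qdist_triangle.
Qed.

Lemma near_crd n (x : (Q n : topologicalType)) (d : R) : 0 < d ->
  \forall y \near x, forall j, `|crd x j - crd y j| < d.
Proof.
move=> d0; apply: (@filter_forall _ _ _ _ (nbhs_filter x)) => j.
by have /cvgrPdist_lt := @continuous_crd R n j x; apply.
Qed.

Lemma lipschitz_continuous n (g : Q n -> R) (L : R) : 0 < L ->
  (forall x y, g x - g y <= L * qdist x y) -> continuous g.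
Proof.
move=> L0 gL x; apply/(@cvgrPdist_lt _ _ _ _ (nbhs_filter x) g (g x)) => e e0.
have eL : 0 < e / (2 * L) by rewrite divr_gt0// mulr_gt0.
have := near_crd x eL.
apply: filterS => y hy.
have qe : L * qdist x y <= e / 2.
  rewrite mulrC -ler_pdivlMr// -mulrA -invfM; apply: ninf_lub => [|j].
    by rewrite divr_ge0 ?ltW// mulr_gt0.
  exact: ltW.
have g1 := gL x y; have g2 := gL y x; rewrite qdistC in g2.
by rewrite ltr_norml; lra.
Qed.

Lemma grid_index N (r : R) : (0 < N)%N -> 0 <= r <= 1 ->
  exists q : 'I_N, q%:R <= N%:R * r <= q.+1%:R.
Proof.
move=> N0 /andP[r0 r1].
have Nr0 : 0 <= N%:R * r by rewrite mulr_ge0.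
have [tN|Nt] := ltnP (Num.truncn (N%:R * r)) N.
  exists (Ordinal tN) => /=; have := truncn_itv Nr0.
  by move=> /andP[-> /ltW ->].
(* For [r = 1] the truncation is [N], out of range; the last box takes the point. *)
have pN : (N.-1 < N)%N by rewrite ltn_predL.
exists (Ordinal pN) => /=.
have h : N%:R <= N%:R * r.
  have /andP[h _] := truncn_itv Nr0.
  by apply: le_trans h; rewrite ler_nat.
rewrite prednK// (le_trans _ h) ?ler_nat ?leq_pred//=.
by rewrite ler_piMr.
Qed.

(* Pigeonhole: a Lipschitz image of the n-cube is covered by [N^n] boxes of side
   [O(1/N)], too few to cover [M^k] well separated points when [n < k]. *)
Lemma lipschitz_misses n k (g : 'I_k -> Q n -> R) (L c : R) :
  (n < k)%N -> 0 < L -> 0 < c -> (forall j x y, g j x - g j y <= L * qdist x y) ->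
  exists a : 'I_k -> R, (forall j, 0 <= a j <= c) /\
    forall x, exists j, g j x != a j.
Proof.
move=> nk L0 c0 gL.
(* Since [L / c < C] and [N = M * C], a box of side [1 / N] has an image narrower than the spacing
   [c / M]; since [C ^ n < M], the number [N ^ n] of boxes is less than [M ^ n.+1 <= M ^ k]. *)
pose C := (Num.truncn (L / c)).+1.
have LC : L / c < C%:R by exact: truncnS_gt.
have C0 : (0 < C)%N by [].
clearbody C; pose M := (C ^ n).+1; have CM : (C ^ n < M)%N by [].
clearbody M; have Mp : (0 < M)%N by apply: leq_ltn_trans CM.
pose N := (M * C)%N; have NE : N = (M * C)%N by [].
clearbody N; have N0 : (0 < N)%N by rewrite NE muln_gt0 Mp.
have M0 : 0 < M%:R :> R by rewrite ltr0n.
pose pt (a : {ffun 'I_k -> 'I_M}) j : R := (a j)%:R * (c / M%:R).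
have cM : 0 < c / M%:R by rewrite divr_gt0.
apply: contrapT => /forallNP nh.
have /choice[z hz] (a : {ffun 'I_k -> 'I_M}) : exists z, forall j, g j z = pt a j.
  apply: contrapT => /forallNP na; apply: (nh (pt a)); split=> [j|x].
    rewrite /pt mulr_ge0 ?(ltW cM)//= mulrCA ger_pMr// ler_pdivrMr// mul1r ler_nat.
    exact/ltnW/ltn_ord.
  by have /existsNP[j /eqP] := na x; exists j.
have /choice[ix hix] (x : Q n) : exists q : {ffun 'I_n -> 'I_N},
    forall i, (q i)%:R <= N%:R * crd x i <= (q i).+1%:R.
  have /choice[q hq] i := @grid_index N (crd x i) N0 (crd_itv x i).
  by exists [ffun i => q i] => i; rewrite ffunE.
have inj : injective (ix \o z).
  suff le a b : ix (z a) = ix (z b) -> forall j, (a j <= b j)%N.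
    move=> a b /= ab; apply/ffunP => j; apply/val_inj/anti_leq.
    by rewrite !le.
  move=> ab j; rewrite leqNgt; apply/negP => lt.
  have := gL j (z a) (z b); rewrite !hz /pt -mulrBl.
  have q1 : qdist (z a) (z b) <= N%:R^-1.
    apply: ninf_lub => [|i]; first by rewrite invr_ge0.
    have := hix (z a) i; have := hix (z b) i; rewrite ab -!natr1 => /andP[h1 h2] /andP[h3 h4].
    have NR : 0 < N%:R :> R by rewrite ltr0n.
    have NV : N%:R * N%:R^-1 = 1 :> R by rewrite mulfV// gt_eqF.
    rewrite ler_norml; apply/andP; split.
      by rewrite lerNl -(ler_pM2l NR) NV; lra.
    by rewrite -(ler_pM2l NR) NV; lra.
  have h1 : L * qdist (z a) (z b) < c / M%:R.
    apply: le_lt_trans (_ : L * N%:R^-1 < _); first by rewrite ler_pM2l.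
    rewrite NE natrM invfM mulrCA mulrC ltr_pM2r ?invr_gt0// ltr_pdivrMr ?ltr0n//.
    by rewrite mulrC -ltr_pdivrMr.
  move=> h2; have := le_lt_trans h2 h1; rewrite gtr_pMl//; apply/negP.
  by rewrite -leNgt lerBrDr addrC natr1 ler_nat.
have := leq_card _ inj; rewrite !card_ffun !card_ord leqNgt => /negP; apply.
rewrite NE expnMn; apply: leq_trans (_ : M ^ n.+1 <= _)%N; last first.
  by rewrite leq_pexp2l.
by rewrite expnSr ltn_pmul2l// expn_gt0 Mp.
Qed.

(** Approximate [w] by Lipschitz functions [g], let [a] be a small value that [g] misses, and take
    [d / 2 = g - a - w]. *)
Lemma avoid_zero n k (w : 'I_k -> Q n -> R) : (n < k)%N -> (forall j, continuous (w j)) ->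
  exists d : Q n -> disc k, continuous d /\
    forall z, exists j, w j z + dcrd (d z) j / 2 != 0.
Proof.
move=> nk cw; have k0 : (0 < k)%N by apply: leq_ltn_trans nk.
(* Bounds [eta / 4] on [g - w] and on [a] bound each coordinate of [d] by [eta <= 1]; with
   [eta = 1 / k] the sum of squares is at most [k * eta = 1], so [d] lies in the disc. *)
pose eta : R := k%:R^-1.
have k1 : 1 <= k%:R :> R by rewrite ler1n.
have kR : 0 < k%:R :> R by rewrite ltr0n.
have eta0 : 0 < eta by rewrite invr_gt0.
have eta4 : 0 < eta / 4 by rewrite divr_gt0.
have /choice[g hg] j : exists g : Q n -> R, exists L, [/\ 0 < L,
    forall x, `|g x - w j x| <= eta / 4 & forall x y, g x - g y <= L * qdist x y].
  exact: lipschitz_approx (cw j) eta4.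
have /choice[L hL] := hg.
pose L' := \sum_j L j.
have LL' j : L j <= L'.
  by rewrite /L' (bigD1 j)//= lerDl sumr_ge0// => i _; have [/ltW] := hL i.
have L'0 : 0 < L' by apply: lt_le_trans (LL' (Ordinal k0)); have [] := hL (Ordinal k0).
have [|a [ha hax]] := @lipschitz_misses n k g L' (eta / 4) nk L'0 eta4.
  move=> j x y; have [_ _ h] := hL j; apply: le_trans (h x y) _.
  by rewrite ler_wpM2r ?ninf_ge0.
have dn z : neuc (fun j => 2 * (g j z - a j - w j z)) <= 1.
  rewrite neuc_le1; apply: (@le_trans _ _ (\sum_(j < k) eta)); last first.
    by rewrite sumr_const card_ord -[leLHS]mulr_natr mulVf// gt_eqF.
  apply: ler_sum => j _.
  have [_ /(_ z) + _] := hL j; have := ha j; rewrite ler_norml => /andP[a0 a1] /andP[g0 g1].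
  have e1 : eta <= 1 by rewrite invf_le1.
  have : `|2 * (g j z - a j - w j z)| <= eta by rewrite ler_norml; lra.
  move=> h; rewrite -real_normK ?num_real// expr2.
  apply: le_trans (_ : eta * 1 <= _); last by rewrite mulr1.
  by apply: ler_pM => //; apply: le_trans h _.
exists (fun z => drow (fun j => 2 * (g j z - a j - w j z))); split.
  apply: continuous_drow => j; apply: contMl; apply: contB => //.
  apply: contB; last exact: cont_cst.
  by have [L0 _ gL] := hL j; exact: lipschitz_continuous gL.
move=> z; have [j hj] := hax z; exists j; rewrite dcrd_drow//.
by rewrite [2 * _]mulrC mulfK ?pnatr_eq0// addrC subrK subr_eq0.
Qed.

End AvoidZero.

(** * Cellular approximation *)

Section CellularCompression.
Context {R : realType} {X : topologicalType} (K : cw_complex R X).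
Local Notation I := (uitv R).
Local Notation Q := (cube R).
Local Notation bd := (cube_bdry R).
Local Notation disc := (disc R).
Local Notation sphere := (sphere R).
Local Notation Sk := (Sk K).

Section CellMap.
Variables (k : nat) (P : topologicalType) (th : P * disc k -> disc k).
Hypotheses (cP : chaus P) (cth : continuous th)
  (thS : forall q v, sphere k v -> th (q, v) = v).

Definition cellmap (p : P * X) : X :=
  cellwise (fun (e : cell K k) v => char_map e (th (p.1, v))) id p.2.

Lemma cellmap_cell q (e : cell K k) v :
  cellmap (q, char_map e v) = char_map e (th (q, v)).
Proof. by rewrite /cellmap cellwise_cell// => e' v' sv; rewrite thS. Qed.

Lemma cellmap_Sk q x : Sk k x -> cellmap (q, x) = x.
Proof. by move=> Sx; rewrite /cellmap cellwise_Sk. Qed.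

Lemma Sk_cases x : Sk k.+1 x -> Sk k x \/ exists (e : cell K k) v, x = char_map e v.
Proof.
move=> [n [e [v [+ ov <-]]]]; rewrite ltnS leq_eqVlt => /orP[/eqP nk|nk].
  by subst n; right; exists e, v.
by left; apply: (Sk_sub nk); exact: cell_Sk.
Qed.

Lemma cellmap_SkS q x : Sk k.+1 x -> Sk k.+1 (cellmap (q, x)).
Proof.
move=> Sx; have [Sx'|[e [v ->]]] := Sk_cases Sx; first by rewrite cellmap_Sk.
by rewrite cellmap_cell; exact: cell_Sk.
Qed.

(** No weak topology on a product is needed: as a function on the skeleton with values in maps from
    [P], continuity is tested on cells, and compactness of [P] allows uncurrying. *)
Lemma ccont_cellmap : ccont (snd @^-1` Sk k.+1) cellmap.
Proof.
have ct (e : cell K k) : continuous (fun p : P * disc k => char_map e (th p)).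
  exact: (continuous_compT (cont_char e) cth).
pose F (x : X) : {compact-open, P -> X} := fun q => cellmap (q, x).
have := @ccont_uncurry P X X (Sk k.+1) F cP.
rewrite (_ : (fun p => F p.2 p.1) = cellmap); last by apply/funext => -[].
apply.
  apply: ccont_Sk => n e; rewrite ltnS leq_eqVlt => /orP[/eqP nk|nk].
    subst n; rewrite (_ : F \o _ = (fun v q => char_map e (th (q, v)))).
      exact: (@continuous_curry2 P _ X (fun p => char_map e (th p))).
    by apply/funext => v; apply/funext => q; rewrite /F /= cellmap_cell.
  rewrite (_ : F \o _ = (fun v q => char_map e v)).
    apply: (@continuous_curry2 P _ X (fun p => char_map e p.2)).
    by apply: (continuous_compT (cont_char e)); exact: continuous_snd.
  apply/funext => v; apply/funext => q; rewrite /F /= cellmap_Sk//.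
  by apply: (Sk_sub nk); exact: cell_Sk.
move=> x Sx; have [Sx'|[e [v ->]]] := Sk_cases Sx.
  rewrite (_ : F x = fun=> x); first exact: cont_cst.
  by apply/funext => q; rewrite /F cellmap_Sk.
rewrite (_ : F _ = fun q => char_map e (th (q, v))).
  apply: (continuous_compT (ct e)).
  by apply: continuous_pair; [move=> q; exact: cvg_id|exact: cont_cst].
by apply/funext => q; rewrite /F cellmap_cell.
Qed.

Lemma continuous_cellmap (T : topologicalType) (a : T -> P) (b : T -> X) :
  continuous a -> continuous b -> (forall x, Sk k.+1 (b x)) ->
  continuous (fun x => cellmap (a x, b x)).
Proof.
move=> ca cb Sb; apply: (ccont_total ccont_cellmap (u := fun x => (a x, b x))) => //.
exact: continuous_pair.
Qed.

End CellMap.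

Lemma ccont_cellfun k (T : topologicalType) (h : disc k -> T) (c : T) :
  continuous h -> (forall v, sphere k v -> h v = c) ->
  ccont (Sk k.+1) (cellwise (fun (_ : cell K k) v => h v) (fun=> c)).
Proof.
move=> ch hc; apply: ccont_cellwise => //.
by apply: continuous_ccont; [exact: cont_cst|exact: closed_Sk].
Qed.

Section Push.
Variables (n k : nat).
Hypothesis nk : (n < k)%N.

(** Equal to 1 up to radius 1/2 and to 0 on the sphere; the bound by [2 - 2 * drad v] keeps a shift
    by half of it inside the disc. *)
Definition damp (v : disc k) : R := Num.min 1 (2 - 2 * drad v).
(* Perturbs the interior of a cell by [p.1], fixing its boundary and acting as a
   translation by [p.1 / 2] near the centre. *)
Definition shift (p : disc k * disc k) : disc k :=
  drow (fun j => dcrd p.2 j + damp p.2 * (dcrd p.1 j / 2)).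

Lemma damp_itv v : 0 <= damp v <= 1.
Proof.
rewrite /damp ge_min lexx /= andbT le_min ler01 /=.
by have := drad_le1 v; lra.
Qed.
Lemma continuous_damp : continuous damp.
Proof.
apply: cont_min; first exact: cont_cst.
apply: contB; first exact: cont_cst.
by apply: contMl; exact: continuous_drad.
Qed.
Lemma damp_sphere v : sphere k v -> damp v = 0.
Proof. by move=> /sphereE v1; rewrite /damp v1 mulr1 subrr min_r. Qed.

Lemma neuc_shift (d v : disc k) :
  neuc (fun j => dcrd v j + damp v * (dcrd d j / 2)) <= drad v + damp v / 2.
Proof.
apply: le_trans (neuc_triangle _ _) _; rewrite lerD2l.
rewrite (_ : (fun j => _) = (fun j => (damp v / 2) * dcrd d j)); last first.
  by apply/funext => j; ring.
have /andP[d0 _] := damp_itv v.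
rewrite neucZ ger0_norm ?divr_ge0// -[leRHS]mulr1 ler_wpM2l ?divr_ge0//.
exact: drad_le1.
Qed.

Lemma neuc_shift1 (d v : disc k) :
  neuc (fun j => dcrd v j + damp v * (dcrd d j / 2)) <= 1.
Proof.
apply: le_trans (neuc_shift d v) _.
have : damp v <= 2 - 2 * drad v by rewrite /damp ge_min lexx orbT.
lra.
Qed.

Lemma dcrd_shift d v j :
  dcrd (shift (d, v)) j = dcrd v j + damp v * (dcrd d j / 2).
Proof. by rewrite dcrd_drow// neuc_shift1. Qed.

Lemma continuous_shift : continuous shift.
Proof.
have c1 j : continuous (fun p : disc k * disc k => dcrd p.1 j).
  by apply: (continuous_compT (@continuous_dcrd R k j)); exact: continuous_fst.
have c2 j : continuous (fun p : disc k * disc k => dcrd p.2 j).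
  by apply: (continuous_compT (@continuous_dcrd R k j)); exact: continuous_snd.
apply: continuous_drow => j; apply: contD => //; apply: contM.
  by apply: (continuous_compT continuous_damp); exact: continuous_snd.
by apply: contM => //; exact: cont_cst.
Qed.

Lemma shift_sphere d v : sphere k v -> shift (d, v) = v.
Proof. by move=> sv; apply: dext => j; rewrite dcrd_shift damp_sphere// mul0r addr0. Qed.

Definition dscale (t : I) (d : disc k) : disc k := drow (fun j => ival t * dcrd d j).
Lemma dcrd_dscale t d j : dcrd (dscale t d) j = ival t * dcrd d j.
Proof.
rewrite dcrd_drow// neucZ; have /andP[t0 t1] := ival_itv t.
rewrite ger0_norm//; apply: mulr_ile1 => //; [exact: neuc_ge0|exact: drad_le1].
Qed.
Lemma continuous_dscale : continuous (fun p : I * disc k => dscale p.1 p.2).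
Proof.
apply: continuous_drow => j; apply: contM.
  by apply: (continuous_compT continuous_ival); exact: continuous_fst.
by apply: (continuous_compT (@continuous_dcrd R k j)); exact: continuous_snd.
Qed.

Section Expand.
Variable del : R.
Hypothesis del01 : 0 < del <= 1.

(** At time 1 the radius is divided by its maximum with [del]: points at radius at least [del] reach
    the sphere, and continuity at the centre is kept. *)
Definition expand (p : I * disc k) : disc k :=
  drow (fun j => ((1 - ival p.1) + ival p.1 / Num.max (drad p.2) del) * dcrd p.2 j).

Lemma max_gt0 (v : disc k) : 0 < Num.max (drad v) del.
Proof. by rewrite lt_max; case/andP: del01 => ->; rewrite orbT. Qed.

Lemma fac_ge0 t (v : disc k) : 0 <= (1 - ival t) + ival t / Num.max (drad v) del.
Proof.
have /andP[t0 t1] := ival_itv t.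
by rewrite addr_ge0 ?subr_ge0// divr_ge0// ltW// max_gt0.
Qed.

Lemma neuc_expand t (v : disc k) :
  neuc (fun j => ((1 - ival t) + ival t / Num.max (drad v) del) * dcrd v j) <= 1.
Proof.
rewrite neucZ ger0_norm ?fac_ge0// -/(drad v) mulrDl.
have /andP[t0 t1] := ival_itv t.
have h : ival t / Num.max (drad v) del * drad v <= ival t.
  by rewrite -mulrA ler_piMr// mulrC ler_pdivrMr ?max_gt0// mul1r le_max lexx.
have := drad_le1 v; have := drad_ge0 v; nra.
Qed.

Lemma dcrd_expand t v j : dcrd (expand (t, v)) j =
  ((1 - ival t) + ival t / Num.max (drad v) del) * dcrd v j.
Proof. by rewrite dcrd_drow// neuc_expand. Qed.

Lemma continuous_expand : continuous expand.
Proof.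
have c1 : continuous (fun p : I * disc k => ival p.1).
  by apply: (continuous_compT continuous_ival); exact: continuous_fst.
have c2 j : continuous (fun p : I * disc k => dcrd p.2 j).
  by apply: (continuous_compT (@continuous_dcrd R k j)); exact: continuous_snd.
apply: continuous_drow => j; apply: contM => //; apply: contD.
  by apply: contB => //; exact: cont_cst.
apply: contM => //; apply: contV => [p|]; first by rewrite gt_eqF// max_gt0.
apply: cont_max; last exact: cont_cst.
by apply: (continuous_compT (@continuous_drad R k)); exact: continuous_snd.
Qed.

Lemma expand_sphere t v : sphere k v -> expand (t, v) = v.
Proof.
move=> /sphereE v1; apply: dext => j; rewrite dcrd_expand v1.
by rewrite max_l ?divr1 ?subrK ?mul1r//; case/andP: del01.
Qed.

Lemma expand0 v : expand (I0, v) = v.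
Proof. by apply: dext => j; rewrite dcrd_expand ival0 mul0r subr0 addr0 mul1r. Qed.

Lemma expand1 v : del <= drad v -> sphere k (expand (I1, v)).
Proof.
move=> dv; apply/sphereE; rewrite /drad.
rewrite (_ : dcrd _ = (fun j => (drad v)^-1 * dcrd v j)); last first.
  by apply/funext => j; rewrite dcrd_expand ival1 subrr add0r mul1r max_l.
have v0 : 0 < drad v by apply: lt_le_trans dv; case/andP: del01.
by rewrite neucZ gtr0_norm ?invr_gt0// mulVf// gt_eqF.
Qed.
End Expand.

(** Since [n < k], a perturbation makes the cube miss the centres of the k-cells; compactness keeps
    it at radius at least some [del], and radial expansion pushes it into the lower skeleton. The
    same functions serve all cells at once, whatever their number. *)
Lemma push_off_cells (b : Q n -> X) : continuous b -> (forall z, Sk k.+1 (b z)) ->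
  exists H : I * Q n -> X, [/\ continuous H, forall z, H (I0, z) = b z,
    forall z, Sk k (H (I1, z)) & forall t z, Sk k (b z) -> H (t, z) = b z].
Proof.
move=> cb Sb.
(* Damped coordinates vanish on the spheres, so they define functions on the whole skeleton. *)
pose om j := cellwise (fun (_ : cell K k) v => damp v * dcrd v j) (fun=> 0 : R).
have om0 j (e : cell K k) v : sphere k v -> damp v * dcrd v j = 0.
  by move=> sv; rewrite damp_sphere// mul0r.
have com j : ccont (Sk k.+1) (om j).
  apply: ccont_cellfun => [|v sv]; last by rewrite damp_sphere// mul0r.
  by apply: contM; [exact: continuous_damp|exact: continuous_dcrd].
have [d [cd hd]] := @avoid_zero R n k (fun j => om j \o b) nk
  (fun j => ccont_total (com j) cb Sb).
have cd' : continuous (fun p : I * Q n => dscale p.1 (d p.2)).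
  apply: (continuous_compT continuous_dscale (f := fun p : I * Q n => (p.1, d p.2))).
  apply: continuous_pair; first exact: continuous_fst.
  by apply: (continuous_compT cd); exact: continuous_snd.
have cb2 : continuous (fun p : I * Q n => b p.2).
  by apply: (continuous_compT cb); exact: continuous_snd.
pose H1 (p : I * Q n) := cellmap shift (dscale p.1 (d p.2), b p.2).
have cH1 : continuous H1.
  apply: continuous_cellmap => //; [exact: chaus_disc|exact: continuous_shift|exact: shift_sphere].
have H1Sk t z : Sk k (b z) -> H1 (t, z) = b z by move=> Sz; rewrite /H1 cellmap_Sk.
have H10 z : H1 (I0, z) = b z.
  have [Sz|[e [v bz]]] := Sk_cases (Sb z); first exact: H1Sk.
  rewrite /H1 /= bz cellmap_cell; last exact: shift_sphere.
  by congr char_map; apply: dext => j; rewrite dcrd_shift dcrd_dscale ival0 mul0r mul0r mulr0 addr0.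
pose b' z := H1 (I1, z).
have cb' : continuous b' by apply: (continuous_compT cH1); exact: cont_pt.
have Sb' z : Sk k.+1 (b' z) by apply: cellmap_SkS => //; exact: shift_sphere.
pose nu := cellwise (fun (_ : cell K k) v => drad v) (fun=> 1 : R).
have cnu : ccont (Sk k.+1) nu.
  by apply: ccont_cellfun => [|v /sphereE//]; exact: continuous_drad.
have nu_cell (e : cell K k) v : nu (char_map e v) = drad v.
  by rewrite /nu cellwise_cell// => e' v' /sphereE.
have nu0 z : 0 < nu (b' z).
  have [Sz|[e [v bz]]] := Sk_cases (Sb z).
    by rewrite /b' H1Sk// /nu cellwise_Sk.
  have b'z : b' z = char_map e (shift (d z, v)).
    rewrite /b' /H1 /= bz cellmap_cell; last exact: shift_sphere.
    by congr (char_map e (shift (_, v))); apply: dext => j; rewrite dcrd_dscale ival1 mul1r.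
  (* A point shifted to the centre has radius at most 1/2, where the damping factor is 1; then
     [v + d / 2 = 0], which the choice of [d] excludes. *)
  rewrite b'z nu_cell lt_neqAle drad_ge0 andbT eq_sym; apply/eqP => sh0.
  have shj j : dcrd v j + damp v * (dcrd (d z) j / 2) = 0.
    by rewrite -dcrd_shift; exact: neuc_eq0.
  have v12 : drad v <= 2^-1.
    have -> : drad v = neuc (fun j => - (damp v / 2) * dcrd (d z) j).
      by rewrite /drad; congr neuc; apply/funext => j; have := shj j; lra.
    have /andP[d0 d1] := damp_itv v.
    rewrite neucZ normrN ger0_norm ?divr_ge0//.
    by have := drad_le1 (d z); have := drad_ge0 (d z); rewrite /drad; nra.
  have dv : damp v = 1 by rewrite /damp min_l//; lra.
  have [j /eqP] := hd z; apply.
  rewrite /= bz /om cellwise_cell; last exact: om0.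
  by have := shj j; rewrite dv; lra.
have cnub : continuous (fun z => (nu (b' z))^-1).
  apply: contV => [z|]; first by rewrite gt_eqF.
  exact: ccont_total cnu cb' Sb'.
have [M M0 hM] := bounded_Q cnub.
pose del := (Num.max M 1)^-1.
have M1 : 0 < Num.max M 1 by rewrite lt_max M0.
have del01 : 0 < del <= 1.
  by rewrite invr_gt0 M1 invf_le1// le_max lexx orbT.
have delnu z : del <= nu (b' z).
  rewrite /del -[leRHS]invrK lef_pV2 ?posrE ?invr_gt0//.
  by rewrite le_max (le_trans _ (hM z))// ler_norm.
pose H2 (p : I * Q n) := cellmap (expand del) (p.1, b' p.2).
have eS t v : sphere k v -> expand del (t, v) = v by exact: expand_sphere.
have cH2 : continuous H2.
  apply: continuous_cellmap => //.
  - exact: chaus_I.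
  - exact: continuous_expand.
  - exact: continuous_fst.
  - by apply: (continuous_compT cb'); exact: continuous_snd.
have H20 z : H2 (I0, z) = b' z.
  have [Sz|[e [v bz]]] := Sk_cases (Sb' z); first by rewrite /H2 cellmap_Sk.
  by rewrite /H2 /= bz cellmap_cell// expand0.
exists (concat H1 H2); split=> [|z|z|t z Sz].
- by apply: continuous_concat => // z; rewrite H20.
- by rewrite concat0.
- rewrite concat1; have [Sz|[e [v bz]]] := Sk_cases (Sb' z); first by rewrite /H2 cellmap_Sk.
  rewrite /H2 /= bz cellmap_cell//; apply: sphere_Sk; apply: expand1 => //.
  by rewrite -(nu_cell e) -bz.
- rewrite /concat; case: ifP => _ /=; first exact: H1Sk.
  by rewrite /H2 cellmap_Sk /b' H1Sk.
Qed.

End Push.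

Lemma push_to_skeleton n l i (b : Q n -> X) : (n < l)%N -> continuous b ->
  (forall z, Sk (l + i) (b z)) ->
  exists H : I * Q n -> X, [/\ continuous H, forall z, H (I0, z) = b z,
    forall z, Sk l (H (I1, z)) & forall t z, Sk l (b z) -> H (t, z) = b z].
Proof.
move=> nl; elim: i b => [|i IH] b cb Sb.
  exists (b \o snd); split=> // [|z]; last by rewrite /= -(addn0 l).
  by apply: continuous_compT => //; exact: continuous_snd.
have nli : (n < l + i)%N by apply: leq_trans nl (leq_addr _ _).
have [|H [cH H0 H1 HS]] := @push_off_cells n (l + i) nli b cb.
  by move=> z; rewrite -addnS.
have [||H' [cH' H'0 H'1 H'S]] := IH (fun z => H (I1, z)).
- by apply: (continuous_compT cH); exact: cont_pt.
- exact: H1.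
have Sl z : Sk l (b z) -> Sk (l + i) (b z) by apply: Sk_sub; exact: leq_addr.
exists (concat H H'); split=> [|z|z|t z Sz].
- by apply: continuous_concat.
- by rewrite concat0.
- by rewrite concat1.
- rewrite /concat; case: ifP => _ /=; first by rewrite HS//; exact: Sl.
  by rewrite H'S HS//; exact: Sl.
Qed.

(** The compact image lies in some skeleton and is pushed down one dimension at a time; the cells to
    be left have dimension at least [l], hence above [n]. *)
Lemma skeleton_compress n l : (n < l)%N -> compress (R := R) (@id X) (Sk l) n.
Proof.
move=> nl b a cb _ aS ab.
have bS s : bd n s -> Sk l (b s) by move=> bs; rewrite -ab//; exact: aS.
have [|k hk] := @compact_Sk R X K (b @` setT).
  by apply: continuous_compact; [exact: continuous_subspaceT|exact: (chaus_Q n).1].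
have [|H [cH H0 H1 HS]] := @push_to_skeleton n l k b nl cb.
  by move=> z; apply: (@Sk_sub _ _ K k); [exact: leq_addl|apply: hk; exists z].
exists (fun z => H (I1, z)); split=> [|z|s bs|].
- by apply: (continuous_compT cH); exact: cont_pt.
- exact: H1.
- by rewrite HS ?ab//; exact: bS.
- by apply: homotopic_rel_sym; exists H; split=> // t z /bS; exact: HS.
Qed.

Lemma skeleton_LP n l : (n < l)%N ->
  LP (R := R) (@over_map R X X id (Sk l)) setT n.
Proof.
move=> nl; apply: LP_map; last exact: skeleton_compress.
by move=> x; exact: cvg_id.
Qed.

End CellularCompression.

(** * Maps from a finite complex *)

Section DiscLifting.
Context {R : realType} {B E : topologicalType} (over : B -> E -> Prop) (U : set B).
Local Notation disc := (disc R).
Local Notation sphere := (sphere R).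

Lemma lext_disc n : LP (R := R) over U n -> lext over U (sphere n).
Proof.
exact: lext2_transfer (@continuous_disc_cube R n) (@continuous_cube_disc R n)
  (@disc_cubeK R n) (@closed_bd R n) (@cube_disc_bd R n) (@disc_cube_sphere R n).
Qed.

Lemma lext2_disc n (psi : disc n -> R) d d' : (forall i, (i <= n)%N -> LP (R := R) over U i) ->
  continuous psi -> d' < d ->
  lext2 over U (sphere n `|` [set v | psi v <= d]) (sphere n `|` [set v | psi v <= d']).
Proof.
move=> hLP cpsi dd'.
have cc : continuous (psi \o @cube_disc R n).
  by apply: (continuous_compT cpsi); exact: continuous_cube_disc.
apply: lext2_transfer (@continuous_disc_cube R n) (@continuous_cube_disc R n)
  (@disc_cubeK R n) _ _ _ (lext2_cube hLP cc dd').
- apply: closedU; first exact: closed_bd.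
  by apply: closed_lef => //; exact: cont_cst.
- by move=> s [/cube_disc_bd|]; [left|right].
- by move=> v [/disc_cube_sphere|/= pv]; [left|right; rewrite /= disc_cubeK].
Qed.

End DiscLifting.

Section FiniteComplex.
Context {R : realType} {X : topologicalType} (K : cw_complex R X).

Lemma cw_finite_chaus : cw_finite K -> chaus X.
Proof.
move=> fK; split; last exact: cw_hausdorff K.
have -> : [set: X] = \bigcup_(e in [set: {classic {n & cell K n}}])
    (char_map (projT2 e) @` setT).
  apply/seteqP; split=> // x _; have [[n e] [[v _ ex] _]] := open_cell_partition K x.
  by exists (existT _ n e) => //; exists v.
have [s sE] : exists s : seq {classic {n & cell K n}}, [set: {classic {n & cell K n}}] = [set` s].
  by apply/finite_seqP.
rewrite sE bigcup_seq; apply: bigsetU_compact => e _.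
apply: continuous_compact; first by apply: continuous_subspaceT; exact: cont_char.
exact: (chaus_disc _).1.
Qed.

Lemma Sk_dim m : cw_dim_le K m -> Sk K m.+1 = setT.
Proof.
move=> hm; apply/seteqP; split=> // x _.
have [n [l [e [v [_ ov ex]]]]] := Sk_total K x.
by exists l, e, v; split=> //; rewrite ltnS; exact: hm.
Qed.

End FiniteComplex.

(** * Neighbourhood deformations from cofibrations *)

Section Neighbourhood.
Context {R : realType}.
Local Notation I := (uitv R).

(* The universal example of the extension property is a retraction [r] onto
   [{0} * X `|` I * A]; then [D] is its second component and [phi] is one minus the
   first component of [r (1, x)]. *)
Lemma cofibration_ndr (X : topologicalType) (A : set X) :
  cofibration R (set_val : A -> X) ->
  exists (phi : X -> R) (D : I * X -> X), [/\ continuous phi, continuous D,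
    forall x, D (I0, x) = x, forall t x, A x -> D (t, x) = x
    & (forall x, A x -> phi x <= 0) /\ (forall x, phi x <= 2^-1 -> A (D (I1, x)))].
Proof.
move=> [_ hep].
pose M : set (I * X) := [set p | p.1 = I0 \/ A p.2].
have M0 x : (I0 : I, x) \in M by rewrite inE; left.
have MA (p : I * A) : (p.1, set_val p.2) \in M by rewrite inE; right; exact: (set_valP p.2).
have [|||r [cr r0 rA]] := hep (M : topologicalType) (fun x => mksub (M0 x)) (fun p => mksub (MA p)).
- by apply: continuous_into; exact: cont_pt.
- apply: continuous_into.
  apply: (@continuous_pair _ _ _ fst (set_val \o snd)); first exact: continuous_fst.
  by apply: continuous_compT; [exact: continuous_set_val|exact: continuous_snd].
- by move=> a; apply: val_inj.
pose r' p : I * X := set_val (r p).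
have cr' : continuous r' by apply: continuous_compT cr; exact: continuous_set_val.
have r'A t x : A x -> r' (t, x) = (t, x).
  by move=> Ax; have := rA t (mksub (mem_set Ax)); rewrite /r' /= => ->.
exists (fun x => 1 - ival (r' (I1, x)).1), (fun p => (r' p).2); split.
- apply: contB; first exact: cont_cst.
  apply: (continuous_compT continuous_ival).
  apply: (@continuous_compT _ _ _ fst (fun x => r' (I1, x))); first exact: continuous_fst.
  by apply: (continuous_compT cr'); exact: cont_pt.
- by apply: continuous_compT cr'; exact: continuous_snd.
- by move=> x; rewrite /r' r0.
- by move=> t x Ax; rewrite r'A.
split=> x; first by move=> Ax; rewrite r'A//= ival1 subrr.
move=> h; have [r1|//] : M (r' (I1, x)) by exact: (set_valP (r (I1, x))).
by move: h; rewrite r1 ival0; lra.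
Qed.

(** With [A] empty, statements relative to [A] become statements on free homotopies. *)
Lemma cofibration_set0 (X : topologicalType) : cofibration R (set_val : (set0 : set X) -> X).
Proof.
split; first exact: continuous_set_val.
move=> Z f h cf _ _; exists (f \o snd); split=> // [|t a].
  by apply: continuous_compT => //; exact: continuous_snd.
by have := set_valP a.
Qed.

End Neighbourhood.

Section LiftUnder.
Context {R : realType} (X : topologicalType) (K : cw_complex R X) (A : set X) (m : nat)
  (Y : topologicalType) (p : continuousType X Y).
Local Notation I := (uitv R).
Hypotheses (X0 : X) (hA : cofibration R (set_val : A -> X)) (hm : cw_dim_le K m)
  (hp : @postnikov_stage R m X Y p).

Local Notation CI := {compact-open, I -> Y}.

Lemma cont_const_path (T Z : topologicalType) (k : T -> Z) : continuous k ->
  continuous ((fun x (_ : I) => k x) : T -> {compact-open, I -> Z}).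
Proof.
move=> ck; apply: (@continuous_curry2 I T Z (k \o snd)).
by apply: continuous_compT => //; exact: continuous_snd.
Qed.

Lemma const_path_over (x : X) :
  over_map (R := R) p setT (p x) (x, (fun=> p x) : CI).
Proof. by split=> //; exact: cont_cst. Qed.

(** The induction starts from the empty skeleton with [g] given over [phi <= 1/2]; the skeleta up to
    [Sk m.+1], all of [X], share the gap down to 0. *)
Lemma lift_near (phi : X -> R) (B E : topologicalType) (over : B -> E -> Prop) (U : set B)
    (f : X -> B) (g : X -> E) :
  continuous phi -> (forall n, (n <= m)%N -> LP (R := R) over U n) ->
  continuous f -> (forall x, U (f x)) -> continuous g ->
  (forall x, phi x <= 2^-1 -> over (f x) (g x)) ->
  exists g', [/\ continuous g', forall x, over (f x) (g' x)
    & forall x, phi x <= 0 -> g' x = g x].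
Proof.
move=> cphi hLP cf fU cg og.
have hext n (e : cell K n) d d' : (0 <= n < m.+1)%N -> 0 <= d' -> d' < d -> d <= 2^-1 ->
    lext2 over U (sphere R n `|` [set v | phi (char_map e v) <= d])
                 (sphere R n `|` [set v | phi (char_map e v) <= d']).
  move=> /andP[_ nm] _ dd' _; apply: lext2_disc => //.
    by move=> i ie; apply: hLP; apply: leq_trans ie _.
  by apply: (continuous_compT cphi); exact: cont_char.
have hg : good_lift over f (Sk K 0 `|` [set x | phi x <= 2^-1]) g.
  split; last by move=> x [|/og//]; rewrite Sk0.
  apply: continuous_ccont => //; rewrite Sk0 set0U.
  by apply: closed_lef => //; exact: cont_cst.
have h2 : 0 < 2^-1 :> R by rewrite invr_gt0.
have [g' [cg' og'] g'g] := lift_skeleta cf fU cphi h2 (leq0n _) hext hg.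
exists g'; split.
- by apply/ccontT; move: cg'; rewrite (Sk_dim hm) setTU.
- by move=> x; apply: og'; left; rewrite (Sk_dim hm).
- by move=> x px; apply: g'g; right.
Qed.

Lemma deform_rel (Z : topologicalType) (D : I * X -> X) (f : X -> Z) :
  continuous D -> (forall x, D (I0, x) = x) -> (forall t x, A x -> D (t, x) = x) ->
  continuous f -> homotopic_rel R A f (fun x => f (D (I1, x))).
Proof.
move=> cD D0 DA cf; exists (f \o D); split=> [|x|//|t x Ax] /=.
- exact: continuous_compT.
- by rewrite D0.
- by rewrite DA.
Qed.

(* Replace [f] by [f \o D (1, _)], which lifts strictly near [A]. *)
Lemma lift_under (f : X -> Y) : continuous f -> (forall x, A x -> f x = p x) ->
  exists a : X -> X, [/\ continuous a, forall x, A x -> a x = x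
    & homotopic_rel R A (p \o a) f].
Proof.
move=> cf fA; have [phi [D [cphi cD D0 DA [phiA phiD]]]] := cofibration_ndr hA.
pose D1 x := D (I1, x).
have cD1 : continuous D1 by apply: (continuous_compT cD); exact: cont_pt.
have cp : continuous p by exact: cts_fun.
have [|||||g' [cg' og' g'g]] := @lift_near phi Y _ (over_map (R := R) p setT) setT
    (f \o D1) (fun x => (D1 x, (fun _ : I => p (D1 x)) : CI)) cphi.
- by move=> n nm; apply: (postnikov_LP X0 hp); exact: leqW.
- exact: continuous_compT.
- by [].
- apply: continuous_pair => //; apply: cont_const_path; exact: continuous_compT.
- by move=> x /phiD AD; rewrite /= fA//; exact: const_path_over.
exists (fun x => (g' x).1); split.
- by apply: continuous_compT cg'; exact: continuous_fst.
- by move=> x Ax; rewrite g'g ?phiA//= /D1 DA.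
apply: homotopic_rel_trans (homotopic_rel_sym (deform_rel cD D0 DA cf)).
exists (fun q => ((g' q.2).2 : I -> Y) q.1); split.
- apply: (@continuous_uncurry2 I X Y (snd \o g')).
  + exact: chaus_I.
  + by apply: continuous_compT cg'; exact: continuous_snd.
  + by move=> x; have [] := og' x.
- by move=> x /=; have [] := og' x.
- by move=> x /=; have [] := og' x.
- by move=> t x Ax /=; rewrite g'g ?phiA.
Qed.

(** The argument of [lift_under] for paths of lifts: near [A] the two deformed maps agree and the
    homotopy is stationary, so a constant path lifts it. *)
Lemma homotopy_lift_under (g0 g1 : X -> X) : continuous g0 -> continuous g1 ->
  (forall x, A x -> g0 x = g1 x) ->
  homotopic_rel R A (p \o g0) (p \o g1) -> homotopic_rel R A g0 g1.
Proof.
move=> cg0 cg1 g01 [ka [cka ka0 ka1 kaA]].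
have [phi [D [cphi cD D0 DA [phiA phiD]]]] := cofibration_ndr hA.
pose D1 x := D (I1, x).
have cD1 : continuous D1 by apply: (continuous_compT cD); exact: cont_pt.
have cp : continuous p by exact: cts_fun.
pose cpath (x : X) : X * CI := (x, (fun=> p x)).
have ccpath : continuous cpath.
  by apply: continuous_pair; [move=> x; exact: cvg_id|exact: cont_const_path].
pose over := over_path (R := R) (over_map (R := R) p setT).
have [|||||g' [cg' og' g'g]] := @lift_near phi _ _ over (path_ok (R := R) (over_map (R := R) p setT))
    (fun x => ((fun t => ka (t, D1 x)) : CI, (cpath (g0 (D1 x)), cpath (g1 (D1 x)))))
    (fun x (_ : I) => cpath (g0 (D1 x))) cphi.
(* Paths of lifts over cells of dimension up to [m] use the lifting property of [p] up to [m.+1]. *)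
- by move=> n nm; apply: LP_path; apply: (postnikov_LP X0 hp).
- apply: continuous_pair.
    apply: (@continuous_curry2 I X Y (fun q => ka (q.1, D1 q.2))).
    apply: (@continuous_compT _ _ _ ka (fun q : I * X => (q.1, D1 q.2))) => //.
    apply: continuous_pair; first exact: continuous_fst.
    by apply: (continuous_compT cD1); exact: continuous_snd.
  by apply: continuous_pair; apply: (continuous_compT ccpath); exact: continuous_compT.
- move=> x; split=> /=.
  + apply: (@continuous_compT _ _ _ ka (fun t : I => (t, D1 x))) => //.
    by apply: continuous_pair; [move=> t; exact: cvg_id|exact: cont_cst].
  + by rewrite ka0; exact: const_path_over.
  + by rewrite ka1; exact: const_path_over.
- apply: cont_const_path; apply: (continuous_compT ccpath); exact: continuous_compT.
- move=> x /phiD AD; split=> //=; first exact: cont_cst.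
  + by move=> t; rewrite kaA//; exact: const_path_over.
  + by rewrite g01.
apply: homotopic_rel_trans (deform_rel cD D0 DA cg0) _.
apply: homotopic_rel_trans (homotopic_rel_sym (deform_rel cD D0 DA cg1)).
exists (fun q => ((g' q.2 : I -> X * CI) q.1).1); split.
- apply: (@continuous_compT _ _ _ fst (fun q => (g' q.2 : I -> X * CI) q.1)).
    exact: continuous_fst.
  apply: (@continuous_uncurry2 I X _ g') => //; first exact: chaus_I.
  by move=> x; have [] := og' x.
- by move=> x /=; have [_ _ ->] := og' x.
- by move=> x /=; have [_ _ _ ->] := og' x.
- by move=> t x Ax /=; rewrite g'g ?phiA.
Qed.

End LiftUnder.

(** * Maps into a space without higher homotopy *)

Section TruncatedTarget.
Context {R : realType} {C : topologicalType} (K : cw_complex R C) (k : nat)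
  (Y : topologicalType).
Local Notation I := (uitv R).
Hypothesis hY : forall n, (k <= n.+1)%N -> pin_trivial (R := R) n Y.

(** A cell of dimension at least [k] is attached along a sphere of dimension at least [k - 1], where
    [Y] has no homotopy; [0 < k] excludes 0-cells, for which a point of [Y] would have to be
    supplied. *)
Lemma truncated_extend (g : C -> Y) : (0 < k)%N -> ccont (Sk K k) g ->
  exists2 F : C -> Y, continuous F & forall x, Sk K k x -> F x = g x.
Proof.
move=> k0 cg.
have [||||F [cF _ Fg]] := @lift_total R C K R Y (@over_triv R Y) setT (fun=> 0) _ _ k g.
- exact: cont_cst.
- by [].
- move=> n _ kn; apply: lext_disc; case: n kn => [|n] kn.
    by have := leq_trans k0 kn.
  by apply: LP_triv; exact: hY.
- by split.
by exists F.
Qed.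

(** A homotopy is a path of unconditional lifts over a dummy path [b]; over an n-cell it is
    obstructed in [pin] of degree [n], trivial for [n >= k]. *)
Lemma truncated_extend_homotopy (F0 F1 : C -> Y) (G : I * C -> Y) :
  continuous F0 -> continuous F1 -> ccont (snd @^-1` Sk K k) G ->
  (forall x, Sk K k x -> G (I0, x) = F0 x) ->
  (forall x, Sk K k x -> G (I1, x) = F1 x) ->
  exists H : I * C -> Y, [/\ continuous H, forall x, H (I0, x) = F0 x,
    forall x, H (I1, x) = F1 x & forall t x, Sk K k x -> H (t, x) = G (t, x)].
Proof.
move=> cF0 cF1 cG G0 G1.
pose b : {compact-open, I -> R} := fun=> 0.
have [||||H [cH oH HG]] := @lift_total R C K _ _ (over_path (R := R) (@over_triv R Y))
   (path_ok (R := R) (@over_triv R Y)) (fun x => (b, (F0 x, F1 x))) _ _ k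
   (fun x => (fun t => G (t, x)) : {compact-open, I -> Y}).
- by apply: continuous_pair; [exact: cont_cst|exact: continuous_pair].
- by move=> x; split=> //; exact: cont_cst.
- move=> n _ kn; apply: lext_disc; apply: LP_path; apply: LP_triv; apply: hY.
  exact: leqW.
- split; first by apply: ccont_curry => //; exact: closed_Sk.
  move=> x Sx; split=> //=; [|exact: G0|exact: G1].
  apply/ccontT; apply: (ccont_comp cG (u := fun t : I => (t, x))) => //.
  apply/ccontT; apply: continuous_pair; [move=> t; exact: cvg_id|exact: cont_cst].
exists (fun q => (H q.2 : I -> Y) q.1); split.
- apply: (@continuous_uncurry2 I C Y H) => //; first exact: chaus_I.
  by move=> x; have [] := oH x.
- by move=> x; have [] := oH x.
- by move=> x; have [] := oH x.
- by move=> t x Sx /=; rewrite HG.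
Qed.

End TruncatedTarget.

(** * Maps from a Postnikov stage *)

Section ExtendAlong.
Context {R : realType} (X : topologicalType) (K : cw_complex R X) (m : nat)
  (Y : topologicalType) (p : continuousType X Y).
Local Notation I := (uitv R).
Hypotheses (X0 : X) (hm : cw_dim_le K m) (hp : @postnikov_stage R m X Y p)
  (hcp : cofibration R p) (hY : cw_homotopy_type R Y).

(* [p] looks like the inclusion of the (m+1)-skeleton: up to homotopy [Y] is a
   complex [C] whose skeleton [S] maps to [X], compatibly with [p]. *)
Lemma skeletal_model : exists (C : topologicalType) (L : cw_complex R C)
    (g : C -> X) (Phi : C -> Y) (Psi : Y -> C),
  [/\ ccont (Sk L m.+2) g, continuous Phi /\ continuous Psi,
      forall c, Sk L m.+2 c -> Phi c = p (g c),
      forall x, Sk L m.+2 (Psi (p x)) & homotopic R (Phi \o Psi) id].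
Proof.
have cp : continuous p by exact: cts_fun.
have [C [L [psi [cpsi [phi [cphi phipsi _]]]]]] := hY.
have tY n : (m.+2 <= n.+1)%N -> pin_trivial (R := R) n Y.
  by move=> mn; apply: (postnikov_trivial hp).
(* Over cells of dimension at most [m.+1], [phi] lifts through [p] up to homotopy; [e] consists of
   the lift and the homotopy. *)
have [|||e [ce oe] _] := @lift_skeleta0 R C L Y _ (over_map (R := R) p setT) setT phi cphi _
    0 m.+2 (fun=> (X0, fun=> p X0)) (leq0n _).
- by [].
- by move=> n _ /andP[_ nm]; apply: lext_disc; exact: (postnikov_LP X0 hp).
- by split; rewrite Sk0// => W _; rewrite set0I; exact: closed0.
have cg : ccont (Sk L m.+2) (fst \o e).
  by apply: ccont_compT ce; exact: continuous_fst.
(* [phi] is replaced by an extension [F] of the strict composite through [X]; the homotopy on the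
   skeleton extends to one from [F] to [phi]. *)
have [F cF Fg] := truncated_extend tY (ltn0Sn _) (ccont_compT cp cg).
have [|||||G [cG G0 G1 _]] := @truncated_extend_homotopy R C L m.+2 Y tY F phi
    (fun q => ((e q.2).2 : I -> Y) q.1) => //.
- apply: (@ccont_uncurry I C Y _ (snd \o e)).
  + exact: chaus_I.
  + by apply: ccont_compT ce; exact: continuous_snd.
  + by move=> x /oe [].
- by move=> x Sx; rewrite Fg//=; have [_ _ -> _] := oe _ Sx.
- by move=> x Sx /=; have [] := oe _ Sx.
(* The cells of [X] have dimension at most [m], so [psi \o p] can be moved into the skeleton. *)
have [||||d [cd od] _] := @lift_skeleta0 R X K C _ (over_map (R := R) id (Sk L m.+2)) setT
    (psi \o p) _ _ 0 m.+1 (fun x => (psi (p x), fun=> psi (p x))) (leq0n _).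
- exact: continuous_compT.
- by [].
- move=> n _ /andP[_ nm]; apply: lext_disc; apply: skeleton_LP; exact: leqW.
- by split; rewrite Sk0// => W _; rewrite set0I; exact: closed0.
rewrite (Sk_dim hm) in cd od; move/ccontT in cd.
have od' x := od x Logic.I.
have cH : continuous (fun q : I * X => ((d q.2).2 : I -> C) (iflip q.1)).
  apply: (@continuous_compT _ _ _ (fun q : I * X => ((d q.2).2 : I -> C) q.1)
     (fun q : I * X => (iflip q.1, q.2))).
    apply: (@continuous_uncurry2 I X C (snd \o d)); first exact: chaus_I.
      by apply: continuous_compT cd; exact: continuous_snd.
    by move=> x; have [] := od' x.
  apply: continuous_pair; last exact: continuous_snd.
  by apply: (continuous_compT continuous_iflip); exact: continuous_fst.
(* This motion extends from [X] to [Y], starting at [psi]; its end is the required [Psi]. *)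
have [_ /(_ C psi _ cpsi cH)[]] := hcp.
  by move=> x /=; rewrite iflip0; have [_ _ _] := od' x.
move=> N [cN N0 NA].
have cPsi : continuous (fun y => N (I1, y)) by apply: (continuous_compT cN); exact: cont_pt.
have NS x : Sk L m.+2 (N (I1, p x)).
  by rewrite NA iflip1; have [Sd _ -> _] := od' x.
exists C, L, (fst \o e), F, (fun y => N (I1, y)); split=> //.
apply: homotopic_rel_trans _ phipsi.
apply: (@homotopic_rel_trans _ _ _ _ _ (F \o psi)).
  by apply: homotopic_rel_compl => //; apply: homotopic_rel_sym; exists N; split.
by apply: (@homotopic_compr _ _ _ _ F phi psi) => //; exists G; split.
Qed.

(** The two maps become homotopic after [p] because [Phi \o Psi] is homotopic to the identity; lifts
    through [p] are unique up to homotopy. *)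
Lemma skeletal_id (C : topologicalType) (L : cw_complex R C)
    (g : C -> X) (Phi : C -> Y) (Psi : Y -> C) :
  ccont (Sk L m.+2) g -> continuous Psi ->
  (forall c, Sk L m.+2 c -> Phi c = p (g c)) ->
  (forall x, Sk L m.+2 (Psi (p x))) -> homotopic R (Phi \o Psi) id ->
  homotopic R (fun x => g (Psi (p x))) id.
Proof.
move=> cg cPsi Phig PsiS PP; have cp : continuous p by exact: cts_fun.
have cgp : continuous (fun x => g (Psi (p x))).
  by apply: (ccont_total cg (u := Psi \o p)) => //; exact: continuous_compT.
have := @homotopy_lift_under R X K set0 m Y p X0 (cofibration_set0 _) hm hp.
apply => //; first by move=> x; exact: cvg_id.
have -> : p \o (fun x => g (Psi (p x))) = (Phi \o Psi) \o p.
  by apply/funext => x /=; rewrite Phig.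
exact: (@homotopic_compr R X Y Y (Phi \o Psi) id p).
Qed.

Lemma truncated_Y n : (m.+2 <= n.+1)%N -> pin_trivial (R := R) n Y.
Proof. by move=> mn; apply: (postnikov_trivial hp). Qed.

Lemma homotopic_extend (F : Y -> Y) (f : X -> Y) : continuous F ->
  homotopic R (F \o p) f -> exists G : I * Y -> Y, [/\ continuous G,
    forall y, G (I0, y) = F y & forall x, G (I1, p x) = f x].
Proof.
move=> cF [H [cH H0 H1 _]]; have [_ /(_ Y F H cF cH)[|G [cG G0 GA]]] := hcp.
  by move=> x; rewrite H0.
by exists G; split=> // x; rewrite GA H1.
Qed.

(** Extend [f \o g] from the skeleton over [C] and precompose with [Psi]. Along [p] this is
    [f \o g \o Psi \o p], homotopic to [f] by [skeletal_id]; homotopy extension makes it equal to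
    [f]. *)
Lemma extend_along (f : X -> Y) : continuous f ->
  exists F : Y -> Y, continuous F /\ forall x, F (p x) = f x.
Proof.
move=> cf; have [C [L [g [Phi [Psi [cg [cPhi cPsi] Phig PsiS PP]]]]]] := skeletal_model.
have [F cF Ff] := truncated_extend truncated_Y (ltn0Sn _) (ccont_compT cf cg).
have cFP : continuous (F \o Psi) by exact: continuous_compT.
have [|G [cG G0 G1]] := @homotopic_extend (F \o Psi) f cFP.
  have -> : (F \o Psi) \o p = f \o (fun x => g (Psi (p x))).
    by apply/funext => x /=; rewrite Ff.
  exact: (@homotopic_compl R X X Y _ id f cf (skeletal_id cg cPsi Phig PsiS PP)).
exists (fun y => G (I1, y)); split=> //.
by apply: (continuous_compT cG); exact: cont_pt.
Qed.

(* [Phi \o Psi] factors maps out of [Y] through a complex with cells attached to the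
   skeleton in dimensions where [Y] has no homotopy; [R'] is a version of it under
   [X], hence invertible under [X]. *)
Lemma extension_unique (F0 F1 : Y -> Y) : continuous F0 -> continuous F1 ->
  (forall x, F0 (p x) = F1 (p x)) -> homotopic_rel R (range p) F0 F1.
Proof.
move=> cF0 cF1 F01; have cp : continuous p by exact: cts_fun.
have [C [L [g [Phi [Psi [cg [cPhi cPsi] Phig PsiS PP]]]]]] := skeletal_model.
have [|||||G [cG G0 G1 GS]] := @truncated_extend_homotopy R C L m.+2 Y truncated_Y
    (F0 \o Phi) (F1 \o Phi) (F0 \o Phi \o snd).
- exact: continuous_compT.
- exact: continuous_compT.
- apply: continuous_ccont; last by apply: closed_snd_preim; exact: closed_Sk.
  apply: continuous_compT; last exact: continuous_snd.
  exact: continuous_compT.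
- by [].
- by move=> c Sc /=; rewrite Phig// F01.
pose c x := g (Psi (p x)).
have cid : homotopic R c id := skeletal_id cg cPsi Phig PsiS PP.
have cRr : continuous (Phi \o Psi) by exact: continuous_compT.
have [mu [cmu mu0 mu1 _]] := cid.
have cpmu : continuous (p \o mu) by exact: continuous_compT.
(* [N] moves [Phi \o Psi] to a map that fixes the image of [p]. *)
have [|N [cN N0 NA]] := hcp.2 Y (Phi \o Psi) (p \o mu) cRr cpmu.
  by move=> x /=; rewrite mu0 Phig.
have cFN (F : Y -> Y) : continuous F -> continuous (F \o N) by move=> cF; exact: continuous_compT.
(* [G] composed with [Psi] joins the two maps precomposed with [Phi \o Psi] and is stationary on the
   image of [p], which [Psi] sends into the skeleton; transport along [N] replaces [Phi \o Psi] by
   the end of [N]. *)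
have h1 : homotopic_rel R (range p) (F0 \o (fun y => N (I1, y))) (F1 \o (fun y => N (I1, y))).
  apply: (@homotopic_rel_transport R X Y Y p (F0 \o N) (F1 \o N) hcp (cFN _ cF0) (cFN _ cF1)).
    by move=> t x /=; rewrite NA/= F01.
  exists (fun q => G (q.1, Psi q.2)); split.
  - apply: (@continuous_compT _ _ _ G (fun q : I * Y => (q.1, Psi q.2))) => //.
    apply: continuous_pair; first exact: continuous_fst.
    by apply: (continuous_compT cPsi); exact: continuous_snd.
  - by move=> y /=; rewrite G0 N0.
  - by move=> y /=; rewrite G1 N0.
  - by move=> t _ [x _ <-] /=; rewrite GS// N0.
pose R' y := N (I1, y).
have cR' : continuous R' by apply: (continuous_compT cN); exact: cont_pt.
have R'p x : R' (p x) = p x by rewrite /R' NA /= mu1.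
have hR' : homotopy_equivalence R R'.
  apply: (@homotopy_equivalence_homotopic R Y Y id R') => //; last exact: homotopy_equivalence_id.
  apply: homotopic_rel_trans (homotopic_rel_sym PP) _.
  by exists N; split.
have [u [[cu _] up _ R'u]] := under_inverse hcp hR' R'p.
have keep w : range p w -> range p (u w) by move=> [x _ <-]; exists x; rewrite ?up.
have e (F : Y -> Y) : continuous F -> homotopic_rel R (range p) F (F \o R' \o u).
  by move=> cF; apply: homotopic_rel_sym; exact: (@homotopic_rel_compl R Y Y Y (range p) (R' \o u) id F).
apply: homotopic_rel_trans (e F0 cF0) _.
apply: homotopic_rel_trans (homotopic_rel_sym (e F1 cF1)).
exact: homotopic_rel_compr h1.
Qed.

(** The homotopy is extended from [X] to [Y], starting at [F0]; its end agrees strictly with [F1] on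
    the image of [p]. *)
Lemma extension_unique_rel (A : set X) (F0 F1 : Y -> Y) : continuous F0 -> continuous F1 ->
  homotopic_rel R A (F0 \o p) (F1 \o p) -> homotopic_rel R (p @` A) F0 F1.
Proof.
move=> cF0 cF1 [H [cH H0 H1 HA]].
have [|G [cG G0 GA]] := hcp.2 Y F0 H cF0 cH; first by move=> x; rewrite H0.
apply: (@homotopic_rel_trans _ _ _ _ _ (fun y => G (I1, y))).
  exists G; split=> // t _ [x Ax <-]; by rewrite GA HA.
apply: (@homotopic_rel_sub R Y Y (range p)) => [_ [x _ <-]|]; first by exists x.
apply: extension_unique => // [|x]; last by rewrite GA H1.
by apply: (continuous_compT cG); exact: cont_pt.
Qed.

End ExtendAlong.

(** * Components of the monoids of equivalences *)

Section AutComponents.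
Context {R : realType} (A Y : topologicalType) (i : A -> Y).
Local Notation I := (uitv R).

(** Each stage of the homotopy is joined to [f] by the initial part of it, hence is itself an
    equivalence. *)
Lemma joined_of_homotopic (f g : aut R i) :
  homotopic_rel R (range i) (aut_fun f) (aut_fun g) -> joined R f g.
Proof.
move=> [H [cH H0 H1 HA]].
have [hf fi] := aut_funP f.
have ct t : continuous (fun y => H (t, y)) by apply: (continuous_compT cH); exact: cont_pt.
have autH t : ((fun y => H (t, y)) : {compact-open, Y -> Y}) \in aut_set R i.
  rewrite inE; split; last by move=> a; rewrite HA ?fi//; exists a.
  apply: homotopy_equivalence_homotopic hf => //.
  exists (fun q => H (toI (ival q.1 * ival t), q.2)); split=> //.
  - apply: (@continuous_compT _ _ _ H (fun q : I * Y => (toI (ival q.1 * ival t), q.2))) => //.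
    apply: continuous_pair; last exact: continuous_snd.
    apply: cont_toI; apply: contM; last exact: cont_cst.
    by apply: (continuous_compT continuous_ival); exact: continuous_fst.
  - by move=> y /=; rewrite ival0 mul0r toI0.
  - by move=> y /=; rewrite ival1 mul1r toI_ival.
exists (fun t => mksub (autH t)); split.
- apply: continuous_into.
  apply: (@continuous_curry2 Y I Y (fun q => H (q.2, q.1))).
  apply: (@continuous_compT _ _ _ H (fun q : Y * I => (q.2, q.1))) => //.
  by apply: continuous_pair; [exact: continuous_snd|exact: continuous_fst].
- by apply: aut_ext; apply/funext => y; exact: H0.
- by apply: aut_ext; apply/funext => y; exact: H1.
Qed.

(* The exponential law needs a compact source, hence the restriction along [q]. *)
Lemma homotopic_of_joined (X : topologicalType) (q : X -> Y) (C : set X) (f g : aut R i) :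
  chaus X -> continuous q -> (forall x, C x -> range i (q x)) -> joined R f g ->
  homotopic_rel R C (aut_fun f \o q) (aut_fun g \o q).
Proof.
move=> cX cq qC [ga [cga g0 g1]].
exists (fun z => aut_fun (ga z.1) (q z.2)); split.
- have cG : continuous (fun z : X * I => (aut_fun (ga z.2) \o q) z.1).
    apply: (@continuous_uncurry2 X I Y (fun t => aut_fun (ga t) \o q)) => //.
      apply: (@continuous_compT _ _ _ ((fun f => f \o q) : {compact-open, Y -> Y} -> {compact-open, X -> Y})
        (fun t => aut_fun (ga t))); first exact: continuous_precomp.
      by apply: (continuous_compT (@continuous_aut_fun R A Y i)).
    by move=> t; apply: continuous_compT => //; exact: aut_fun_continuous.
  apply: (@continuous_compT _ _ _ (fun z : X * I => (aut_fun (ga z.2) \o q) z.1)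
    (fun z : I * X => (z.2, z.1))) => //.
  by apply: continuous_pair; [exact: continuous_snd|exact: continuous_fst].
- by move=> x /=; rewrite g0.
- by move=> x /=; rewrite g1.
- move=> t x /qC [a _ qa] /=; rewrite -qa.
  by have [_ ->] := aut_funP (ga t); have [_ ->] := aut_funP f.
Qed.

Lemma pi0_aut_group : cofibration R i -> is_group (pi0_aut R i).
Proof.
move=> hi c; have [hf fi] := aut_funP (repr c).
have [g [hg gi gf fg]] := under_inverse hi hf fi.
have gP : (g : {compact-open, Y -> Y}) \in aut_set R i by rewrite inE.
pose g' : aut R i := mksub gP.
exists (pi0_class g'); rewrite -(pi0_classK c).
split; rewrite -[LHS]/(pi0_aut_mul _ _) pi0_aut_mulE; apply/pi0_classP;
  exact: joined_of_homotopic.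
Qed.

End AutComponents.

Lemma cofibration_comp (R : realType) (A X Y : topologicalType) (i : A -> X) (p : X -> Y) :
  cofibration R i -> cofibration R p -> cofibration R (p \o i).
Proof.
move=> [ci hi] [cp hp]; split; first exact: continuous_compT.
move=> Z f h cf ch hf.
have [|H [cH H0 HA]] := hi Z (f \o p) h (continuous_compT cf cp) ch; first by [].
have [|G [cG G0 GA]] := hp Z f H cf cH; first by move=> x; rewrite H0.
by exists G; split=> // t a /=; rewrite GA HA.
Qed.

(** * Comparison of the two groups *)

Section Comparison.
Context (R : realType) (X : topologicalType) (K : cw_complex R X)
    (A : set X) (m : nat) (Y : topologicalType) (p : continuousType X Y).
Hypotheses (X0 : X) (fK : cw_finite K) (hA : cofibration R (set_val : A -> X))
  (hm : cw_dim_le K m) (hY : cw_homotopy_type R Y)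
  (hp : @postnikov_stage R m X Y p) (hcp : cofibration R p).

Local Notation iX := (set_val : A -> X).
Local Notation iY := (p \o (set_val : A -> X)).

Definition related (F : Y -> Y) (a : X -> X) := homotopic_rel R A (F \o p) (p \o a).

Let cp : continuous p. Proof. exact: cts_fun. Qed.

Lemma range_iX : range iX = A.
Proof.
apply/seteqP; split=> x; first by move=> [a _ <-]; exact: (set_valP a).
by move=> Ax; exists (mksub (mem_set Ax)).
Qed.

Lemma range_iY : range iY = p @` A.
Proof. by rewrite -[in RHS]range_iX image_comp. Qed.

Lemma related_id : related id id.
Proof. exact: homotopic_rel_refl. Qed.

(** [F F' p ~ F p a' ~ p a a']; the second homotopy is relative to [A] because [a'] fixes [A]. *)
Lemma related_comp (F F' : Y -> Y) (a a' : X -> X) : continuous F -> continuous a' ->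
  (forall x, A x -> a' x = x) -> related F a -> related F' a' ->
  related (F \o F') (a \o a').
Proof.
move=> cF ca' a'A Fa F'a'.
apply: (@homotopic_rel_trans _ _ _ _ _ (F \o (p \o a'))).
  exact: (@homotopic_rel_compl R X Y Y A (F' \o p) (p \o a') F).
apply: (@homotopic_rel_compr R X X Y A A (F \o p) (p \o a) a') => // x Ax.
by rewrite a'A.
Qed.

Lemma related_down (F F' : Y -> Y) (a a' : X -> X) : continuous a -> continuous a' ->
  (forall x, A x -> a x = a' x) -> related F a -> related F' a' ->
  homotopic_rel R A (F \o p) (F' \o p) -> homotopic_rel R A a a'.
Proof.
move=> ca ca' aa' Fa F'a' FF'.
apply: (homotopy_lift_under X0 hA hm hp) => //.
apply: homotopic_rel_trans (homotopic_rel_sym Fa) _.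
exact: homotopic_rel_trans FF' F'a'.
Qed.

Lemma related_up (F F' : Y -> Y) (a a' : X -> X) : continuous F -> continuous F' ->
  related F a -> related F' a' -> homotopic_rel R A a a' ->
  homotopic_rel R (range iY) F F'.
Proof.
move=> cF cF' Fa F'a' aa'; rewrite range_iY.
apply: (extension_unique_rel X0 hm hp hcp hY) => //.
apply: homotopic_rel_trans Fa _; apply: homotopic_rel_trans (homotopic_rel_sym F'a').
exact: homotopic_rel_compl.
Qed.

Lemma fixes_iX (a : X -> X) : (forall x, A x -> a x = x) <-> (forall b, a (iX b) = iX b).
Proof.
split=> h; first by move=> b; apply: h; exact: (set_valP b).
by move=> x Ax; exact: (h (mksub (mem_set Ax))).
Qed.

Lemma fixes_iY (F : Y -> Y) : (forall b, F (iY b) = iY b) -> forall x, A x -> F (p x) = p x.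
Proof. by move=> h x Ax; exact: (h (mksub (mem_set Ax))). Qed.

(** An inverse [F'] under [A] is lifted too; the composites of the two lifts are related to maps
    homotopic to the identity, so uniqueness of lifts makes the lifts inverse to each other. *)
Lemma related_of_aut_stage (F : aut R iY) : exists a : aut R iX, related (aut_fun F) (aut_fun a).
Proof.
have [hF Fi] := aut_funP F; have [cF _] := hF.
have [F' [[cF' _] F'i F'F FF']] := under_inverse (cofibration_comp hA hcp) hF Fi.
have low (G : Y -> Y) : continuous G -> (forall b, G (iY b) = iY b) ->
    exists a : X -> X, [/\ continuous a, forall x, A x -> a x = x & related G a].
  move=> cG Gi.
  have [||a [ca aA pa]] := @lift_under R X K A m Y p X0 hA hm hp (G \o p).
  - exact: continuous_compT.
  - exact: fixes_iY Gi.
  by exists a; split=> //; exact: homotopic_rel_sym.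
have [a [ca aA Fa]] := low _ cF Fi.
have [a' [ca' a'A F'a']] := low _ cF' F'i.
have inv (G G' : Y -> Y) (b b' : X -> X) : continuous G -> continuous b -> continuous b' ->
    (forall x, A x -> b x = x) -> (forall x, A x -> b' x = x) -> related G b -> related G' b' ->
    homotopic_rel R (range iY) (G \o G') id -> homotopic_rel R A (b \o b') id.
  move=> cG cb cb' bA b'A Gb G'b' GG'.
  apply: (related_down _ _ _ (related_comp cG cb' b'A Gb G'b') related_id).
  - exact: continuous_compT.
  - by move=> x; exact: cvg_id.
  - by move=> x Ax /=; rewrite b'A ?bA.
  - apply: (@homotopic_rel_compr R X Y Y A (range iY) (G \o G') id p) => // x Ax.
    by rewrite range_iY; exists x.
have ha : homotopy_equivalence R a.
  split=> //; exists a'; split=> //; apply: homotopic_of_rel.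
  - exact: (inv F' (aut_fun F)) F'F.
  - exact: (inv (aut_fun F) F') FF'.
have aP : (a : {compact-open, X -> X}) \in aut_set R iX.
  by rewrite inE; split=> //; apply/fixes_iX.
by exists (mksub aP).
Qed.

(** An inverse of [a] under [A] is extended too, and uniqueness of extensions makes the two
    extensions inverse to each other. *)
Lemma related_of_aut (a : aut R iX) : exists F : aut R iY, related (aut_fun F) (aut_fun a).
Proof.
have [ha ai] := aut_funP a; have [ca _] := ha.
have [a' [[ca' _] a'i a'a aa']] := under_inverse hA ha ai.
have up (b : X -> X) : continuous b -> (forall c, b (iX c) = iX c) ->
    exists G : Y -> Y, [/\ continuous G, forall c, G (iY c) = iY c & related G b].
  move=> cb bi; have [|G [cG Gp]] := @extend_along R X K m Y p X0 hm hp hcp hY (p \o b).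
    exact: continuous_compT.
  exists G; split=> // [c|]; first by rewrite /= Gp /= bi.
  rewrite /related (_ : G \o p = p \o b); last by apply/funext => x; exact: Gp.
  by apply: homotopic_rel_refl; exact: continuous_compT.
have [F [cF Fi Fa]] := up _ ca ai.
have [F' [cF' F'i F'a']] := up _ ca' a'i.
rewrite range_iX in a'a aa'.
have inv (G G' : Y -> Y) (b b' : X -> X) : continuous G -> continuous G' -> continuous b' ->
    (forall x, A x -> b' x = x) -> related G b -> related G' b' ->
    homotopic_rel R A (b \o b') id -> homotopic_rel R (range iY) (G \o G') id.
  move=> cG cG' cb' b'A Gb G'b'.
  apply: (related_up _ _ (related_comp cG cb' b'A Gb G'b') related_id).
  - exact: continuous_compT.
  - by move=> x; exact: cvg_id.
have hF : homotopy_equivalence R F.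
  split=> //; exists F'; split=> //; apply: homotopic_of_rel.
  - by apply: (inv F' F a' (aut_fun a)) => //; apply/fixes_iX.
  - by apply: (inv F F' (aut_fun a) a') => //; apply/fixes_iX.
have FP : (F : {compact-open, Y -> Y}) \in aut_set R iY by rewrite inE.
by exists (mksub FP).
Qed.

Lemma related_joined (F F' : aut R iY) (a a' : aut R iX) :
  related (aut_fun F) (aut_fun a) -> related (aut_fun F') (aut_fun a') ->
  joined R F F' <-> joined R a a'.
Proof.
move=> Fa F'a'; have cX := cw_finite_chaus fK; split=> h.
- apply: joined_of_homotopic; rewrite range_iX.
  apply: (related_down _ _ _ Fa F'a'); try exact: aut_fun_continuous.
    move=> x Ax; have [_ ai] := aut_funP a; have [_ a'i] := aut_funP a'.
    by rewrite (fixes_iX (aut_fun a)).2// (fixes_iX (aut_fun a')).2.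
  apply: homotopic_of_joined => // x Ax.
  by rewrite range_iY; exists x.
- apply: joined_of_homotopic; apply: (related_up _ _ Fa F'a'); try exact: aut_fun_continuous.
  have := @homotopic_of_joined R A X iX X id A a a' cX; apply=> //.
    by move=> x; exact: cvg_id.
  by move=> x; rewrite range_iX.
Qed.

Lemma pi0_aut_isomorphic : group_isomorphic (pi0_aut R iY) (pi0_aut R iX).
Proof.
split; [exact/pi0_aut_group/cofibration_comp|exact: pi0_aut_group|].
have /choice[down hdown] := related_of_aut_stage.
have /choice[up hup] := related_of_aut.
pose f (c : pi0_aut R iY) : pi0_aut R iX := pi0_class (down (repr c)).
(* Any related pair computes [f], whichever representatives were chosen; multiplicativity and
   bijectivity reduce to exhibiting related pairs. *)
have fE F a : related (aut_fun F) (aut_fun a) -> f (pi0_class F) = pi0_class a.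
  move=> Fa; apply/pi0_classP; apply/(related_joined (hdown _) Fa)/pi0_classP.
  exact: pi0_classK.
exists f; split.
  move=> c d; rewrite -(pi0_classK c) -(pi0_classK d).
  set F := repr c; set G := repr d.
  rewrite (fE _ _ (hdown F)) (fE _ _ (hdown G)).
  rewrite -[(pi0_class F * _)%g]/(pi0_aut_mul _ _) -[RHS]/(pi0_aut_mul _ _) !pi0_aut_mulE.
  apply: fE; apply: related_comp => //; try exact: aut_fun_continuous.
  by apply/fixes_iX; have [] := aut_funP (down G).
exists (fun c => pi0_class (up (repr c))).
  move=> c; rewrite -(pi0_classK c) (fE _ _ (hdown _)); apply/pi0_classP.
  apply/(related_joined (hup _) (hdown _))/pi0_classP; exact: pi0_classK.
by move=> c; rewrite (fE _ _ (hup _)) pi0_classK.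
Qed.

End Comparison.

(** Homotopy groups fix the stage only up to weak equivalence; [cw_homotopy_type] selects the
    homotopy type in which maps out of it are controlled by cells. *)
Theorem lemma1p4 (R : realType) (X : topologicalType) (K : cw_complex R X)
    (A : set X) (m : nat) (Xm : topologicalType) (p : continuousType X Xm) :
  cw_finite K -> simple_space R X ->
  cofibration R (set_val : A -> X) ->
  cw_dim_le K m ->
  cw_homotopy_type R Xm -> postnikov_stage R m p -> cofibration R p ->
  cofibration R (p \o (set_val : A -> X)) /\
  group_isomorphic (pi0_aut R (p \o (set_val : A -> X)))
                   (pi0_aut R (set_val : A -> X)).
Proof.
move=> fK [[[x0 _] _] _] hA hm hY hp hcp; split; first exact: cofibration_comp.
exact: (@pi0_aut_isomorphic R X K A m Xm p x0).
Qed.
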